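(* Let $B_2(0)\subset\mathbb{R}^2$. There exist a continuous (symmetric) coefficient matrix $A$ on $B_2(0)$, a function $u\in W^{1,2}(B_2(0))$ with $u\not\equiv0$, and positive constants $\lambda$ and $\Lambda$ such that: (1) $A$ is uniformly elliptic, i.e. $(1+\lambda)^{-1}I\le A(x)\le(1+\lambda)I$; (2) $u$ is a weak solution of $\mathrm{div}(A\nabla u)=0$ in $B_2(0)$; (3) the doubling property holds for every ball $B_{2r}(x)\subset B_2(0)$: $\fint_{B_{2r}(x)}u^2\le4^\Lambda\fint_{B_r(x)}u^2$; (4) the nodal set has infinite length, i.e. $\mathcal{H}^1(Z(u)\cap B_1(0))=\infty$.
   Context: $\fint$ denotes the average, $\mathcal{H}^1$ is one-dimensional Hausdorff measure, and $Z(u)=\{x:u(x)=0\}$ for the continuous representative of $u$. *)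

(* Defs.v *)
From HB Require Import structures.
From mathcomp Require Import all_boot all_order all_algebra.
From mathcomp Require Import all_classical all_reals all_analysis.

Set Implicit Arguments.
Unset Strict Implicit.
Unset Printing Implicit Defensive.

Import Order.TTheory GRing.Theory Num.Theory.
Import numFieldNormedType.Exports.

Local Open Scope classical_set_scope.
Local Open Scope ring_scope.

(* The plane is the product type R * R, which carries the product topology and
   the product sigma-algebra.  Its library norm is the sup norm, so Euclidean
   distances and balls are introduced separately. *)

Section plane.
Variable R : realType.

(* Stated on measurableTypeR R, which is convertible to R, so that the
   sigma-algebra is the one on which the library defines lebesgue_measure. *)
Definition plane_measure :
    set (measurableTypeR R * measurableTypeR R) -> \bar R :=
  (@lebesgue_measure R \x @lebesgue_measure R)%E.

HB.instance Definition _ := Measure.on plane_measure.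

Definition edist (x y : R * R) : R :=
  Num.sqrt ((x.1 - y.1) ^+ 2 + (x.2 - y.2) ^+ 2).

Definition eball (x : R * R) (r : R) : set (R * R) := [set y | edist x y < r].

Definition average (D : set (R * R)) (f : R * R -> R) : R :=
  (fine (plane_measure D))^-1 * \int[plane_measure]_(x in D) f x.

Definition basis_vector (i : 'I_2) : R * R := if i == 0 then (1, 0) else (0, 1).

Definition partial (i : 'I_2) (f : R * R -> R) : R * R -> R :=
  fun x => 'D_(basis_vector i) f x.

Definition gradient (f : R * R -> R) (x : R * R) : 'cV[R]_2 :=
  \col_i partial i f x.

(* C^infinity: every iterated partial derivative exists and is continuous. *)
Definition smooth (f : R * R -> R) : Prop :=
  forall s : seq 'I_2,
    continuous (foldr partial f s) /\
    forall (i : 'I_2) (x : R * R),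
      derivable (foldr partial f s) x (basis_vector i).

Definition closed_support (f : R * R -> R) : set (R * R) :=
  closure [set x | f x != 0].

Definition test_function (D : set (R * R)) (phi : R * R -> R) : Prop :=
  [/\ smooth phi, compact (closed_support phi) & closed_support phi `<=` D].

(* Only the values on D matter, here and in all the notions below. *)
Definition square_integrable (D : set (R * R)) (f : R * R -> R) : Prop :=
  measurable_fun (D : set (measurableTypeR R * measurableTypeR R)) f /\
  (\int[plane_measure]_(x in D) ((f x) ^+ 2)%:E < +oo)%E.

Definition weak_gradient (D : set (R * R)) (u : R * R -> R)
    (g : R * R -> 'cV[R]_2) : Prop :=
  forall phi, test_function D phi -> forall i : 'I_2,
    \int[plane_measure]_(x in D) (u x * partial i phi x) =
    - \int[plane_measure]_(x in D) (g x i 0 * phi x).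

Definition L2_weak_gradient (D : set (R * R)) (u : R * R -> R)
    (g : R * R -> 'cV[R]_2) : Prop :=
  (forall i : 'I_2, square_integrable D (fun x => g x i 0)) /\
  weak_gradient D u g.

Definition sobolev_W12 (D : set (R * R)) (u : R * R -> R) : Prop :=
  square_integrable D u /\ exists g, L2_weak_gradient D u g.

(* The weak gradient is unique almost everywhere on an open set, so the choice
   of g is immaterial. *)
Definition weak_solution (D : set (R * R)) (A : R * R -> 'M[R]_2)
    (u : R * R -> R) : Prop :=
  exists2 g, L2_weak_gradient D u g &
    forall phi, test_function D phi ->
      \int[plane_measure]_(x in D)
        ((A x *m g x)^T *m gradient phi x) 0 0 = 0.

Definition loewner_le (M N : 'M[R]_2) : Prop :=
  forall v : 'cV[R]_2, 0 <= (v^T *m (N - M) *m v) 0 0.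

Definition continuous_representative (D : set (R * R)) (u v : R * R -> R) :
    Prop :=
  {within D, continuous v} /\ {ae plane_measure, forall x, D x -> v x = u x}.

Definition nodal_set (D : set (R * R)) (v : R * R -> R) : set (R * R) :=
  [set x | D x /\ v x = 0].

(* Adjoining 0 gives the empty set diameter 0 instead of -oo. *)
Definition diameter (U : set (R * R)) : \bar R :=
  ereal_sup ([set 0%E] `|`
    [set z | exists x y, [/\ U x, U y & z = (edist x y)%:E]]).

Definition hausdorff1_pre (delta : R) (S : set (R * R)) : \bar R :=
  ereal_inf [set s | exists U : nat -> set (R * R),
    [/\ forall k, (diameter (U k) <= delta%:E)%E,
        S `<=` \bigcup_k U k &
        s = (\sum_(0 <= k <oo) diameter (U k))%E]].

Definition hausdorff1 (S : set (R * R)) : \bar R :=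
  ereal_sup [set hausdorff1_pre delta S | delta in [set d : R | 0 < d]].

End plane.

(* Main.v *)
Require Import Defs.
From mathcomp Require Import all_boot all_order all_algebra.
From mathcomp Require Import all_classical all_reals all_analysis.
From mathcomp Require Import measurable_realfun ring lra.

(** The solution is [u = Im F], where [F] is the limit of the compositions of the
    maps G_k z = z + (a_k / N_k) P_k (N_k z).  Here P_k is
    i sin z - (3 a_k / 8) sin (2 z) cut off in Im z, so that G_k is conformal for
    N_k |Im z| <= 1 and the identity for N_k |Im z| >= 2; the amplitudes are
    a_k = a / sqrt (k + 1), and the frequencies N_k grow superexponentially.

    The coefficient matrix is the pullback of the identity under [F], for which
    [A *m gradient u] is the rotated gradient of [Re F]: this is divergence free
    because mixed derivatives commute.  A point stays in the conformal strips up
    to a last step, which makes an error of relative size O (a_k); hence [A] is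
    elliptic, and since a_k -> 0 it extends by the identity, continuously, to the
    nodal set [u = 0], which is the set of points that never leave the strips.

    On the nodal set |G_k'|^2 <= 1 - a_k^2 / 4 at every step.  Since the sum of
    a_k^2 diverges, the differential of [F] vanishes there, so [F] contracts
    short distances on the nodal set by arbitrarily large factors; but it maps
    this set onto the real line, so the set has infinite length.

    At every point and scale, [F] is within a small relative error of an affine
    conformal map: the maps of low frequency are nearly affine at this scale and
    those of high frequency nearly the identity.  This gives the doubling
    property. *)

Set Implicit Arguments.
Unset Strict Implicit.
Unset Printing Implicit Defensive.

Import Order.TTheory GRing.Theory Num.Theory.
Import numFieldNormedType.Exports.

Local Open Scope classical_set_scope.
Local Open Scope ring_scope.

(** * Integration by parts on the plane *)

Section plane_measurability.
Variable R : realType.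
Local Notation mR := (measurableTypeR R).

(** The contraction has to hold at every nodal point, not on average. For i sin z alone, |G'|^2 on
    the curve Im G = 0 is 1 + a^2 (1 - 3 sin^2 (Re z)) to second order, which exceeds 1 near the
    zeros of the sine; the second harmonic evens this out, so no equidistribution of the orbit is
    needed. The gain a^2 is of higher order than the distortion a, and this is what reconciles
    continuity of the matrix (a_k -> 0) with infinite length (divergent sum of a_k^2).

    The gain is available only within O(a_k^3 / N_k) of the curve, so the next strip must be that
    thin. Moreover N_k must dominate the second-order constant of the preceding composition, so that
    at each scale at most one map is neither nearly affine nor nearly the identity. Both demands are
    built into one recursion for the frequencies.

    The limit is never differentiated. Its weak gradient is the pointwise limit of the differentials
    of the compositions: eventually constant off the nodal set, 0 on it. Re F gets its weak gradient
    in the same way and serves both as conjugate function and as parameter of the nodal set. *)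

Lemma open_plane_measurable (U : set (R * R)) :
  open U -> measurable (U : set (mR * mR)).
Proof.
move=> oU.
(* The plane carries the product sigma-algebra, so an open set must be exhausted by countably many
   rectangles; rational corners provide them. *)
pose box (q : (rat * rat) * (rat * rat)) : set (mR * mR) :=
  `]ratr q.1.1, ratr q.1.2[%classic `*` `]ratr q.2.1, ratr q.2.2[%classic.
have -> : U = \bigcup_(q in [set q | box q `<=` U]) box q.
  apply/seteqP; split=> [x Ux|x [q qU bx]]; last exact: qU.
  have /nbhs_ballP[e /= e0 eU] := open_nbhs_nbhs (conj oU Ux).
  have ra (t : R) : exists p : rat * rat, [/\ t - e < ratr p.1, ratr p.1 < t,
       t < ratr p.2 & ratr p.2 < t + e].
    have [a] := rat_in_itvoo (ltac:(lra) : t - e < t).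
    have [b] := rat_in_itvoo (ltac:(lra) : t < t + e).
    rewrite !in_itv/= => /andP[? ?] /andP[? ?]; by exists (a, b).
  have [p [p1 p2 p3 p4]] := ra x.1; have [q [q1 q2 q3 q4]] := ra x.2.
  exists (p, q); last by split; rewrite /= in_itv/=; apply/andP.
  move=> y [/= ]; rewrite !in_itv/= => /andP[? ?] /andP[? ?]; apply: eU.
  by split; rewrite /ball/= ltr_norml; apply/andP; split; lra.
rewrite bigcup_mkcond; apply: countable_bigcupT_measurable => [|q].
  exact: countableP.
case: ifPn => _; last exact: measurable0.
by apply: measurableX; exact: measurable_itv.
Qed.

Lemma continuous_plane_measurable (D : set (R * R)) (f : R * R -> R) :
  measurable (D : set (mR * mR)) -> continuous f ->
  measurable_fun (D : set (mR * mR)) (f : mR * mR -> mR).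
Proof.
move=> mD /continuousP cf; apply: (measurability _ (RGenOpens.measurableE R)).
move=> _ [_ [a [b ->] <-]]; apply: measurableI => //.
apply: open_plane_measurable; apply: cf; exact: itv_open.
Qed.

End plane_measurability.

Section integration_by_parts.
Variable R : realType.
Local Notation mR := (measurableTypeR R).
Local Notation mu := (@plane_measure R).

Lemma plane_measure_box (a b c d : R) : a <= b -> c <= d ->
  mu (`[a, b] `*` `[c, d]) = ((b - a) * (d - c))%:E.
Proof.
move=> ab cd; rewrite /plane_measure product_measure1E; [|exact: measurable_itv..].
rewrite /= !lebesgue_measure_itv/= !lte_fin.
have e (x y : R) : x <= y -> (if (x < y)%R then y%:E - x%:E else 0)%E = (y - x)%:E.
  by case: ltgtP => // -> _; rewrite subrr.
by rewrite !e.
Qed.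

Definition supported_in_box (M : R) (f : R * R -> R) :=
  forall x, f x != 0 -> `|x.1| <= M /\ `|x.2| <= M.

Lemma bounded_on_box (M : R) (f : R * R -> R) : continuous f ->
  exists K, forall x, `|x.1| <= M -> `|x.2| <= M -> `|f x| <= K.
Proof.
move=> cf.
have cK : compact (`[- M, M]%classic `*` `[- M, M]%classic : set (R * R)).
  by apply: compact_setX; exact: segment_compact.
have [K [Kr KP]] := compact_bounded
  (continuous_compact (continuous_subspaceT cf) cK).
exists (K + 1) => x x1 x2; apply: (KP (K + 1)); first by rewrite ltrDl.
by exists x => //; split; rewrite /= in_itv/= -ler_norml.
Qed.

Lemma integrable_supported (M : R) (f : R * R -> R) (D : set (R * R)) :
  0 <= M -> measurable (D : set (mR * mR)) ->
  continuous f -> supported_in_box M f -> mu.-integrable D (EFin \o f).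
Proof.
move=> M0 mD cf sf.
pose B := (`[- M, M]%classic `*` `[- M, M]%classic : set (mR * mR)).
have mB : measurable B by apply: measurableX; exact: measurable_itv.
have fB : mu.-integrable B (EFin \o f).
  have [K KP] := bounded_on_box M cf.
  apply: measurable_bounded_integrable => //.
  - by rewrite /= plane_measure_box ?ltry//; lra.
  - exact: continuous_plane_measurable.
  - exists K; split; [exact: num_real|] => t Kt x [/=]; rewrite !in_itv/= -!ler_norml => x1 x2.
    exact: le_trans (KP _ x1 x2) (ltW Kt).
apply: integrableS (_ : mu.-integrable setT _) => //; move: fB.
rewrite (integrable_mkcond _ mB); congr integrable; apply/funext => x.
rewrite /restrict/=; case: ifPn => // xB; have [->//|/sf[x1 x2]] := eqVneq (f x) 0.
by move: xB; rewrite notin_setE => -[]; split; rewrite /= in_itv/= -ler_norml.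
Qed.

(** Along such a line a partial derivative becomes a derivative of one real variable, which gives
    access to the fundamental theorem of calculus. *)
Definition line (i : 'I_2) (x : R * R) (t : R) : R * R :=
  if i == 0 then (t, x.2) else (x.1, t).

Lemma line_quotient (f : R * R -> R) i x t :
  (fun h : R => h^-1 *: ((f \o shift (line i x t)) (h *: basis_vector R i)
     - f (line i x t))) =
  (fun h : R => h^-1 *: ((((f \o line i x) : R -> R) \o shift t) (h *: 1)
     - (f \o line i x) t)).
Proof.
apply/funext => h /=; congr (_ *: (_ - _)); congr f.
rewrite /line /basis_vector; case: ifP => _;
  by apply: injective_projections; rewrite /= ?scaler0 ?add0r.
Qed.

Lemma derivable_line (f : R * R -> R) i x t :
  derivable f (line i x t) (basis_vector R i) <->
  derivable ((f \o line i x) : R -> R) t 1.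
Proof. by rewrite /derivable line_quotient. Qed.

Lemma partial_line (f : R * R -> R) i x t :
  partial i f (line i x t) = 'D_1 ((f \o line i x) : R -> R) t.
Proof. by rewrite /partial /derive line_quotient. Qed.

Lemma integral_derive_supported (M : R) (f : R -> R) : 0 < M ->
  (forall t, derivable f t 1) -> continuous (f^`()%classic : R -> R) ->
  (forall t, f t != 0 -> `|t| <= M) ->
  (\int[@lebesgue_measure R]_t (f^`()%classic t)%:E = 0)%E.
Proof.
move=> M0 df cf sf.
have f0 t : M < `|t| -> f t = 0.
  by move=> Mt; apply/eqP; apply: contraTT Mt => /sf; rewrite leNgt.
have f'0 t : M < `|t| -> f^`()%classic t = 0.
  move=> Mt; rewrite derive1E (@near_eq_derive _ _ _ _ (cst 0)) ?derive_cst//.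
  have : \forall s \near t, M < `|s|.
    exact: (cvgr_gt _ (@norm_continuous R R^o t)).
  by apply: filterS => s /f0.
have cf1 : continuous f.
  by move=> t; apply: differentiable_continuous; apply/derivable1_diffP.
(* The interval reaches beyond [M] because the support condition does not exclude a nonzero value at
   [M] itself. *)
transitivity (\int[@lebesgue_measure R]_(t in `[(- (M + 1))%R, (M + 1)%R])
    (f^`()%classic t)%:E)%E.
  rewrite [RHS]integral_mkcond; congr integral; apply/funext => t.
  rewrite /restrict; case: ifPn => //; rewrite notin_setE/= in_itv/= -ler_norml.
  by move/negP; rewrite -ltNge => h; rewrite f'0//; apply: lt_trans h; rewrite ltrDl.
rewrite (@continuous_FTC2 _ _ f).
- have M1 : M < `|M + 1| by rewrite gtr0_norm ?ltrDl// addr_gt0.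
  by rewrite !f0 ?normrN// subee.
- lra.
- exact: continuous_subspaceT.
- split=> [t _||]; [exact: df|apply: cvg_at_right_filter; exact: cf1|apply: cvg_at_left_filter; exact: cf1].
- by [].
Qed.

(** Fubini with the variable [i] innermost: every inner integral is that of the derivative of a
    function vanishing off a bounded interval. *)
Lemma integral_partial_supported (M : R) (f : R * R -> R) i : 0 < M ->
  (forall x, derivable f x (basis_vector R i)) -> continuous (partial i f) ->
  supported_in_box M f -> supported_in_box M (partial i f) ->
  \int[mu]_x partial i f x = 0.
Proof.
move=> M0 df cf sf sdf.
have intf := integrable_supported (ltW M0) measurableT cf sdf.
have cl x : continuous (line i x).
  move=> t; apply/cvg_ballP => e e0; near=> s.
  have sb : ball t e s by near: s; apply/nbhs_ballP; exists e.
  by rewrite /line; case: (i == 0); split=> //=; exact: ballxx.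
have inner x : (\int[@lebesgue_measure R]_t (partial i f (line i x t))%:E = 0)%E.
  have e : (fun t => partial i f (line i x t)) = ((f \o line i x) : R -> R)^`()%classic.
    by apply/funext => t; rewrite partial_line derive1E.
  transitivity (\int[@lebesgue_measure R]_t
      (((f \o line i x) : R -> R)^`()%classic t)%:E)%E.
    by apply: eq_integral => t _; rewrite -e.
  apply: (@integral_derive_supported M) => //.
  - by move=> t; apply/derivable_line.
  - rewrite -e => t; apply: continuous_comp; [exact: cl|exact: cf].
  - by move=> t /sf; rewrite /line; case: ifP => _ [].
rewrite /Rintegral.
case: (eqVneq i 0) => [i0|i1].
- rewrite -(integral21_prod_meas1 intf) /fubini_G integral0_eq//= => y _.
  by have := inner (0, y); rewrite /line i0.
- rewrite -(integral12_prod_meas1 intf) /fubini_F integral0_eq//= => x _.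
  by have := inner (x, 0); rewrite /line (negPf i1).
Unshelve. all: by end_near. Qed.

End integration_by_parts.

(** * Test functions and weak gradients of pointwise limits *)

Section weak_gradients.
Variable R : realType.
Local Notation mR := (measurableTypeR R).
Local Notation mu := (@plane_measure R).

Lemma test_function_supported (D : set (R * R)) phi : test_function D phi ->
  exists2 M, 0 < M & supported_in_box M phi.
Proof.
move=> [_ cphi _]; have [M [Mr MP]] := compact_bounded cphi.
exists (`|M| + 1) => [|x x0]; first by rewrite ltr_wpDl.
have xM : `|x| <= `|M| + 1.
  apply: (MP (`|M| + 1)); last exact: subset_closure.
  by rewrite (le_lt_trans (ler_norm M))// ltrDl.
by move: xM; rewrite prod_normE ge_max => /andP[].
Qed.

Lemma test_function_eq0 (D : set (R * R)) phi x : test_function D phi ->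
  ~ D x -> phi x = 0.
Proof.
move=> [_ _ sD] Dx; apply/eqP; apply: contra_notT Dx => x0.
by apply: sD; exact: subset_closure.
Qed.

Lemma test_function_partial (D : set (R * R)) phi i : test_function D phi ->
  test_function D (partial i phi).
Proof.
move=> [sphi cphi sD].
have sub : closed_support (partial i phi) `<=` closed_support phi.
  rewrite [X in _ `<=` X](closure_id _).1; last exact: closed_closure.
  apply: closure_subset => x /=; apply: contraPP => xs; apply/negP; rewrite negbK.
  have : \forall y \near x, phi y = 0.
    have : nbhs x (~` closed_support phi).
      by apply: open_nbhs_nbhs; split => //; apply: closed_openC; exact: closed_closure.
    apply: filterS => y ys; apply/eqP; apply: contra_notT ys => y0; exact: subset_closure.
  move=> h; apply/eqP; rewrite /partial (@near_eq_derive _ _ _ _ (cst 0)) ?derive_cst//.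
split.
- move=> s; have := sphi (rcons s i).
  by rewrite foldr_rcons.
- by apply: subclosed_compact sub => //; exact: closed_closure.
- exact: subset_trans sD.
Qed.

Lemma test_function_continuous (D : set (R * R)) phi : test_function D phi ->
  continuous phi.
Proof. by move=> [/(_ [::])[]]. Qed.

Lemma test_function_derivable (D : set (R * R)) phi i x : test_function D phi ->
  derivable phi x (basis_vector R i).
Proof. by move=> [/(_ [::])[_ +] _ _] => /(_ i x). Qed.

Lemma integrable_mul_test (D : set (R * R)) (f phi : R * R -> R) :
  measurable (D : set (mR * mR)) ->
  continuous f -> test_function D phi ->
  mu.-integrable D (EFin \o (fun x => f x * phi x)).
Proof.
move=> mD cf tphi; have [M M0 sM] := test_function_supported tphi.
apply: (@integrable_supported _ M); [exact: ltW|by []| |].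
  by move=> x; apply: cvgM; [exact: cf|exact: (test_function_continuous tphi)].
by move=> x; rewrite mulf_eq0 negb_or => /andP[_ /sM].
Qed.

(** There is no boundary term: [f * phi] vanishes off [D], so the two integrals add up to the
    integral over the whole plane of a partial derivative with bounded support. *)
Lemma integral_by_parts_test (D : set (R * R)) (f phi : R * R -> R) i :
  measurable (D : set (mR * mR)) ->
  continuous f -> (forall x, derivable f x (basis_vector R i)) ->
  continuous (partial i f) -> test_function D phi ->
  \int[mu]_(x in D) (f x * partial i phi x) =
  - \int[mu]_(x in D) (partial i f x * phi x).
Proof.
move=> mD cf df cdf tphi; have tdphi := test_function_partial i tphi.
have [M M0 sM] := test_function_supported tphi.
have [M' M'0 sM'] := test_function_supported tdphi.
apply/eqP; rewrite -addr_eq0; apply/eqP.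
rewrite -RintegralD//; [|exact: integrable_mul_test..].
pose psi := f * phi.
have dpsi x : is_derive x (basis_vector R i) psi
    (f x * partial i phi x + partial i f x * phi x).
  have dphi := @test_function_derivable _ _ i x tphi.
  have d1 : is_derive x (basis_vector R i) phi (partial i phi x) by exact: derivableP dphi.
  have d2 : is_derive x (basis_vector R i) f (partial i f x) by exact: derivableP (df x).
  move: (partial i phi x) (partial i f x) d1 d2 => a b d1 d2.
  rewrite [b * _]mulrC; exact: is_deriveM.
have psiE : partial i psi = fun x => f x * partial i phi x + partial i f x * phi x.
  by apply/funext => x; rewrite /partial; exact: derive_val.
have cphi := test_function_continuous tphi.
have cdphi := test_function_continuous tdphi.
rewrite -(@integral_partial_supported _ (Num.max M M') psi i).
- rewrite Rintegral_mkcond psiE; congr Rintegral; apply/funext => x.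
  rewrite /restrict; case: ifPn => //; rewrite notin_setE => Dx.
  by rewrite (test_function_eq0 tphi Dx) (test_function_eq0 tdphi Dx) !mulr0 addr0.
- by rewrite lt_max M0.
- by move=> x; exact: ex_derive.
- rewrite psiE => x; apply: cvgD.
    by apply: cvgM; [exact: cf|exact: cdphi].
  by apply: cvgM; [exact: cdf|exact: cphi].
- move=> x; rewrite /psi mulf_eq0 negb_or => /andP[_ /sM[]].
  by rewrite !le_max => -> ->.
- move=> x; rewrite psiE => x0; rewrite !le_max.
  have [e|/sM[-> ->]//] := eqVneq (phi x) 0.
  have [e'|/sM'[-> ->]] := eqVneq (partial i phi x) 0; last by rewrite !orbT.
  by move: x0; rewrite e e' !mulr0 addr0 eqxx.
Qed.

Lemma Rintegral_mul_test_cvg (D : set (R * R)) (h_ : nat -> R * R -> R)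
    (h phi : R * R -> R) (K : R) :
  measurable (D : set (mR * mR)) ->
  (forall k, continuous (h_ k)) ->
  (forall x, D x -> h_ ^~ x @ \oo --> h x) ->
  (forall k x, D x -> `|h_ k x| <= K) -> test_function D phi ->
  (\int[mu]_(x in D) (h_ k x * phi x)) @[k --> \oo] -->
  \int[mu]_(x in D) (h x * phi x).
Proof.
move=> mD ch hh hK tphi; have cphi := test_function_continuous tphi.
have [M M0 sM] := test_function_supported tphi.
have mh_ k : measurable_fun (D : set (mR * mR)) (h_ k).
  exact: continuous_plane_measurable.
have mh : measurable_fun (D : set (mR * mR)) h by exact: measurable_fun_cvg hh.
have mphi : measurable_fun (D : set (mR * mR)) phi.
  exact: continuous_plane_measurable.
have [|||||i _ c] := @dominated_convergence _ _ _ mu D mD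
  (fun k x => (h_ k x * phi x)%:E) (fun x => (h x * phi x)%:E)
  (EFin \o (fun x => `|K * phi x|)).
- by move=> k; apply/measurable_EFinP; exact: measurable_funM.
- by apply/measurable_EFinP; exact: measurable_funM.
- apply: aeW => x Dx; apply: cvg_EFin; first by near=> k.
  by apply: cvgMl; exact: hh.
- apply: (@integrable_supported _ M); [exact: ltW|by []| |].
    move=> x; apply: (@continuous_comp _ _ _ (fun x => K * phi x) (fun y : R => `|y|)).
      by apply: cvgMr; exact: cphi.
    exact: norm_continuous.
  by move=> x; rewrite normr_eq0 mulf_eq0 negb_or => /andP[_ /sM].
- apply: aeW => x k Dx; rewrite lee_fin !normrM ler_wpM2r//.
  exact: le_trans (hK _ _ Dx) (ler_norm _).
- apply: fine_cvg; rewrite fineK//; exact: integrable_fin_num.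
Unshelve. all: by end_near. Qed.

(** Dominated convergence carries integration by parts to the limit, which needs no
    differentiability of its own. This is how the limit map acquires a weak gradient across the
    nodal set. *)
Lemma weak_gradient_limit (D : set (R * R)) (f_ : nat -> R * R -> R)
    (f : R * R -> R) (g : R * R -> 'cV[R]_2) (K : R) :
  measurable (D : set (mR * mR)) ->
  (forall k, continuous (f_ k)) ->
  (forall k i x, derivable (f_ k) x (basis_vector R i)) ->
  (forall k i, continuous (partial i (f_ k))) ->
  (forall x, D x -> f_ ^~ x @ \oo --> f x) ->
  (forall i x, D x -> partial i (f_ k) x @[k --> \oo] --> g x i 0) ->
  (forall k x, D x -> `|f_ k x| <= K) ->
  (forall k i x, D x -> `|partial i (f_ k) x| <= K) ->
  weak_gradient D f g.
Proof.
move=> mD cf df cdf ff dff fK dfK phi tphi i.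
have l1 := Rintegral_mul_test_cvg mD cf ff fK (test_function_partial i tphi).
have l2 := Rintegral_mul_test_cvg mD (cdf^~ i) (dff i) (fun k => dfK k i) tphi.
apply: (cvg_unique (@Rhausdorff R) l1).
rewrite (_ : (fun k => _) = fun k => - \int[mu]_(x in D) (partial i (f_ k) x * phi x)).
  exact: cvgN l2.
by apply/funext => k; exact: integral_by_parts_test.
Qed.

End weak_gradients.

(** * Mixed derivatives commute *)

Section mixed_derivatives.
Variables (R : realType) (V : normedModType R).
Implicit Types (f : V -> R) (x v w : V).

Lemma is_derive_along f x v t : derivable f (x + t *: v) v ->
  is_derive t 1 (fun s : R => f (x + s *: v)) ('D_v f (x + t *: v)).
Proof.
move=> df; have e : (fun h : R => h^-1 *: ((f \o shift (x + t *: v)) (h *: v)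
      - f (x + t *: v))) =
   (fun h : R => h^-1 *: (((fun s : R => f (x + s *: v)) \o shift t) (h *: 1)
      - f (x + t *: v))).
  apply/funext => h /=; congr (_ *: (f _ - _)).
  by rewrite [h *: 1]mulr1 scalerDl addrCA.
split; first by rewrite /derivable -e.
by rewrite /derive -e.
Qed.

Lemma continuous_along f x v : (forall y, derivable f y v) ->
  continuous (fun s : R => f (x + s *: v)).
Proof.
move=> df t; apply: differentiable_continuous; apply/derivable1_diffP.
exact: (@ex_derive _ _ _ _ _ _ _ (is_derive_along (df _))).
Qed.

(** Two applications of the mean value theorem: in direction [v] to the difference of [f] along [w],
    then in direction [w] to ['D_v f]. *)
Lemma mixed_difference f x v w h : 0 < h ->
  (forall y, derivable f y v) -> (forall y, derivable ('D_v f) y w) ->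
  exists s t, [/\ 0 < s < h, 0 < t < h &
    f (x + h *: v + h *: w) - f (x + h *: v) - (f (x + h *: w) - f x) =
    h ^+ 2 * 'D_w ('D_v f) (x + s *: v + t *: w)].
Proof.
move=> h0 dv dw.
pose g (s : R) : R := f (x + h *: w + s *: v) - f (x + s *: v).
pose g' (s : R) : R := 'D_v f (x + h *: w + s *: v) - 'D_v f (x + s *: v).
have dg (s : R) : is_derive s 1 g (g' s).
  by apply: is_deriveB; exact: is_derive_along.
have cg : continuous g.
  by move=> s; apply: cvgB; exact: continuous_along.
have [s sh gE] := MVT h0 (fun s _ => dg s) (continuous_subspaceT cg).
have [t th kE] := MVT h0 (fun (t : R) _ => is_derive_along (dw (x + s *: v + t *: w)))
  (continuous_subspaceT (@continuous_along _ (x + s *: v) _ dw)).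
exists s, t; split; [by rewrite in_itv in sh|by rewrite in_itv in th|].
move: gE kE; rewrite /g /g' !subr0 !scale0r !addr0 => gE kE.
rewrite [x + h *: v + _]addrAC gE [x + h *: w + _]addrAC kE; ring.
Qed.

(** The second difference is symmetric in [v] and [w], so the two mixed derivatives agree at a pair
    of points arbitrarily close to [x]; continuity at [x] does the rest. *)
Lemma derive_comm f x v w :
  (forall y, derivable f y v) -> (forall y, derivable f y w) ->
  (forall y, derivable ('D_v f) y w) -> (forall y, derivable ('D_w f) y v) ->
  {for x, continuous ('D_w ('D_v f))} -> {for x, continuous ('D_v ('D_w f))} ->
  'D_w ('D_v f) x = 'D_v ('D_w f) x.
Proof.
move=> dv dw dvw dwv c1 c2; apply/eqP; rewrite -subr_eq0 -normr_le0.
apply/ler_addgt0Pl => e e0; rewrite addr0.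
have e2 : 0 < e / 2 by rewrite divr_gt0.
have /cvgr_dist_le /(_ _ e2) /nbhs_ballP[d1 /= d10 B1] := c1.
have /cvgr_dist_le /(_ _ e2) /nbhs_ballP[d2 /= d20 B2] := c2.
pose N := `|v| + `|w| + 1.
have N0 : 0 < N by rewrite ltr_wpDl// addr_ge0.
pose d := Num.min d1 d2.
have d0 : 0 < d by rewrite lt_min d10.
pose h := d / N.
have h0 : 0 < h by rewrite divr_gt0.
have near s t v' w' : 0 < s < h -> 0 < t < h -> `|v'| + `|w'| = `|v| + `|w| ->
    `|x - (x + s *: v' + t *: w')| < d.
  move=> /andP[s0 sh] /andP[t0 th] vw.
  rewrite -addrA opprD addNKr normrN (le_lt_trans (ler_normD _ _))//.
  rewrite !normrZ !gtr0_norm//.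
  have : s * `|v'| + t * `|w'| <= h * (`|v'| + `|w'|).
    by rewrite mulrDr lerD// ler_wpM2r// ltW.
  move/le_lt_trans; apply; rewrite vw /h mulrAC ltr_pdivrMr// ltr_pM2l// /N.
  by rewrite ltrDl.
have [s [t [sh th E1]]] := mixed_difference x h0 dv dvw.
have [s' [t' [sh' th' E2]]] := mixed_difference x h0 dw dwv.
have E : 'D_w ('D_v f) (x + s *: v + t *: w) =
         'D_v ('D_w f) (x + s' *: w + t' *: v).
  rewrite [x + h *: w + _]addrAC in E2; move: E1 E2.
  move: ('D_w _ _) ('D_v _ (_ + _ + _)) => p q E1 E2.
  apply: (@mulfI _ (h ^+ 2)); first by rewrite expf_neq0// gt_eqF.
  rewrite -E1 -E2.
  by move: (f _) (f _) (f _) (f _) => a b c a0; ring.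
have n1 := near _ _ _ _ sh th erefl.
have n2 := near _ _ _ _ sh' th' (addrC _ _).
rewrite lt_min in n1; rewrite lt_min in n2.
move/andP: n1 => [n1 _]; move/andP: n2 => [_ n2].
have := B1 (x + s *: v + t *: w); rewrite -ball_normE => /(_ n1) /= b1.
have := B2 (x + s' *: w + t' *: v); rewrite -ball_normE => /(_ n2) /= b2.
rewrite -E distrC in b2.
move: b1 b2; move: ('D_w _ _) ('D_w _ x) ('D_v _ x) => p q r b1 b2.
by apply: le_trans (ler_distD p q r) _; rewrite [leRHS]splitr lerD.
Qed.

End mixed_derivatives.

(** * Functions with bounded derivatives *)

Section quadratic_remainder.
Variables (R : realType) (V : normedModType R).

(** Trades the limit of difference quotients for an inequality, which for piecewise polynomials is
    settled by case analysis and for [c11] functions is part of the definition. *)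
Lemma is_derive_quadratic (f : V -> R) (x v : V) (d K : R) :
  (forall h : R, `|f (x + h *: v) - f x - h * d| <= K * h ^+ 2) ->
  is_derive x v f d.
Proof.
move=> fK; have K0 : 0 <= K.
  by have := le_trans (normr_ge0 _) (fK 1); rewrite expr1n mulr1.
suff c : h^-1 *: ((f \o shift x) (h *: v) - f x) @[h --> (0 : R)^'] --> d.
  split; first by apply/cvg_ex; exists d.
  exact: (cvg_lim (@Rhausdorff R) c).
apply/cvgrPdist_le => e e0; near=> h.
have h0 : h != 0 by near: h; exact: nbhs_dnbhs_neq.
have hs : `|h| <= e / (K + 1).
  near: h; apply: dnbhs0_le; by rewrite divr_gt0// ltr_wpDl.
have -> : d - h^-1 *: ((f \o shift x) (h *: v) - f x)
    = - h^-1 * (f (x + h *: v) - f x - h * d).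
  rewrite /= [h *: v + x]addrC /GRing.scale/=.
  by move: (f _) (f _) => p q; field.
rewrite normrM normrN normfV -ler_pdivlMl ?invr_gt0 ?normr_gt0// invrK.
rewrite (le_trans (fK h))// -(@real_normK _ h) ?num_real//.
rewrite ler_pdivlMr ?ltr_wpDl// in hs.
by move: (normr_ge0 h) hs; move: `|h| => t t0 hs; nra.
Unshelve. all: by end_near. Qed.

End quadratic_remainder.

Section real_functions.
Variable R : realType.
Implicit Types f g df dg : R -> R.

Definition bounded_lipschitz f := exists K, forall x,
  `|f x| <= K /\ forall y, `|f y - f x| <= K * `|y - x|.

(** The class C^{1,1} with global bounds. Lipschitz first derivatives are all that the construction
    uses, so a piecewise polynomial cutoff is good enough. *)
Definition smooth11 f df := [/\ forall x : R, is_derive x (1 : R) f (df x),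
  bounded_lipschitz df & exists K, forall x, `|f x| <= K].

Lemma mean_value f df (x y : R) : (forall x : R, is_derive x (1 : R) f (df x)) ->
  exists2 c, `|c - x| <= `|y - x| & f y - f x = df c * (y - x).
Proof.
move=> dfx; have cf : continuous f.
  by move=> t; apply: differentiable_continuous; apply/derivable1_diffP.
have mvt a b : a < b -> exists2 c, a < c < b & f b - f a = df c * (b - a).
  move=> ab; have [c] := MVT ab (fun x _ => dfx x) (continuous_subspaceT cf).
  by rewrite in_itv; exists c.
case: (ltgtP x y) => [/mvt[c /andP[xc cy] e]|/mvt[c /andP[yc cx] e]|->].
- by exists c => //; rewrite !gtr0_norm; lra.
- by exists c; [rewrite !ltr0_norm; lra|rewrite -opprB e; ring].
- by exists y; rewrite ?subrr ?mulr0 ?normr0.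
Qed.

Lemma bounded_lipschitz_const c : bounded_lipschitz (fun=> c).
Proof. by exists `|c| => x; split=> // y; rewrite subrr normr0 mulr_ge0. Qed.

Lemma bounded_lipschitzD f g : bounded_lipschitz f -> bounded_lipschitz g ->
  bounded_lipschitz (fun x => f x + g x).
Proof.
move=> [K fK] [L gL]; exists (K + L) => x; have [f1 f2] := fK x.
have [g1 g2] := gL x; split; first by rewrite (le_trans (ler_normD _ _))// lerD.
move=> y; rewrite opprD addrACA (le_trans (ler_normD _ _))// mulrDl lerD//.
Qed.

Lemma bounded_lipschitzM f g : bounded_lipschitz f -> bounded_lipschitz g ->
  bounded_lipschitz (fun x => f x * g x).
Proof.
move=> [K fK] [L gL].
have K0 : 0 <= K by have [+ _] := fK 0; exact: le_trans.
have L0 : 0 <= L by have [+ _] := gL 0; exact: le_trans.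
exists (K * L + K * L) => x; have [f1 f2] := fK x.
have [g1 g2] := gL x; split.
  by rewrite normrM -[leLHS]addr0 lerD ?mulr_ge0// ler_pM.
move=> y; have [f3 _] := fK y.
have -> : f y * g y - f x * g x = f y * (g y - g x) + (f y - f x) * g x by ring.
rewrite (le_trans (ler_normD _ _))// !normrM mulrDl lerD//.
  by rewrite -mulrA ler_pM.
by rewrite mulrAC ler_pM.
Qed.

Lemma bounded_lipschitz_smooth11 f df : smooth11 f df -> bounded_lipschitz f.
Proof.
move=> [dfx [K dK] [L fL]]; exists (Num.max K L) => x.
split; first by rewrite le_max fL orbT.
move=> y; have [c _ ->] := mean_value x y dfx.
rewrite normrM ler_wpM2r// le_max; apply/orP; left.
by have [] := dK c.
Qed.

Lemma smooth11_remainder f df : smooth11 f df -> exists K, forall x y,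
  `|f y - f x - df x * (y - x)| <= K * `|y - x| ^+ 2.
Proof.
move=> [dfx [K dK] _]; exists K => x y; have [c cx ->] := mean_value x y dfx.
have K0 : 0 <= K by have [+ _] := dK 0; exact: le_trans.
rewrite -mulrBl normrM expr2 mulrA ler_wpM2r//.
have [_ /(_ c) h] := dK x; rewrite (le_trans h)// ler_wpM2l//.
Qed.

End real_functions.

(** * A cutoff of class C^{1,1} *)

Section cutoff.
Variable R : realType.
Implicit Types (x y s t c : R) (f df : R -> R).

Lemma bounded_lipschitz_derive f df K :
  (forall x : R, is_derive x (1 : R) f (df x)) ->
  (forall x, `|f x| <= K) -> (forall x, `|df x| <= K) -> bounded_lipschitz f.
Proof.
move=> dfx fK dK; exists K => x; split=> // y.
have [c _ ->] := mean_value x y dfx.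
by rewrite normrM ler_wpM2r.
Qed.

Definition pospart t : R := Num.max t 0.

Lemma pospart_lipschitz s t : `|pospart s - pospart t| <= `|s - t|.
Proof.
rewrite /pospart; case: (leP s 0) => s0; case: (leP t 0) => t0; rewrite ?subrr ?normr0//.
  by rewrite ler_norml; case: (ltrgt0P (s - t)); lra.
by rewrite ler_norml; case: (ltrgt0P (s - t)); lra.
Qed.

Lemma pospart_ge0 t : 0 <= pospart t.
Proof. by rewrite le_max lexx orbT. Qed.

Lemma pospart_le t c : 0 <= c -> t <= c -> pospart t <= c.
Proof. by move=> c0 tc; rewrite ge_max tc. Qed.

Lemma pospart_eq0 t : t <= 0 -> pospart t = 0.
Proof. by move=> t0; apply/max_idPr. Qed.

Lemma is_derive_pospart_sqr t : is_derive t (1 : R) (fun s => pospart s ^+ 2) (2 * pospart t).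
Proof.
apply: (@is_derive_quadratic _ _ _ _ _ _ 1) => h; rewrite [h *: 1]mulr1 mul1r.
by rewrite /pospart ler_norml; case: (leP (t + h) 0) => a; case: (leP t 0) => b;
  apply/andP; split; nra.
Qed.

(** A cutoff that is 1 for |x| <= 1 and 0 for |x| >= 2; squaring the positive parts makes its
    derivative Lipschitz. *)
Definition cut x := pospart (1 - pospart (x ^+ 2 - 1) ^+ 2) ^+ 2.
Definition dcut x := 2 * pospart (1 - pospart (x ^+ 2 - 1) ^+ 2) *
  - (2 * pospart (x ^+ 2 - 1) * (2 * x)).

Lemma is_derive_cut x : is_derive x (1 : R) cut (dcut x).
Proof.
pose g := (fun y => 1 - pospart (y ^+ 2 - 1) ^+ 2).
have dg : is_derive x (1 : R) g (- (2 * pospart (x ^+ 2 - 1) * (2 * x))).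
  have h : is_derive x (1 : R) (fun y => y ^+ 2 - 1) (2 * x).
    by apply: (@is_derive_quadratic _ _ _ _ _ _ 1) => h; rewrite [h *: 1]mulr1 mul1r;
       rewrite ler_norml; apply/andP; split; nra.
  have k := @is_derive1_comp _ (fun s => pospart s ^+ 2) _ _ _ _ (is_derive_pospart_sqr _) h.
  have := is_deriveB (is_derive_cst (1 : R) x (1 : R)) k.
  by rewrite sub0r.
exact: (@is_derive1_comp _ (fun s => pospart s ^+ 2) g _ _ _ (is_derive_pospart_sqr _) dg).
Qed.

Lemma cut1 x : `|x| <= 1 -> cut x = 1.
Proof.
move=> x1; have x2 : x ^+ 2 - 1 <= 0.
  by rewrite subr_le0 -real_normK ?num_real// expr_le1.
by rewrite /cut [pospart (x ^+ 2 - 1)]pospart_eq0// expr0n subr0 /pospart; case: (leP 1 0); rewrite ?expr1n//; lra.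
Qed.

Lemma dcut0 x : `|x| <= 1 -> dcut x = 0.
Proof.
move=> x1; have x2 : x ^+ 2 - 1 <= 0.
  by rewrite subr_le0 -real_normK ?num_real// expr_le1.
by rewrite /dcut [pospart (x ^+ 2 - 1)]pospart_eq0// !(mulr0, mul0r) oppr0 mulr0.
Qed.

Lemma pospart_cut0 x : 2 <= `|x| -> pospart (1 - pospart (x ^+ 2 - 1) ^+ 2) = 0.
Proof.
move=> x2; apply: pospart_eq0.
have : 3 <= x ^+ 2 - 1 by rewrite -real_normK ?num_real//; nra.
by move=> x3; rewrite /pospart; case: (leP (x ^+ 2 - 1) 0); nra.
Qed.

Lemma cut0 x : 2 <= `|x| -> cut x = 0.
Proof. by move=> x2; rewrite /cut pospart_cut0// expr0n. Qed.

Lemma dcut_out x : 2 <= `|x| -> dcut x = 0.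
Proof. by move=> x2; rewrite /dcut pospart_cut0// mulr0 mul0r. Qed.

(** Truncation to [-2, 2]. Exponentials become bounded and Lipschitz only after it, and under a
    factor [cut] it changes nothing. *)
Definition clamp x : R := pospart (x + 2) - pospart (x - 2) - 2.

Lemma clamp_lipschitz x y : `|clamp y - clamp x| <= 2 * `|y - x|.
Proof.
have := pospart_lipschitz (y + 2) (x + 2); have := pospart_lipschitz (y - 2) (x - 2).
have -> : y - 2 - (x - 2) = y - x by ring.
have -> : y + 2 - (x + 2) = y - x by ring.
rewrite /clamp !ler_norml => /andP[? ?] /andP[? ?]; apply/andP; split; lra.
Qed.

Lemma clamp_le x : x <= -2 -> clamp x = -2.
Proof. by move=> x2; rewrite /clamp !pospart_eq0; lra. Qed.

Lemma clamp_ge x : 2 <= x -> clamp x = 2.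
Proof. by move=> x2; rewrite /clamp /pospart !max_l; lra. Qed.

Lemma clamp_id x : `|x| <= 2 -> clamp x = x.
Proof.
rewrite ler_norml => /andP[x1 x2].
by rewrite /clamp [pospart (x - 2)]pospart_eq0 /pospart ?max_l; lra.
Qed.

Lemma clamp_bound x : `|clamp x| <= 2.
Proof.
have [x2|x2] := leP `|x| 2; first by rewrite clamp_id.
have [x0|x0] := leP 0 x.
  by rewrite clamp_ge ?ger0_norm//; rewrite ger0_norm// in x2; lra.
by rewrite clamp_le ?normrN ?ger0_norm//; rewrite ltr0_norm// in x2; lra.
Qed.

Lemma clamp_out x : 2 <= `|x| -> 2 <= `|clamp x|.
Proof.
move=> x2; have [x0|x0] := leP 0 x.
  by rewrite clamp_ge ?ger0_norm//; rewrite ger0_norm// in x2; lra.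
by rewrite clamp_le ?normrN ?ger0_norm//; rewrite ltr0_norm// in x2; lra.
Qed.

Lemma bounded_lipschitz_clamp : bounded_lipschitz clamp.
Proof.
exists 2 => x; split; first exact: clamp_bound.
by move=> y; exact: clamp_lipschitz.
Qed.

Lemma bounded_lipschitz_pospart f : bounded_lipschitz f ->
  bounded_lipschitz (fun x => pospart (f x)).
Proof.
move=> [K fK]; exists K => x; have [f1 f2] := fK x; split.
  rewrite ger0_norm ?pospart_ge0//; apply: pospart_le; first exact: le_trans f1.
  exact: le_trans (ler_norm _) f1.
by move=> y; rewrite (le_trans (pospart_lipschitz _ _)).
Qed.

Lemma bounded_lipschitz_cut_clamp :
  bounded_lipschitz (cut \o clamp) /\ bounded_lipschitz (dcut \o clamp).
Proof.
have b0 := bounded_lipschitz_clamp.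
have b1 : bounded_lipschitz (fun x => pospart (clamp x ^+ 2 - 1)).
  by apply: bounded_lipschitz_pospart; apply: bounded_lipschitzD; [exact: bounded_lipschitzM|exact: bounded_lipschitz_const].
have b2 : bounded_lipschitz (fun x => pospart (1 - pospart (clamp x ^+ 2 - 1) ^+ 2)).
  have -> : (fun x => pospart (1 - pospart (clamp x ^+ 2 - 1) ^+ 2)) =
     (fun x => pospart (1 + (- 1) * (pospart (clamp x ^+ 2 - 1) * pospart (clamp x ^+ 2 - 1)))).
    by apply/funext => x; rewrite mulN1r.
  by apply: bounded_lipschitz_pospart; apply: bounded_lipschitzD; [exact: bounded_lipschitz_const|apply: bounded_lipschitzM; [exact: bounded_lipschitz_const|exact: bounded_lipschitzM]].
split; first exact: bounded_lipschitzM.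
rewrite (_ : dcut \o clamp = fun x => (2 * pospart (1 - pospart (clamp x ^+ 2 - 1) ^+ 2)) *
   (-4 * (pospart (clamp x ^+ 2 - 1) * clamp x))); last first.
  by apply/funext => x; rewrite /= /dcut; ring.
apply: bounded_lipschitzM; apply: bounded_lipschitzM => //.
- exact: bounded_lipschitz_const.
- exact: bounded_lipschitz_const.
- exact: bounded_lipschitzM.
Qed.

(** Since [cut] and [dcut] vanish for |x| >= 2, every factor may be composed with [clamp], so only
    the behaviour of [f] and [df] on [-2, 2] matters. *)
Lemma smooth11_cut f df : (forall x : R, is_derive x (1 : R) f (df x)) ->
  bounded_lipschitz (f \o clamp) -> bounded_lipschitz (df \o clamp) ->
  smooth11 (fun x => cut x * f x) (fun x => cut x * df x + dcut x * f x).
Proof.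
move=> dfx bf bdf; have [bc bdc] := bounded_lipschitz_cut_clamp.
have cl (g h : R -> R) : (forall x, 2 <= `|x| -> g x = 0) ->
    (fun x => g x * h x) = (fun x => (g \o clamp) x * (h \o clamp) x).
  move=> g0; apply/funext => x /=; have [x2|x2] := leP 2 `|x|.
    by rewrite !g0 ?clamp_out// !mul0r.
  by rewrite clamp_id// ltW.
split.
- move=> x; have -> : cut x * df x + dcut x * f x = cut x *: df x + f x *: dcut x.
    by rewrite [dcut x * _]mulrC.
  by apply: is_deriveM; exact: is_derive_cut.
- apply: bounded_lipschitzD; rewrite cl//.
  + by apply: bounded_lipschitzM.
  + exact: cut0.
  + by apply: bounded_lipschitzM.
  + exact: dcut_out.
- have := bounded_lipschitzM bc bf.
  by rewrite -cl; [move=> [K h]; exists K => x; have [] := h x|exact: cut0].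
Qed.

End cutoff.

(** * The hyperbolic and trigonometric factors of the perturbation *)

Section hyperbolic.
Variable R : realType.
Implicit Types (x y c : R).

Definition ch c x := (expR (c * x) + expR (- c * x)) / 2.
Definition sh c x := (expR (c * x) - expR (- c * x)) / 2.

Lemma is_derive_expR_scale c x :
  is_derive x (1 : R) (fun y => expR (c * y)) (c * expR (c * x)).
Proof.
have h : is_derive x (1 : R) (fun y => c * y) c.
  by apply: (@is_derive_quadratic _ _ _ _ _ _ 0) => h; rewrite [h *: 1]mulr1 mul0r;
    rewrite (_ : _ - _ = 0) ?normr0//; ring.
by have := @is_derive1_comp _ expR _ _ _ _ (is_derive_expR (c * x)) h; rewrite mulrC.
Qed.

Lemma is_derive_ch c x : is_derive x (1 : R) (ch c) (c * sh c x).
Proof.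
have h := is_deriveD (is_derive_expR_scale c x) (is_derive_expR_scale (- c) x).
have -> : ch c = 2^-1 \*: ((fun y => expR (c * y)) \+ (fun y => expR (- c * y))).
  by apply/funext => y; rewrite /ch mulrC.
have -> : c * sh c x = 2^-1 *: (c * expR (c * x) + - c * expR (- c * x)).
  by rewrite /sh /GRing.scale/=; ring.
exact: is_deriveZ.
Qed.

Lemma is_derive_sh c x : is_derive x (1 : R) (sh c) (c * ch c x).
Proof.
have h := is_deriveB (is_derive_expR_scale c x) (is_derive_expR_scale (- c) x).
have -> : sh c = 2^-1 \*: ((fun y => expR (c * y)) \- (fun y => expR (- c * y))).
  by apply/funext => y; rewrite /sh mulrC.
have -> : c * ch c x = 2^-1 *: (c * expR (c * x) - - c * expR (- c * x)).
  by rewrite /ch /GRing.scale/=; ring.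
exact: is_deriveZ.
Qed.

Lemma bounded_lipschitz_expR_clamp c :
  bounded_lipschitz (fun x => expR (c * clamp x)).
Proof.
exists (expR (6 * `|c|) * (2 * `|c|) + expR (6 * `|c|)) => x.
have cc y : `|c * clamp y| <= 2 * `|c|.
  by rewrite normrM mulrC ler_wpM2r// clamp_bound.
have e0 (t : R) : 0 <= expR t by exact: expR_ge0.
have ex : expR (c * clamp x) <= expR (6 * `|c|).
  rewrite ler_expR (le_trans (ler_norm _))// (le_trans (cc x))// ler_wpM2r//.
  by rewrite ler_nat.
split.
  by rewrite ger0_norm// (le_trans ex)// lerDr mulr_ge0// mulr_ge0.
move=> y; have [d dx ->] := mean_value (c * clamp x) (c * clamp y)
  (fun x => is_derive_expR x).
(* The intermediate point [d] lies within 4 |c| of a number of size at most 2 |c|, whence 6 |c|. *)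
have ed : expR d <= expR (6 * `|c|).
  rewrite ler_expR; have := cc x; have := cc y; have := ler_norm d.
  have := ler_normB (c * clamp y) (c * clamp x).
  have := ler_normD (d - c * clamp x) (c * clamp x); rewrite subrK.
  by move=> *; lra.
rewrite normrM ger0_norm// -mulrBr normrM.
have := clamp_lipschitz x y; move: (expR d) (expR (6 * `|c|)) ed (e0 d) => p q pq p0 h.
rewrite mulrDl [X in _ <= X](_ : _ = q * (`|c| * (2 * `|y - x|)) + q * `|y - x|); last ring.
have q0 := le_trans p0 pq.
rewrite -[leLHS]addr0 lerD ?mulr_ge0//.
by apply: ler_pM => //; rewrite ?mulr_ge0// ler_wpM2l.
Qed.

Lemma bounded_lipschitz_ch_clamp c : bounded_lipschitz (ch c \o @clamp R).
Proof.
apply: bounded_lipschitzM; last exact: bounded_lipschitz_const.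
by apply: bounded_lipschitzD; exact: bounded_lipschitz_expR_clamp.
Qed.

Lemma bounded_lipschitz_sh_clamp c : bounded_lipschitz (sh c \o @clamp R).
Proof.
apply: bounded_lipschitzM; last exact: bounded_lipschitz_const.
rewrite (_ : (fun x => _) =
  fun x => expR (c * clamp x) + -1 * expR (- c * clamp x)); last first.
  by apply/funext => x; rewrite mulN1r.
apply: bounded_lipschitzD; first exact: bounded_lipschitz_expR_clamp.
apply: bounded_lipschitzM; [exact: bounded_lipschitz_const|].
exact: bounded_lipschitz_expR_clamp.
Qed.

Definition cch c x := cut x * ch c x.
Definition dcch c x := cut x * (c * sh c x) + dcut x * ch c x.
Definition csh c x := cut x * sh c x.
Definition dcsh c x := cut x * (c * ch c x) + dcut x * sh c x.

Lemma smooth11_cch c : smooth11 (cch c) (dcch c).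
Proof.
apply: smooth11_cut => [x||]; first exact: is_derive_ch.
  exact: bounded_lipschitz_ch_clamp.
apply: bounded_lipschitzM; first exact: bounded_lipschitz_const.
exact: bounded_lipschitz_sh_clamp.
Qed.

Lemma smooth11_csh c : smooth11 (csh c) (dcsh c).
Proof.
apply: smooth11_cut => [x||]; first exact: is_derive_sh.
  exact: bounded_lipschitz_sh_clamp.
apply: bounded_lipschitzM; first exact: bounded_lipschitz_const.
exact: bounded_lipschitz_ch_clamp.
Qed.

Lemma is_derive_scale c x : is_derive x (1 : R) (fun y => c * y) c.
Proof.
by apply: (@is_derive_quadratic _ _ _ _ _ _ 0) => h; rewrite [h *: 1]mulr1 mul0r;
    rewrite (_ : _ - _ = 0) ?normr0//; ring.
Qed.

Lemma is_derive_sin_scale c x :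
  is_derive x (1 : R) (fun y => sin (c * y)) (c * cos (c * x)).
Proof.
by have := @is_derive1_comp _ sin _ _ _ _ (is_derive_sin (c * x)) (is_derive_scale c x);
   rewrite mulrC.
Qed.

Lemma is_derive_cos_scale c x :
  is_derive x (1 : R) (fun y => cos (c * y)) (- c * sin (c * x)).
Proof.
rewrite mulNr mulrC -mulNr.
exact: (@is_derive1_comp _ cos _ _ _ _ (is_derive_cos (c * x)) (is_derive_scale c x)).
Qed.

Lemma bounded_lipschitz_sin c : bounded_lipschitz (fun x => sin (c * x)).
Proof.
apply: (@bounded_lipschitz_derive _ _ (fun x => c * cos (c * x)) (1 + `|c|)).
- exact: is_derive_sin_scale.
- by move=> x; rewrite (le_trans (sin_max _))// lerDl.
- move=> x; rewrite normrM (@le_trans _ _ `|c|)//; last by rewrite lerDr.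
  by rewrite -[leRHS]mulr1 ler_wpM2l// cos_max.
Qed.

Lemma bounded_lipschitz_cos c : bounded_lipschitz (fun x => cos (c * x)).
Proof.
apply: (@bounded_lipschitz_derive _ _ (fun x => - c * sin (c * x)) (1 + `|c|)).
- exact: is_derive_cos_scale.
- by move=> x; rewrite (le_trans (cos_max _))// lerDl.
- move=> x; rewrite normrM (@le_trans _ _ `|c|)//; last by rewrite lerDr.
  by rewrite normrN -[leRHS]mulr1 ler_wpM2l// sin_max.
Qed.

Lemma smooth11_sin c : smooth11 (fun x => sin (c * x)) (fun x => c * cos (c * x)).
Proof.
split; [exact: is_derive_sin_scale| |].
- apply: bounded_lipschitzM; first exact: bounded_lipschitz_const.
  exact: bounded_lipschitz_cos.
- by exists 1 => x; exact: sin_max.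
Qed.

Lemma smooth11_cos c : smooth11 (fun x => cos (c * x)) (fun x => - c * sin (c * x)).
Proof.
split; [exact: is_derive_cos_scale| |].
- apply: bounded_lipschitzM; first exact: bounded_lipschitz_const.
  exact: bounded_lipschitz_sin.
- by exists 1 => x; exact: cos_max.
Qed.

End hyperbolic.

(** * Functions on the plane with explicit C^{1,1} constants *)

Section plane_functions.
Variable R : realType.
Implicit Types (f : R * R -> R) (z w : R * R) (K L Q : R).

Lemma norm_fst z : `|z.1| <= `|z|.
Proof. by rewrite prod_normE le_max lexx. Qed.

Lemma norm_snd z : `|z.2| <= `|z|.
Proof. by rewrite prod_normE le_max lexx orbT. Qed.

Lemma norm_le_pair z K : `|z.1| <= K -> `|z.2| <= K -> `|z| <= K.
Proof. by rewrite prod_normE ge_max => -> ->. Qed.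

(** [L] governs first order and [Q] second order. The constants stay explicit because those of the
    compositions determine the frequencies. The Lipschitz bound is listed separately: in the sup
    norm, the bounds on the partial derivatives would only give [2 * L]. *)
Definition c11 L Q f f1 f2 := forall z w,
  [/\ `|f1 z| <= L /\ `|f2 z| <= L, `|f w - f z| <= L * `|w - z|,
      `|f1 w - f1 z| <= Q * `|w - z| /\ `|f2 w - f2 z| <= Q * `|w - z| &
      `|f w - f z - (f1 z * (w.1 - z.1) + f2 z * (w.2 - z.2))|
        <= Q * `|w - z| ^+ 2].

Lemma c11D L Q f f1 f2 L' Q' g g1 g2 : c11 L Q f f1 f2 -> c11 L' Q' g g1 g2 ->
  c11 (L + L') (Q + Q') (fun z => f z + g z) (fun z => f1 z + g1 z)
    (fun z => f2 z + g2 z).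
Proof.
move=> cf cg z w; have [[a1 a2] a3 [a4 a5] a6] := cf z w.
have [[b1 b2] b3 [b4 b5] b6] := cg z w.
have tri (x y p q : R) : `|x| <= p -> `|y| <= q -> `|x + y| <= p + q.
  by move=> xp yq; rewrite (le_trans (ler_normD _ _))// lerD.
split; [split|rewrite opprD addrACA mulrDl|split|].
- exact: tri.
- exact: tri.
- exact: tri.
- by rewrite opprD addrACA mulrDl tri.
- by rewrite opprD addrACA mulrDl tri.
- rewrite mulrDl; have := tri _ _ _ _ a6 b6; congr (`|_| <= _); ring.
Qed.

Lemma c11Z c L Q f f1 f2 : c11 L Q f f1 f2 ->
  c11 (`|c| * L) (`|c| * Q) (fun z => c * f z) (fun z => c * f1 z)
    (fun z => c * f2 z).
Proof.
move=> cf z w; have [[a1 a2] a3 [a4 a5] a6] := cf z w.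
split; [split|rewrite -mulrBr normrM -mulrA ler_wpM2l//|split|].
- by rewrite normrM ler_wpM2l.
- by rewrite normrM ler_wpM2l.
- by rewrite -mulrBr normrM -mulrA ler_wpM2l.
- by rewrite -mulrBr normrM -mulrA ler_wpM2l.
- have -> : c * f w - c * f z - (c * f1 z * (w.1 - z.1) + c * f2 z * (w.2 - z.2))
   = c * (f w - f z - (f1 z * (w.1 - z.1) + f2 z * (w.2 - z.2))) by ring.
  by rewrite normrM -mulrA ler_wpM2l.
Qed.

Lemma c11W L Q L' Q' f f1 f2 : L <= L' -> Q <= Q' -> c11 L Q f f1 f2 ->
  c11 L' Q' f f1 f2.
Proof.
move=> LL QQ cf z w; have [[a1 a2] a3 [a4 a5] a6] := cf z w.
have h (x : R) : 0 <= x -> L * x <= L' * x by move=> x0; rewrite ler_wpM2r.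
have k (x : R) : 0 <= x -> Q * x <= Q' * x by move=> x0; rewrite ler_wpM2r.
split; [split|exact: le_trans a3 (h _ _)|split|exact: le_trans a6 (k _ _)].
- exact: le_trans LL.
- exact: le_trans LL.
- exact: le_trans a4 (k _ _).
- exact: le_trans a5 (k _ _).
Qed.

Lemma smooth11_constant (g dg : R -> R) : smooth11 g dg ->
  exists2 K, 0 <= K & forall x y : R, [/\ `|g x| <= K, `|dg x| <= K,
    `|g y - g x| <= K * `|y - x|, `|dg y - dg x| <= K * `|y - x| &
    `|g y - g x - dg x * (y - x)| <= K * `|y - x| ^+ 2].
Proof.
move=> sg; have [K1 h1] := bounded_lipschitz_smooth11 sg.
have [_ [K2 h2] _] := sg; have [K3 h3] := smooth11_remainder sg.
exists (`|K1| + `|K2| + `|K3|) => [|x y]; first by rewrite !addr_ge0.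
have [a1 a2] := h1 x; have [b1 b2] := h2 x.
have k1 := ler_norm K1; have k2 := ler_norm K2; have k3 := ler_norm K3.
have n1 := normr_ge0 K1; have n2 := normr_ge0 K2; have n3 := normr_ge0 K3.
have W (p q t : R) : p <= q -> 0 <= t -> p * t <= q * t by move=> ? ?; rewrite ler_wpM2r.
split.
- lra.
- lra.
- by apply: le_trans (a2 y) _; apply: W => //; lra.
- by apply: le_trans (b2 y) _; apply: W => //; lra.
- by apply: le_trans (h3 x y) _; apply: W => //; lra.
Qed.

Definition tensor (g h : R -> R) z : R := g z.1 * h z.2.

Lemma c11_tensor (g dg h dh : R -> R) : smooth11 g dg -> smooth11 h dh ->
  exists K, (forall z, `|tensor g h z| <= K) /\
    c11 K K (tensor g h) (tensor dg h) (tensor g dh).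
Proof.
move=> /smooth11_constant[A A0 gA] /smooth11_constant[B B0 hB].
have AB0 : 0 <= A * B by rewrite mulr_ge0.
have prod (x y p q : R) : `|x| <= p -> `|y| <= q -> `|x * y| <= p * q.
  by move=> xp yq; rewrite normrM ler_pM.
have lip (u u' v v' d : R) : `|u| <= A -> `|v'| <= B ->
    `|u' - u| <= A * d -> `|v' - v| <= B * d -> `|u' * v' - u * v| <= 3 * (A * B) * d.
  move=> uA vB ud vd; have d0 : 0 <= A * d := le_trans (normr_ge0 _) ud.
  rewrite (_ : _ - _ = (u' - u) * v' + u * (v' - v)); last ring.
  rewrite (le_trans (ler_normD _ _))//.
  have := prod _ _ _ _ ud vB; have := prod _ _ _ _ uA vd.
  have : 0 <= A * d * B by rewrite mulr_ge0.
  move: `|_ * v'| `|u * _| => x y; lra.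
exists (3 * (A * B)); split.
  move=> z; have [g1 _ _ _ _] := gA z.1 0; have [h1 _ _ _ _] := hB z.2 0.
  by apply: le_trans (prod _ _ _ _ g1 h1) _; lra.
move=> z w; pose d := `|w - z|.
have [g1 g2 g3 g4 g5] := gA z.1 w.1; have [h1 h2 h3 h4 h5] := hB z.2 w.2.
have [_ _ _ _ _] := gA w.1 z.1; have [k1 k2 _ _ _] := hB w.2 z.2.
have d1 : `|w.1 - z.1| <= d := norm_fst (w - z).
have d2 : `|w.2 - z.2| <= d := norm_snd (w - z).
have d0 : 0 <= d by exact: normr_ge0.
have up (K t : R) : 0 <= K -> t <= d -> K * t <= K * d.
  by move=> ? ?; rewrite ler_wpM2l.
have up2 (K t : R) : 0 <= K -> 0 <= t -> t <= d -> K * t ^+ 2 <= K * d ^+ 2.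
  by move=> ? ? ?; rewrite ler_wpM2l// lerXn2r// ?nnegrE.
have {}g3 := le_trans g3 (up _ _ A0 d1); have {}g4 := le_trans g4 (up _ _ A0 d1).
have {}h3 := le_trans h3 (up _ _ B0 d2); have {}h4 := le_trans h4 (up _ _ B0 d2).
have {}g5 := le_trans g5 (up2 _ _ A0 (normr_ge0 _) d1).
have {}h5 := le_trans h5 (up2 _ _ B0 (normr_ge0 _) d2).
rewrite /tensor -/d; split; [split|exact: lip|split; exact: lip|].
- by apply: le_trans (prod _ _ _ _ g2 h1) _; lra.
- by apply: le_trans (prod _ _ _ _ g1 h2) _; lra.
(* Taylor remainder of [g] times a value of [h], product of the two first-order increments, value of
   [g] times the remainder of [h]: each is at most [A * B * d ^+ 2], which explains the factor 3. *)
- rewrite (_ : _ - _ = (g w.1 - g z.1 - dg z.1 * (w.1 - z.1)) * h w.2 +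
     (dg z.1 * (w.1 - z.1) * (h w.2 - h z.2) +
      g z.1 * (h w.2 - h z.2 - dh z.2 * (w.2 - z.2)))); last ring.
  have e1 := prod _ _ _ _ g5 k1.
  have e2 := prod _ _ _ _ (prod _ _ _ _ g2 d1) h3.
  have e3 := prod _ _ _ _ g1 h5.
  rewrite (le_trans (ler_normD _ _))//.
  rewrite (le_trans (lerD (lexx _) (ler_normD _ _)))//.
  rewrite (le_trans (lerD e1 (lerD e2 e3)))//; lra.
Qed.

End plane_functions.

(** * The perturbation *)

Section perturbation.
Variable R : realType.
Implicit Types (a K C : R) (z w : R * R).

(* With coefficient kappa * a, the curve [Im G = 0] of the map
   [G z = z + a (i sin z + kappa a sin (2 z))] satisfies
   |G'|^2 = 1 + a^2 (4 kappa + 1 - (8 kappa + 3) sin^2 (Re z)) + O(a^3);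
   kappa = -3/8 turns the second-order term into the constant - a^2 / 2. *)
Definition coef a : R := - (3 / 8) * a.

(* [PX + i PY] is the holomorphic function i sin z + coef a sin (2 z), in which
   every hyperbolic function of Im z is multiplied by a cutoff; the factors 1
   give both summands the shape to which [c11_tensor] and [c11Z] apply. *)
Definition PX a z : R := -1 * tensor (fun x => cos (1 * x)) (csh 1) z +
  coef a * tensor (fun x => sin (2 * x)) (cch 2) z.
Definition PX1 a z : R := -1 * tensor (fun x => -1 * sin (1 * x)) (csh 1) z +
  coef a * tensor (fun x => 2 * cos (2 * x)) (cch 2) z.
Definition PX2 a z : R := -1 * tensor (fun x => cos (1 * x)) (dcsh 1) z +
  coef a * tensor (fun x => sin (2 * x)) (dcch 2) z.
Definition PY a z : R := 1 * tensor (fun x => sin (1 * x)) (cch 1) z +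
  coef a * tensor (fun x => cos (2 * x)) (csh 2) z.
Definition PY1 a z : R := 1 * tensor (fun x => 1 * cos (1 * x)) (cch 1) z +
  coef a * tensor (fun x => -2 * sin (2 * x)) (csh 2) z.
Definition PY2 a z : R := 1 * tensor (fun x => sin (1 * x)) (dcch 1) z +
  coef a * tensor (fun x => cos (2 * x)) (dcsh 2) z.

(** One constant serves all amplitudes in [0, 1], since |coef a| <= 1 there; this allows the
    amplitudes to be chosen small in terms of [C]. *)
Lemma perturbation_c11 : exists2 C, 1 <= C & forall a, 0 <= a -> a <= 1 ->
  [/\ forall z, `|PX a z| <= C, c11 C C (PX a) (PX1 a) (PX2 a),
      forall z, `|PY a z| <= C & c11 C C (PY a) (PY1 a) (PY2 a)].
Proof.
have [A1 [b1 c1]] := c11_tensor (smooth11_cos 1) (smooth11_csh (1 : R)).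
have [A2 [b2 c2]] := c11_tensor (smooth11_sin 2) (smooth11_cch (2 : R)).
have [A3 [b3 c3]] := c11_tensor (smooth11_sin 1) (smooth11_cch (1 : R)).
have [A4 [b4 c4]] := c11_tensor (smooth11_cos 2) (smooth11_csh (2 : R)).
have p1 := le_trans (normr_ge0 _) (b1 (0, 0)).
have p2 := le_trans (normr_ge0 _) (b2 (0, 0)).
have p3 := le_trans (normr_ge0 _) (b3 (0, 0)).
have p4 := le_trans (normr_ge0 _) (b4 (0, 0)).
exists (1 + A1 + A2 + A3 + A4) => [|a a0 a1]; first lra.
have ca : `|coef a| <= 1 by rewrite /coef ler_norml; apply/andP; split; lra.
have bnd (c u v p q : R) : `|c| = 1 -> `|u| <= p -> `|v| <= q ->
    `|c * u + coef a * v| <= p + q.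
  move: (coef a) ca => k ca c1' up vq; apply: le_trans (ler_normD _ _) _.
  rewrite !normrM c1' mul1r; apply: lerD => //.
  by apply: le_trans vq; rewrite ler_piMl.
have m2 : `|coef a| * A2 <= A2 by rewrite ler_piMl.
have m4 : `|coef a| * A4 <= A4 by rewrite ler_piMl.
have n1 : `|-1| = 1 :> R by rewrite normrN normr1.
have n1' : `|1| = 1 :> R by rewrite normr1.
split.
- by move=> z; apply: le_trans (bnd _ _ _ _ _ n1 (b1 z) (b2 z)) _; lra.
- by apply: c11W (c11D (c11Z (-1) c1) (c11Z (coef a) c2)); rewrite n1; lra.
- by move=> z; apply: le_trans (bnd _ _ _ _ _ n1' (b3 z) (b4 z)) _; lra.
- by apply: c11W (c11D (c11Z 1 c3) (c11Z (coef a) c4)); rewrite n1'; lra.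
Qed.

Lemma perturbation_out a z : 2 <= `|z.2| ->
  [/\ PX a z = 0, PX1 a z = 0, PX2 a z = 0, PY a z = 0 & PY1 a z = 0 /\ PY2 a z = 0].
Proof.
move=> z2; have := cut0 z2; have := dcut_out z2.
rewrite /PX /PX1 /PX2 /PY /PY1 /PY2 /tensor /cch /csh /dcch /dcsh => -> ->.
by split; [..|split]; ring.
Qed.

(** Where the cutoff equals 1 the perturbation is holomorphic; the last two identities are the
    Cauchy-Riemann equations. *)
Lemma perturbation_strip a z : `|z.2| <= 1 ->
  [/\ PY a z = sin z.1 * ch 1 z.2 + coef a * (cos (2 * z.1) * sh 2 z.2),
      PX1 a z = sin z.1 * sh 1 z.2 + coef a * (2 * cos (2 * z.1) * ch 2 z.2),
      PY1 a z = cos z.1 * ch 1 z.2 - coef a * (2 * sin (2 * z.1) * sh 2 z.2),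
      PX2 a z = - PY1 a z & PY2 a z = PX1 a z].
Proof.
move=> z2; have := cut1 z2; have := dcut0 z2.
rewrite /PX /PX1 /PX2 /PY /PY1 /PY2 /tensor /cch /csh /dcch /dcsh => -> ->.
by rewrite !mul1r; split; ring.
Qed.

(** The mean value theorem used in turn: [sh] is O(|y|), hence [ch - 1] is O(y^2), hence so is
    [sh 1 y - y]. *)
Lemma hyperbolic_bounds : exists2 K : R, 1 <= K & forall y : R, `|y| <= 1 ->
  [/\ `|ch 1 y - 1| <= K * y ^+ 2, `|sh 1 y - y| <= K * y ^+ 2,
      `|ch 2 y - 1| <= K * y ^+ 2 & `|sh 2 y| <= K * `|y|].
Proof.
pose E : R := expR 2.
have E0 : 0 < E by exact: expR_gt0.
have chE c y : 0 <= c <= 2 -> `|y| <= 1 -> `|ch c y| <= E.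
  move=> /andP[c0 c2]; rewrite ler_norml => /andP[y1 y2].
  have e1 : expR (c * y) <= E by rewrite ler_expR; nra.
  have e2 : expR (- c * y) <= E by rewrite ler_expR; nra.
  have := expR_gt0 (c * y); have := expR_gt0 (- c * y) => ? ?.
  by rewrite /ch ler_norml; apply/andP; split; lra.
have sh0 c : sh c 0 = 0 :> R by rewrite /sh !mulr0 subrr mul0r.
have ch0 c : ch c 0 = 1 :> R by rewrite /ch !mulr0 expR0; lra.
have shE c y : 0 <= c <= 2 -> `|y| <= 1 -> `|sh c y| <= 2 * E * `|y|.
  move=> c02 y1; have [d dy] := mean_value 0 y (is_derive_sh c).
  rewrite sh0 !subr0 in dy * => ->; rewrite normrM [`|c * _|]normrM ler_wpM2r//.
  have /andP[c0 c2] := c02; rewrite ger0_norm//; apply: ler_pM => //.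
  by apply: chE => //; exact: le_trans dy y1.
have chE1 c y : 0 <= c <= 2 -> `|y| <= 1 -> `|ch c y - 1| <= 4 * E * y ^+ 2.
  move=> c02 y1; have [d dy] := mean_value 0 y (is_derive_ch c).
  rewrite ch0 !subr0 in dy * => ->; rewrite normrM [`|c * _|]normrM -(@real_normK _ y) ?num_real//.
  rewrite expr2 mulrA ler_wpM2r//.
  have /andP[c0 c2] := c02; rewrite ger0_norm// (_ : 4 * E * _ = 2 * (2 * E * `|y|)); last ring.
  apply: ler_pM => //; apply: le_trans (shE _ _ c02 (le_trans dy y1)) _.
  by rewrite ler_wpM2l// mulr_ge0// ltW.
have E1 : 1 <= E by rewrite -(expR0 R) ler_expR.
exists (4 * E) => [|y y1]; first lra.
have c1 : 0 <= (1 : R) <= 2 by rewrite ler01 ler1n.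
have c2 : 0 <= (2 : R) <= 2 by rewrite ler0n lexx.
split; [exact: chE1| |exact: chE1|].
  have dsh (x : R) : is_derive x (1 : R) (fun t : R => sh 1 t - t) (1 * ch 1 x - 1).
    by apply: is_deriveB; exact: is_derive_sh.
  have [d dy] := mean_value 0 y dsh.
  rewrite sh0 !subr0 mul1r in dy * => ->; rewrite normrM.
  have := chE1 1 d c1 (le_trans dy y1).
  rewrite -(@real_normK _ d) ?num_real// -(@real_normK _ y) ?num_real//.
  move: (normr_ge0 (ch 1 d - 1)) (normr_ge0 d) dy y1.
  move: `|ch 1 d - 1| `|d| `|y| => u v t u0 v0 vt t1 h.
  have : v ^+ 2 <= t ^+ 2 by rewrite lerXn2r// nnegrE//; lra.
  have : t ^+ 2 <= t by nra.
  by nra.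
by rewrite (le_trans (shE _ _ c2 y1))// ler_wpM2r//; lra.
Qed.

End perturbation.

(** * The contraction estimate near the curve Im G = 0 *)

Section contraction.
Variable R : realType.
Implicit Types (a K C : R) (z w : R * R).

(** Here [s], [c], [m], [n] stand for sin x, cos x, cos 2x, sin 2x and [Ch], [S], [C2], [S2] for the
    hyperbolic functions of y and 2y. Being within a^3 of Im G = 0 forces y = - a s + O(a^2);
    inserted into |G'|^2 this gives 1 - a^2 / 2 up to an error that the smallness of [a] keeps below
    a^2 / 4. *)
Lemma contraction_algebra (K a s c y Ch S C2 S2 m n : R) :
  1 <= K -> 0 < a -> (40 * 40) * K ^+ 3 * a <= 1 -> s ^+ 2 + c ^+ 2 = 1 ->
  m = 1 - 2 * s ^+ 2 -> n = 2 * (s * c) -> `|y| <= 1 ->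
  `|Ch - 1| <= K * y ^+ 2 -> `|S - y| <= K * y ^+ 2 ->
  `|C2 - 1| <= K * y ^+ 2 -> `|S2| <= K * `|y| ->
  `|y + a * (s * Ch + coef a * (m * S2))| <= a ^+ 3 ->
  (1 + a * (s * S + coef a * (2 * m * C2))) ^+ 2 +
  (a * (c * Ch - coef a * (2 * n * S2))) ^+ 2 <= 1 - a ^+ 2 / 4.
Proof.
move=> K1 a0 aK sc mE nE y1 hC hS hC2 hS2 hY; rewrite /coef in hY *.
have K0 : 0 <= K by lra.
have K2 : K <= K ^+ 2 by clear - K1; nra.
have K3 : K ^+ 2 <= K ^+ 3 by clear - K1 K2; rewrite exprS; nra.
have Ka : K ^+ 3 * a <= 1 / (40 * 40) by clear - aK; lra.
have a1 : a <= 1 / (40 * 40) by clear - Ka K1 K2 K3 a0; nra.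
have s1 : `|s| <= 1 by clear - sc; rewrite ler_norml; apply/andP; split; nra.
have c1 : `|c| <= 1 by clear - sc; rewrite ler_norml; apply/andP; split; nra.
have m1 : `|m| <= 1 by rewrite mE; clear - sc; rewrite ler_norml; apply/andP; split; nra.
have n1 : `|n| <= 1.
  rewrite nE; clear - sc; have := sqr_ge0 (s - c); have := sqr_ge0 (s + c).
  by rewrite sqrrB sqrrD !mulr2n ler_norml => ? ?; apply/andP; split; lra.
have prod (x t p q : R) : `|x| <= p -> `|t| <= q -> `|x * t| <= p * q.
  by move=> xp tq; rewrite normrM ler_pM.
have tri (x t p q : R) : `|x| <= p -> `|t| <= q -> `|x + t| <= p + q.
  by move=> xp tq; rewrite (le_trans (ler_normD _ _))// lerD.
have na : `|a| <= a by rewrite gtr0_norm.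
have nN (x p : R) : `|x| <= p -> `|- x| <= p by rewrite normrN.
have nk : `|- (3 / 8) * a| <= 3 / 8 * a by clear - a0; rewrite mulNr normrN ger0_norm; lra.
have y2 : y ^+ 2 <= `|y| by clear - y1; rewrite -(@real_normK _ y) ?num_real//; have := normr_ge0 y; nra.
have Ch2 : `|Ch| <= 2 * K.
  rewrite -[Ch](subrK 1) (le_trans (ler_normD _ _))// normr1.
  have : K * y ^+ 2 <= K * 1 by rewrite ler_wpM2l// (le_trans y2).
  move: hC; clear - K1; lra.
have S2K : `|S2| <= K by rewrite (le_trans hS2)// ler_piMr.
(* A crude bound first: the equation of the curve makes [y] of order [a], which turns all the O(y^2)
   errors into O(a^2). *)
have b1 : `|y| <= 4 * K * a.
  have := tri _ _ _ _ hY (tri _ _ _ _ (nN _ _ (prod _ _ _ _ na (prod _ _ _ _ s1 Ch2)))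
    (nN _ _ (prod _ _ _ _ na (prod _ _ _ _ nk (prod _ _ _ _ m1 S2K))))).
  rewrite (_ : _ + _ = y); last ring.
  move/le_trans; apply.
  have : a ^+ 3 <= a by clear - a0 a1; rewrite exprS; nra.
  by clear - K1 a0 a1; nra.
have yy : y ^+ 2 <= 16 * K ^+ 2 * a ^+ 2.
  rewrite -(@real_normK _ y) ?num_real// (_ : 16 * _ * _ = (4 * K * a) ^+ 2); last ring.
  by rewrite lerXn2r// nnegrE// (le_trans _ b1).
have Kyy : K * y ^+ 2 <= 16 * K ^+ 3 * a ^+ 2.
  by rewrite (_ : 16 * _ * _ = K * (16 * K ^+ 2 * a ^+ 2)); [rewrite ler_wpM2l|ring].
have {}hC := le_trans hC Kyy; have {}hS := le_trans hS Kyy.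
have {}hC2 := le_trans hC2 Kyy.
have {}hS2 : `|S2| <= 4 * K ^+ 2 * a.
  by rewrite (le_trans hS2)// (_ : 4 * _ * _ = K * (4 * K * a)); [rewrite ler_wpM2l|ring].
set J := K ^+ 3 in K3 Ka Kyy hC hS hC2.
have J1 : 1 <= J by clear - K1 K2 K3; lra.
have a2 : 0 < a ^+ 2 by rewrite exprn_gt0.
have a3 : a ^+ 3 <= a ^+ 2 / (40 * 40) by clear - a0 a1 a2; rewrite exprS; nra.
have a30 : 0 < a ^+ 3 by rewrite exprn_gt0.
(* Feeding the crude bound back into the equation of the curve isolates the leading term - a s of
   [y]. *)
have b2 : `|y + a * s| <= 20 * J * a ^+ 2.
  have := tri _ _ _ _ hY (tri _ _ _ _ (nN _ _ (prod _ _ _ _ na (prod _ _ _ _ s1 hC)))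
    (nN _ _ (prod _ _ _ _ na (prod _ _ _ _ nk (prod _ _ _ _ m1 hS2))))).
  rewrite (_ : _ + _ = y + a * s); last ring.
  move/le_trans; apply.
  rewrite (_ : _ + _ = a ^+ 3 * (1 + 16 * J + 3 / 2 * K ^+ 2)); last by field.
  have : a ^+ 3 * (1 + 16 * J + 3 / 2 * K ^+ 2) <= a ^+ 3 * (20 * J).
    by rewrite ler_pM2l//; clear - J1 K2 K3; lra.
  by move/le_trans; apply; clear - J1 a2 a3; nra.
have b3 : `|S + a * s| <= 36 * J * a ^+ 2.
  have := tri _ _ _ _ hS b2; rewrite (_ : _ + _ = S + a * s); last ring.
  by move/le_trans; apply; clear; lra.
pose e5 := a * (s * (S + a * s)) + - (3 / 8) * a * (a * (2 * (m * (C2 - 1)))).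
pose e6 := a * (c * (Ch - 1)) + - (- (3 / 8) * a * (a * (2 * (n * S2)))).
have n2 : `|2 : R| <= 2 by rewrite ger0_norm.
have e5b : `|e5| <= 3 / (10 * 10) * a ^+ 2.
  have := tri _ _ _ _ (prod _ _ _ _ na (prod _ _ _ _ s1 b3))
    (prod _ _ _ _ nk (prod _ _ _ _ na (prod _ _ _ _ n2 (prod _ _ _ _ m1 hC2)))).
  move/le_trans; apply.
  rewrite (_ : _ + _ = (J * a) * a ^+ 2 * (36 + 12 * a)); last by field.
  have Ja0 : 0 < J * a by rewrite mulr_gt0//; apply: lt_le_trans J1.
  have : J * a * (36 + 12 * a) <= 3 / (10 * 10) by clear - Ja0 Ka a1; nra.
  by move=> h; rewrite mulrAC ler_wpM2r// ltW.
have e6b : `|e6| <= 3 / (10 * 10) * a ^+ 2.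
  have := tri _ _ _ _ (prod _ _ _ _ na (prod _ _ _ _ c1 hC))
    (nN _ _ (prod _ _ _ _ nk (prod _ _ _ _ na (prod _ _ _ _ n2 (prod _ _ _ _ n1 hS2))))).
  move/le_trans; apply.
  rewrite (_ : _ + _ = a ^+ 2 * (16 * (J * a) + 3 * (K ^+ 2 * a))); last by field.
  have : K ^+ 2 * a <= J * a by rewrite ler_pM2r.
  by clear - Ka a2; nra.
(* Main terms: - a^2 s^2 from the first harmonic and - (3/4) a^2 (1 - 2 s^2) from the second. *)
have q1 : 1 + a * (s * S + - (3 / 8) * a * (2 * m * C2)) =
  1 - (a ^+ 2 * (3 / 4 - s ^+ 2 / 2) - e5) by clear - mE; rewrite /e5 mE; field.
have q2 : a * (c * Ch - - (3 / 8) * a * (2 * n * S2)) = a * c + e6.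
  by clear; rewrite /e6; field.
rewrite q1 q2; have c2 : c ^+ 2 = 1 - s ^+ 2 by clear - sc; lra.
rewrite [(a * c + e6) ^+ 2]sqrrD [(a * c) ^+ 2]exprMn c2.
move: e5 e6 e5b e6b {q1 q2 b1 b2 b3 hC hS hC2 hS2 hY} => e f.
have s2 : 0 <= s ^+ 2 <= 1 by clear - sc; apply/andP; split; nra.
have b1 : a ^+ 2 <= 1 / (10 * 10) by clear - a0 a1; nra.
clear mE nE y1 m1 n1 na nk y2 Ch2 S2K yy Kyy tri prod nN K2 K3 Ka J1 aK c2 sc n2.
move: (s ^+ 2) s2 => u /andP[u0 u1]; move: (a ^+ 2) a2 a3 b1 => b b0 ab3 b1 eb fb.
move: eb fb; rewrite !ler_norml => /andP[e1 e2] /andP[f1 f2].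
have acf : a * c * f *+ 2 <= b / (10 * 10).
  move: c1; rewrite ler_norml => /andP[c3 c4].
  have : a * c <= a by nra.
  have : - a <= a * c by nra.
  by move=> *; rewrite mulr2n; nra.
have ff : f ^+ 2 <= b / (10 * 10) by nra.
have [t tE] : exists t, t = b * (3 / 4 - u / 2) - e by eexists.
rewrite -tE; have t0 : 0 <= t by nra.
have t1 : t <= b by nra.
have tt : t ^+ 2 <= b / (10 * 10) by nra.
(* The terms in [u] cancel: - 2 b (3/4 - u/2) + b (1 - u) = - b/2, and the errors total at most
   9/100 of [b]. *)
by rewrite sqrrB expr1n mul1r mulr2n; nra.
Qed.

End contraction.

Section contraction_strip.
Variable R : realType.

Lemma contraction_strip : exists2 a1 : R, 0 < a1 <= 1 &
  forall (a : R) (z : R * R), 0 < a -> a <= a1 -> `|z.2| <= 1 ->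
  `|z.2 + a * PY a z| <= a ^+ 3 ->
  (1 + a * PX1 a z) ^+ 2 + (a * PY1 a z) ^+ 2 <= 1 - a ^+ 2 / 4.
Proof.
have [K K1 hK] := hyperbolic_bounds R.
have K3 : 1 <= K ^+ 3 by rewrite exprn_ege1.
exists ((40 * 40) * K ^+ 3)^-1 => [|a z a0 aa z2 hz].
  by apply/andP; split; [rewrite invr_gt0|rewrite invf_le1]; lra.
have [e1 e2 e3 _ _] := perturbation_strip a z2.
have [h1 h2 h3 h4] := hK _ z2.
rewrite e1 in hz; rewrite e2 e3.
apply: (contraction_algebra (K := K) (s := sin z.1) (c := cos z.1) (m := cos (2 * z.1))
  (n := sin (2 * z.1))) h1 h2 h3 h4 hz => //.
- by rewrite mulrC -ler_pdivlMr ?div1r//; lra.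
- by rewrite addrC cos2Dsin2.
- by rewrite mulr_natl cos_mulr2n cos2sin2; ring.
- by rewrite mulr_natl sin_mulr2n; ring.
Qed.

End contraction_strip.

(** * Rescaling and the chain rule, with constants *)

Section composition.
Variable R : realType.
Implicit Types (f : R * R -> R) (z w : R * R) (K L Q N : R).

Lemma c11_fst : c11 1 0 (fun z : R * R => z.1) (fun=> 1) (fun=> 0).
Proof.
move=> z w; rewrite !subrr !normr1 !normr0 !mul0r mul1r.
split=> //; first exact: norm_fst (w - z).
by rewrite mul1r addr0 subrr normr0.
Qed.

Lemma c11_snd : c11 1 0 (fun z : R * R => z.2) (fun=> 0) (fun=> 1).
Proof.
move=> z w; rewrite !subrr !normr1 !normr0 !mul0r mul1r.
split=> //; first exact: norm_snd (w - z).
by rewrite mul1r add0r subrr normr0.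
Qed.

(** The scaling preserves first derivatives and multiplies second-order quantities by [N]: high
    frequency costs nothing in [L] and everything in [Q]. *)
Lemma c11_rescale N L Q f f1 f2 : 0 < N -> c11 L Q f f1 f2 ->
  c11 L (N * Q) (fun z => N^-1 * f (N *: z)) (fun z => f1 (N *: z))
    (fun z => f2 (N *: z)).
Proof.
move=> N0 cf z w; have [a1 a2 [a3 a4] a5] := cf (N *: z) (N *: w).
have nE : `|N *: w - N *: z| = N * `|w - z| by rewrite -scalerBr normrZ gtr0_norm.
rewrite nE in a2 a3 a4 a5; split; [by []| | |].
- rewrite -mulrBr normrM gtr0_norm ?invr_gt0// ler_pdivrMl//.
  by apply: le_trans a2 _; rewrite mulrCA.
- by split; rewrite [N * Q]mulrC -mulrA.
- have -> : N^-1 * f (N *: w) - N^-1 * f (N *: z) -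
     (f1 (N *: z) * (w.1 - z.1) + f2 (N *: z) * (w.2 - z.2)) =
     N^-1 * (f (N *: w) - f (N *: z) - (f1 (N *: z) * ((N *: w).1 - (N *: z).1)
        + f2 (N *: z) * ((N *: w).2 - (N *: z).2))).
    by rewrite /= /GRing.scale/=; field; rewrite gt_eqF.
  rewrite normrM gtr0_norm ?invr_gt0// ler_pdivrMl//.
  by apply: le_trans a5 _; rewrite le_eqVlt; apply/orP; left; apply/eqP; ring.
Qed.

(** The row bound [|g1| + |g2| <= 2] makes each composition at most double [L]. The resulting
    second-order constant is the one iterated in the definition of [quad]. *)
Lemma c11_comp (g g1 g2 X X1 X2 Y Y1 Y2 : R * R -> R) (Qg L Q : R) :
  0 <= Qg -> 0 <= L -> c11 2 Qg g g1 g2 -> (forall z, `|g1 z| + `|g2 z| <= 2) ->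
  c11 L Q X X1 X2 -> c11 L Q Y Y1 Y2 ->
  let F z := (X z, Y z) in
  c11 (2 * L) (2 * Q + 2 * Qg * L ^+ 2) (g \o F)
    (fun z => g1 (F z) * X1 z + g2 (F z) * Y1 z)
    (fun z => g1 (F z) * X2 z + g2 (F z) * Y2 z).
Proof.
move=> Qg0 L0 cg g12 cX cY F z w.
have [[a1 a2] a3 [a4 a5] a6] := cg (F z) (F w).
have [[b1 b2] b3 [b4 b5] b6] := cX z w.
have [[d1 d2] d3 [d4 d5] d6] := cY z w.
have [[e1 e2] _ _ _] := cX w z; have [[e3 e4] _ _ _] := cY w z.
have FL : `|F w - F z| <= L * `|w - z| by apply: norm_le_pair.
have s12 := g12 (F z); have t12 := g12 (F w).
have comb (u v x y B : R) : `|u| + `|v| <= 2 -> `|x| <= B -> `|y| <= B ->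
    `|u * x + v * y| <= 2 * B.
  move=> uv xB yB; rewrite (le_trans (ler_normD _ _))// !normrM.
  have B0 : 0 <= B by exact: le_trans xB.
  apply: (@le_trans _ _ (`|u| * B + `|v| * B)).
    by apply: lerD; rewrite ler_wpM2l.
  by rewrite -mulrDl ler_wpM2r.
have {}a4 : `|g1 (F w) - g1 (F z)| <= Qg * L * `|w - z|.
  by apply: le_trans a4 _; rewrite -mulrA ler_wpM2l.
have {}a5 : `|g2 (F w) - g2 (F z)| <= Qg * L * `|w - z|.
  by apply: le_trans a5 _; rewrite -mulrA ler_wpM2l.
have dl (U V U' V' : R) : `|U'| <= L -> `|V'| <= L ->
    `|U' - U| <= Q * `|w - z| -> `|V' - V| <= Q * `|w - z| ->
    `|g1 (F w) * U' + g2 (F w) * V' - (g1 (F z) * U + g2 (F z) * V)|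
      <= (2 * Q + 2 * Qg * L ^+ 2) * `|w - z|.
  move=> U1 V1 UU VV.
  rewrite (_ : _ - _ = (g1 (F z) * (U' - U) + g2 (F z) * (V' - V)) +
    ((g1 (F w) - g1 (F z)) * U' + (g2 (F w) - g2 (F z)) * V')); last ring.
  rewrite [leRHS]mulrDl; apply: le_trans (ler_normD _ _) _; apply: lerD.
    by rewrite -mulrA; exact: comb.
  rewrite (le_trans (ler_normD _ _))// !normrM.
  rewrite (_ : 2 * Qg * _ * _ = Qg * L * `|w - z| * L + Qg * L * `|w - z| * L);
    last ring.
  by apply: lerD; apply: ler_pM.
split.
- by split; exact: comb.
- by apply: le_trans a3 _; rewrite -mulrA ler_wpM2l.
- by split; exact: dl.
- rewrite /=; set dX := X w - X z - (_ + _) in b6; set dY := Y w - Y z - (_ + _) in d6.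
  rewrite (_ : g (F w) - g (F z) - _ = (g (F w) - g (F z) -
     (g1 (F z) * ((F w).1 - (F z).1) + g2 (F z) * ((F w).2 - (F z).2))) +
     (g1 (F z) * dX + g2 (F z) * dY)); last by rewrite /dX /dY /=; ring.
  rewrite [leRHS]mulrDl [leRHS]addrC.
  apply: le_trans (ler_normD _ _) _; apply: lerD; last first.
    by rewrite -mulrA; exact: comb.
  apply: le_trans a6 _.
  have : `|F w - F z| ^+ 2 <= (L * `|w - z|) ^+ 2.
    by rewrite lerXn2r// nnegrE// mulr_ge0.
  move=> h; have : Qg * `|F w - F z| ^+ 2 <= Qg * (L * `|w - z|) ^+ 2.
    by rewrite ler_wpM2l.
  move/le_trans; apply; rewrite exprMn mulrA -[X in X <= _]mul1r -!mulrA.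
  by rewrite ler_wpM2r ?ler1n// !mulr_ge0// exprn_ge0.
Qed.

End composition.

(** * Amplitudes, frequencies and scales *)

Section scales.
Variables (R : realType) (C a1 : R).

(** The divisor 400 C makes [C * amax] at most 1/400, so the entries of the differential of each
    step are within 1/400 of those of the identity; it also keeps [amax] below the threshold [a1] of
    the contraction estimate. *)
Definition amax : R := a1 / (20 * 20 * C).
Definition amp (k : nat) : R := amax / Num.sqrt k.+1%:R.
(** The cube of [amax] is there to cancel against [amp k ^+ 3] in [freq_cube]. *)
Definition freq0 : R := 20 * 20 / amax ^+ 3.

(* [quad k] bounds the second-order Taylor remainder of the composition of the
   first k maps; its recursion is the chain rule for that bound.  At scales below
   [radius k] this composition is close to affine, and [freq k] is so large that
   the k-th map displaces points by a negligible fraction of [radius k]. *)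
Fixpoint quad (k : nat) : R :=
  if k is k'.+1 then 2 * quad k' + 2 * C * (freq0 * 16 ^+ k' * quad k') * 4 ^+ k'
  else (10 * 10)^-1.

Definition freq (k : nat) : R := freq0 * 16 ^+ k * quad k.
Definition radius (k : nat) : R := (10 * 10 * 2 ^+ k * quad k)^-1.

Hypothesis C1 : 1 <= C.
Hypothesis a10 : 0 < a1 <= 1.

Lemma amax_gt0 : 0 < amax.
Proof. by have /andP[? ?] := a10; rewrite divr_gt0// !mulr_gt0//; have := C1; lra. Qed.

Lemma C_amax : C * amax <= (20 * 20)^-1.
Proof.
have /andP[? ?] := a10; have C0 : 0 < C by have := C1; lra.
rewrite /amax (_ : _ * _ = (20 * 20)^-1 * a1); last by field; rewrite gt_eqF.
by rewrite ler_piMr// invr_ge0; lra.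
Qed.

Lemma amax_le : amax <= (20 * 20)^-1.
Proof.
apply: le_trans C_amax; rewrite ler_peMl//; exact: ltW amax_gt0.
Qed.

Lemma amax_le_a1 : amax <= a1.
Proof.
have /andP[? ?] := a10; have C0 : 0 < C by have := C1; lra.
by rewrite /amax ler_pdivrMr ?mulr_gt0//; have := C1; nra.
Qed.

Lemma sqrtS_ge1 k : 1 <= Num.sqrt (k.+1%:R : R).
Proof. by rewrite -[leLHS]sqrtr1 ler_sqrt ?ler1n// ltr0n. Qed.

Lemma amp_gt0 k : 0 < amp k.
Proof. by rewrite divr_gt0 ?amax_gt0// (lt_le_trans _ (sqrtS_ge1 k)). Qed.

Lemma amp_le_amax k : amp k <= amax.
Proof.
have := sqrtS_ge1 k => s1; rewrite ler_pdivrMr ?(lt_le_trans _ s1)//.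
by rewrite ler_peMr// ltW// amax_gt0.
Qed.

Lemma amp_le j k : (j <= k)%N -> amp k <= amp j.
Proof.
move=> jk; rewrite ler_pM2l ?amax_gt0// lef_pV2 ?posrE; last 2 first.
- by rewrite (lt_le_trans _ (sqrtS_ge1 k)).
- by rewrite (lt_le_trans _ (sqrtS_ge1 j)).
by rewrite ler_wsqrtr// ler_nat ltnS.
Qed.

Lemma amp_sqr k : amp k ^+ 2 = amax ^+ 2 / k.+1%:R.
Proof. by rewrite expr_div_n sqr_sqrtr// ler0n. Qed.

Lemma amp_cvg0 : amp k @[k --> \oo] --> 0.
Proof.
apply/cvgrPdist_le => e e0.
have e1 : 0 < e / amax by rewrite divr_gt0 ?amax_gt0.
have := @cvg_harmonic R => /cvgrPdist_le /(_ _ (exprn_gt0 2 e1)).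
apply: filterS => k; rewrite !sub0r !normrN /harmonic /=.
rewrite ger0_norm ?invr_ge0// ger0_norm ?(ltW (amp_gt0 k))// => h.
suff : amp k ^+ 2 <= e ^+ 2 by rewrite ler_pXn2r// nnegrE ltW// amp_gt0.
by rewrite amp_sqr mulrC -ler_pdivlMr ?exprn_gt0 ?amax_gt0// -expr_div_n.
Qed.

Lemma freq0_ge : 20 * 20 <= freq0.
Proof.
have a0 := amax_gt0; have al := amax_le.
rewrite ler_pdivlMr ?exprn_gt0//; have : amax ^+ 3 <= 1.
  by rewrite exprn_ile1 ?(ltW a0)// (le_trans al)//; lra.
lra.
Qed.

Lemma quad_gt0 k : 0 < quad k.
Proof.
have b0 := freq0_ge; elim: k => [|k IH] /=; first by rewrite invr_gt0; lra.
have f0 : 0 < freq0 by lra.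
have C0 : 0 < C by have := C1; lra.
apply: addr_gt0; first by rewrite mulr_gt0.
by move: freq0 f0 {b0} => f f0; rewrite !mulr_gt0// exprn_gt0.
Qed.

(** The recursion in the form delivered by [c11_comp], with Lipschitz constant 2^k for the
    composition so far and second-order constant [C * freq k] for one step. *)
Lemma quadSE k : quad k.+1 = 2 * quad k + 2 * (C * freq k) * (2 ^+ k) ^+ 2.
Proof.
rewrite /= /freq -exprM mulnC exprM (_ : 2 ^+ 2 = 4 :> R); last ring.
by rewrite !mulrA.
Qed.

Lemma freq_gt0 k : 0 < freq k.
Proof.
have f0 : 0 < freq0 by have := freq0_ge; lra.
have q0 := quad_gt0 k; rewrite /freq; move: freq0 f0 (quad k) q0 => f f0 q q0.
by rewrite !mulr_gt0// exprn_gt0.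
Qed.

(** The second summand of [quad k.+1] alone contains [freq k]; the factor [freq0 * 16 ^+ k.+1] in
    front of it gives the growth. *)
Lemma freqS_ge k : 32 * freq0 * 64 ^+ k * freq k <= freq k.+1.
Proof.
have b0 := freq0_ge; have f0 : 0 < freq0 by lra.
have N0 := freq_gt0 k; have Q0 := quad_gt0 k.
have p4 : 0 < 4 ^+ k :> R by rewrite exprn_gt0.
have p16 : 0 < 16 ^+ k :> R by rewrite exprn_gt0.
rewrite /(freq k.+1) quadSE -exprM mulnC exprM (_ : 2 ^+ 2 = 4 :> R); last ring.
rewrite exprS (_ : 64 = 16 * 4 :> R); last ring.
rewrite exprMn.
move: freq0 (freq k) (quad k) (4 ^+ k) (16 ^+ k) f0 N0 Q0 p4 p16 {b0}.
move=> f n q x y f0 n0 q0 x0 y0.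
have nC : n * x <= C * n * x by rewrite ler_pM2r// ler_peMl ?C1// ltW.
rewrite (_ : 32 * _ * _ * _ = f * (16 * y) * (2 * (n * x))); last ring.
rewrite ler_pM2l ?mulr_gt0//; lra.
Qed.

Lemma freq_first : 4 <= freq 0.
Proof. by rewrite /freq /= mulr1 ler_pdivlMr; have := freq0_ge; lra. Qed.

Lemma freq_growth k : 4 * freq k <= freq k.+1.
Proof.
apply: le_trans (freqS_ge k); rewrite ler_pM2r ?freq_gt0//.
have b0 := freq0_ge; have : 1 <= 64 ^+ k :> R by rewrite exprn_ege1// ler1n.
nra.
Qed.

(** A height below [2 / freq k.+1] is at most [amp k ^+ 3] in units of [(freq k)^-1]: the closeness
    to the curve that the contraction estimate demands. *)
Lemma freq_cube k : 2 * freq k <= amp k ^+ 3 * freq k.+1.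
Proof.
have a0 := amax_gt0; have N0 := freq_gt0 k.
have s1 := sqrtS_ge1 k; have s0 := lt_le_trans ltr01 s1.
apply: (@le_trans _ _ (amp k ^+ 3 * (32 * freq0 * 64 ^+ k * freq k))); last first.
  by rewrite ler_pM2l ?exprn_gt0 ?amp_gt0// freqS_ge.
rewrite mulrA ler_pM2r// /amp /freq0 expr_div_n.
set s := Num.sqrt _ in s1 s0 *.
rewrite (_ : _ * _ = 32 * (20 * 20) * (64 ^+ k / s ^+ 3)); last first.
  by field; rewrite !gt_eqF.
have : 1 <= 64 ^+ k / s ^+ 3.
  rewrite ler_pdivlMr ?exprn_gt0// mul1r.
  (* With s^2 = k + 1: s^3 <= s^4 = (k + 1)^2 <= 8^(2k) = 64^k. *)
  apply: (@le_trans _ _ (s ^+ 4)); first by rewrite ler_weXn2l.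
  rewrite (_ : s ^+ 4 = (s ^+ 2) ^+ 2); last by rewrite -exprM.
  rewrite sqr_sqrtr// (_ : 64 = (8 : R) ^+ 2); last ring.
  rewrite -exprM mulnC exprM lerXn2r ?nnegrE ?exprn_ge0//.
  rewrite -natrX ler_nat; exact: ltn_expl.
lra.
Qed.

Lemma radius_gt0 k : 0 < radius k.
Proof. by rewrite invr_gt0 !mulr_gt0 ?exprn_gt0 ?quad_gt0. Qed.

Lemma radius0 : radius 0 = 1.
Proof. by rewrite /radius /=; field. Qed.

(** While a point is in the strips, a step shrinks lengths at most by half, so the linear part may
    be as small as 2^-k; the factor 2^k keeps the quadratic remainder a small fraction of it at
    scales up to [radius k]. *)
Lemma radius_quad k : 2 ^+ k * quad k * radius k = (10 * 10)^-1.
Proof.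
by rewrite /radius; field; rewrite !gt_eqF ?quad_gt0 ?exprn_gt0.
Qed.

Lemma radius_half k : 2 * radius k.+1 <= radius k.
Proof.
have Q0 := quad_gt0 k; have Q1 := quad_gt0 k.+1.
have p2 : 0 < 2 ^+ k :> R by rewrite exprn_gt0.
have QQ : quad k <= quad k.+1.
  have C0 : 0 <= C by have := C1; lra.
  have : 0 <= 2 * (C * freq k) * (2 ^+ k) ^+ 2.
    apply: mulr_ge0; last exact: sqr_ge0.
    by apply: mulr_ge0 => //; apply: mulr_ge0 => //; exact: ltW (freq_gt0 k).
  rewrite quadSE; lra.
rewrite /radius exprS.
rewrite (_ : 2 * _ = (10 * 10 * 2 ^+ k * quad k.+1)^-1); last first.
  by field; rewrite !gt_eqF.
by rewrite lef_pV2 ?posrE ?mulr_gt0// ler_pM2l// mulr_gt0.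
Qed.

(** The displacement of step [k.+1] is a small multiple of [(freq k.+1)^-1], hence negligible at
    scale [radius k.+1] even after lengths have shrunk by 2^k. *)
Lemma freq_radius k : 2 ^+ k <= freq k.+1 * radius k.+1.
Proof.
have Q1 := quad_gt0 k.+1; have p2 : 0 < 2 ^+ k.+1 :> R by rewrite exprn_gt0.
rewrite /freq /radius (_ : _ * _ = freq0 / (10 * 10) * (16 ^+ k.+1 / 2 ^+ k.+1)); last first.
  by field; rewrite !gt_eqF.
rewrite -expr_div_n (_ : 16 / 2 = 8 :> R); last by field.
have b0 := freq0_ge; have b1 : 1 <= freq0 / (10 * 10) by rewrite ler_pdivlMr; lra.
apply: (@le_trans _ _ (1 * 8 ^+ k.+1)).
  rewrite mul1r; apply: (@le_trans _ _ (8 ^+ k)).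
    by rewrite lerXn2r ?nnegrE// ler_nat.
  by rewrite ler_weXn2l// ler1n.
by rewrite ler_wpM2r ?exprn_ge0.
Qed.

End scales.

(** * The iteration *)

Section iteration.
Variables (R : realType) (C a1 : R).
Implicit Types (z w v : R * R) (k j l : nat).

Local Notation amp := (amp C a1).
Local Notation freq := (freq C a1).
Local Notation quad := (quad C a1).
Local Notation amax := (amax C a1).

Definition step k z : R * R :=
  (z.1 + amp k * ((freq k)^-1 * PX (amp k) (freq k *: z)),
   z.2 + amp k * ((freq k)^-1 * PY (amp k) (freq k *: z))).

Fixpoint approx k z : R * R :=
  if k is k'.+1 then step k' (approx k' z) else z.

(** The entries of the differential of [step]; the summands [0 +] match what [c11D] produces from
    the coordinate functions. *)
Definition sX1 k z : R := 1 + amp k * PX1 (amp k) (freq k *: z).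
Definition sX2 k z : R := 0 + amp k * PX2 (amp k) (freq k *: z).
Definition sY1 k z : R := 0 + amp k * PY1 (amp k) (freq k *: z).
Definition sY2 k z : R := 1 + amp k * PY2 (amp k) (freq k *: z).

(** The differential of [approx k] applied to [v], written out by the chain rule; [c11_approx]
    identifies it as such. *)
Fixpoint jac v k z : R * R :=
  if k is k'.+1 then
    let d := jac v k' z in let w := approx k' z in
    (sX1 k' w * d.1 + sX2 k' w * d.2, sY1 k' w * d.1 + sY2 k' w * d.2)
  else v.

(** The region in which step [k] may differ from the identity. Level 0 admits every point, so that
    estimates stated for a strip also yield global ones. *)
Definition strip k z := k = 0%N \/ freq k * `|(approx k z).2| < 2.

Definition sqnorm v : R := v.1 ^+ 2 + v.2 ^+ 2.

(** Multiplication by the complex number v.1 + i v.2 has columns (v.1, v.2) and (- v.2, v.1); [e] is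
    the error relative to its modulus. *)
Definition near_conformal (e : R) v c1 c2 :=
  [/\ `|c1.1 - v.1| <= e * Num.sqrt (sqnorm v), `|c1.2 - v.2| <= e * Num.sqrt (sqnorm v),
      `|c2.1 + v.2| <= e * Num.sqrt (sqnorm v) & `|c2.2 - v.1| <= e * Num.sqrt (sqnorm v)].

Hypothesis C1 : 1 <= C.
Hypothesis a10 : 0 < a1 <= 1.
Hypothesis pert : forall a : R, 0 <= a -> a <= 1 ->
  [/\ forall z, `|PX a z| <= C, c11 C C (PX a) (PX1 a) (PX2 a),
      forall z, `|PY a z| <= C & c11 C C (PY a) (PY1 a) (PY2 a)].
Hypothesis contr : forall (a : R) z, 0 < a -> a <= a1 -> `|z.2| <= 1 ->
  `|z.2 + a * PY a z| <= a ^+ 3 ->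
  (1 + a * PX1 a z) ^+ 2 + (a * PY1 a z) ^+ 2 <= 1 - a ^+ 2 / 4.

Let C0 : 0 < C. Proof. exact: lt_le_trans C1. Qed.
Let N0 k : 0 < freq k. Proof. exact: freq_gt0. Qed.
Let A0 k : 0 < amp k. Proof. exact: amp_gt0. Qed.

Lemma C_amp k : C * amp k <= (20 * 20)^-1.
Proof. by apply: le_trans (C_amax C1 a10); rewrite ler_pM2l// amp_le_amax. Qed.

Lemma amp_le1 k : amp k <= 1.
Proof.
apply: le_trans (amp_le_amax C1 a10 k) _; have /andP[_] := a10.
exact: le_trans (amax_le_a1 C1 a10).
Qed.

Let pertk k := pert (ltW (A0 k)) (amp_le1 k).

Lemma step_dist k z : `|step k z - z| <= C * amp k / freq k.
Proof.
have [bX _ bY _] := pertk k.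
have h (a n x : R) : 0 < a -> 0 < n -> `|x| <= C ->
    `|a * (n^-1 * x)| <= C * a / n.
  move=> a0 n0 xC; rewrite !normrM normfV (gtr0_norm a0) (gtr0_norm n0).
  rewrite (_ : C * a / n = a * (n^-1 * C)); last ring.
  by rewrite ler_pM2l// ler_pM2l ?invr_gt0.
by apply: norm_le_pair; rewrite /step /= [_ + _ - _]addrAC subrr add0r; apply: h.
Qed.

Lemma step_lipschitz k z w :
  `|step k w - w - (step k z - z)| <= C * amp k * `|w - z|.
Proof.
have [_ cX _ cY] := pertk k.
have [_ lX _ _] := c11Z (amp k) (c11_rescale (N0 k) cX) z w.
have [_ lY _ _] := c11Z (amp k) (c11_rescale (N0 k) cY) z w.
rewrite (gtr0_norm (A0 k)) in lX lY.
apply: norm_le_pair; rewrite [C * _]mulrC /step /=; [move: lX|move: lY];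
  congr (`|_| <= _); ring.
Qed.

Lemma step_jacobian_bound k z : [/\ `|sX1 k z - 1| <= C * amp k,
  `|sX2 k z| <= C * amp k, `|sY1 k z| <= C * amp k & `|sY2 k z - 1| <= C * amp k].
Proof.
have [_ cX _ cY] := pertk k; rewrite /sX1 /sX2 /sY1 /sY2.
have [[h1 h2] _ _ _] := cX (freq k *: z) 0; have [[h3 h4] _ _ _] := cY (freq k *: z) 0.
have e (x : R) : 1 + x - 1 = x by ring.
by split; rewrite ?e ?add0r normrM (gtr0_norm (A0 k)) mulrC ler_pM2r.
Qed.

Lemma c11_step k :
  c11 2 (C * freq k) (fst \o step k) (sX1 k) (sX2 k) /\
  c11 2 (C * freq k) (snd \o step k) (sY1 k) (sY2 k).
Proof.
have [_ cX _ cY] := pertk k.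
have CA := C_amp k; have A1 := amp_le1 k.
have l : 1 + `|amp k| * C <= 2 by rewrite (gtr0_norm (A0 k)) mulrC; lra.
have q : 0 + `|amp k| * (freq k * C) <= C * freq k.
  by rewrite add0r (gtr0_norm (A0 k)) [freq k * C]mulrC ler_piMl// mulr_ge0// ltW.
split.
- have h := c11W l q (c11D (@c11_fst R) (c11Z (amp k) (c11_rescale (N0 k) cX))).
  exact: h.
- have h := c11W l q (c11D (@c11_snd R) (c11Z (amp k) (c11_rescale (N0 k) cY))).
  exact: h.
Qed.

Lemma c11_approx k :
  c11 (2 ^+ k) (quad k) (fst \o approx k)
    (fun z => (jac (1, 0) k z).1) (fun z => (jac (0, 1) k z).1) /\
  c11 (2 ^+ k) (quad k) (snd \o approx k)
    (fun z => (jac (1, 0) k z).2) (fun z => (jac (0, 1) k z).2).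
Proof.
elim: k => [|k [IX IY]].
  have q0 : 0 <= quad 0 by rewrite invr_ge0.
  by split; [apply: (c11W _ _ (@c11_fst R))|apply: (c11W _ _ (@c11_snd R))].
have [cX cY] := c11_step k.
have s12 z : `|sX1 k z| + `|sX2 k z| <= 2 /\ `|sY1 k z| + `|sY2 k z| <= 2.
  have [h1 h2 h3 h4] := step_jacobian_bound k z; have CA := C_amp k.
  have e1 : `|sX1 k z| <= C * amp k + 1.
    by rewrite -[sX1 k z](subrK 1) (le_trans (ler_normD _ _))// normr1 lerD2r.
  have e2 : `|sY2 k z| <= C * amp k + 1.
    by rewrite -[sY2 k z](subrK 1) (le_trans (ler_normD _ _))// normr1 lerD2r.
  split; lra.
have Qg : 0 <= C * freq k by rewrite mulr_ge0// ltW.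
have eX := c11_comp Qg (exprn_ge0 k (ler0n R 2)) cX (fun z => (s12 z).1) IX IY.
have eY := c11_comp Qg (exprn_ge0 k (ler0n R 2)) cY (fun z => (s12 z).2) IX IY.
have E : (fun z => ((fst \o approx k) z, (snd \o approx k) z)) = approx k.
  by apply/funext => z /=; case: (approx k z).
rewrite quadSE exprS.
split; [move: eX|move: eY]; rewrite /= => h z w; have := h z w;
  by rewrite /= -!surjective_pairing.
Qed.

Lemma step_out k z : 2 <= freq k * `|z.2| ->
  [/\ step k z = z, sX1 k z = 1, sX2 k z = 0, sY1 k z = 0 & sY2 k z = 1].
Proof.
move=> z2; have [|h1 h2 h3 h4 [h5 h6]] := @perturbation_out _ (amp k) (freq k *: z).
  by rewrite /= normrM (gtr0_norm (N0 k)).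
rewrite /step /sX1 /sX2 /sY1 /sY2 h1 h2 h3 h4 h5 h6 !mulr0 !addr0.
by split=> //; case: (z).
Qed.

Lemma step_strip k z : freq k * `|z.2| <= 1 -> sX2 k z = - sY1 k z /\ sY2 k z = sX1 k z.
Proof.
move=> z2; have [|_ _ _ h1 h2] := @perturbation_strip _ (amp k) (freq k *: z).
  by rewrite /= normrM (gtr0_norm (N0 k)).
by rewrite /sX1 /sX2 /sY1 /sY2 h1 h2 !add0r mulrN.
Qed.

Lemma step_contraction k z : freq k * `|z.2| <= 1 ->
  freq k * `|(step k z).2| <= amp k ^+ 3 ->
  sX1 k z ^+ 2 + sY1 k z ^+ 2 <= 1 - amp k ^+ 2 / 4.
Proof.
move=> z2 s2; rewrite /sX1 /sY1 add0r; apply: contr => //.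
- exact: le_trans (amp_le_amax C1 a10 k) (amax_le_a1 C1 a10).
- by rewrite /= normrM (gtr0_norm (N0 k)).
- move: s2; rewrite -[in X in X -> _](gtr0_norm (N0 k)) -normrM; congr (`|_| <= _).
  by rewrite /step /= /GRing.scale/=; field; rewrite gt_eqF.
Qed.

(** Step [k] moves points by at most 1/400 of [(freq k)^-1], and the strip of level [k.+1] is
    thinner still. So a point in it was, one step earlier, where step [k] is conformal, and has
    landed where the contraction estimate applies. *)
Lemma strip_pred k z : freq k.+1 * `|(approx k.+1 z).2| < 2 ->
  freq k * `|(approx k z).2| <= 1 /\ freq k * `|(approx k.+1 z).2| <= amp k ^+ 3.
Proof.
move=> h; have g := freq_growth C1 a10 k; have c := freq_cube C1 a10 k.
have Nk := N0 k; have NS := N0 k.+1; have CA := C_amp k.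
set y := `|_| in h *; have y0 : 0 <= y by exact: normr_ge0.
have d := le_trans (norm_snd _) (step_dist k (approx k z)).
rewrite ler_pdivlMr// in d.
have d' : `|(approx k z).2| * freq k <= y * freq k + C * amp k.
  apply: le_trans (lerD (lexx _) d); rewrite -mulrDl ler_pM2r// /y /=.
  rewrite -[X in `|X|](subrK (step k (approx k z)).2) addrC.
  by rewrite (le_trans (ler_normD _ _))// lerD2l distrC.
split.
  rewrite mulrC; apply: le_trans d' _.
  have : 4 * (y * freq k) <= 2.
    by apply: le_trans (ltW h); rewrite mulrCA mulrC ler_wpM2r// mulrC.
  lra.
have a3 : 0 < amp k ^+ 3 by rewrite exprn_gt0.
have : 2 * (freq k * y) <= amp k ^+ 3 * 2.
  apply: (@le_trans _ _ (amp k ^+ 3 * (freq k.+1 * y))).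
    rewrite [2 * _]mulrA [_ ^+ 3 * _]mulrA; exact: ler_wpM2r.
  by rewrite ler_pM2l// ltW.
lra.
Qed.

Lemma stripW k z : strip k.+1 z -> strip k z.
Proof. by case=> // /strip_pred[h _]; right; lra. Qed.

(** All earlier steps acted conformally, so [sqnorm] of the first column is the product of the
    factors |G_j'|^2. Each is at most the contraction factor, and at least 1/4 since the real part
    of G_j' is at least 1/2. *)
Lemma strip_conformal k z : strip k z ->
  jac (0, 1) k z = (- (jac (1, 0) k z).2, (jac (1, 0) k z).1) /\
  4^-1 ^+ k <= sqnorm (jac (1, 0) k z) <= \prod_(j < k) (1 - amp j ^+ 2 / 4).
Proof.
elim: k => [_|k IH sk].
  by rewrite /= oppr0 big_ord0 /sqnorm expr0n expr1n addr0 lexx.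
have [c /andP[n1 n2]] := IH (stripW sk).
have [//|/strip_pred[h1 h2]] := sk.
have [e1 e2] := step_strip h1; have ct := step_contraction h1 h2.
have [b1 _ _ _] := step_jacobian_bound k (approx k z); have CA := C_amp k.
rewrite big_ord_recr exprS.
have -> : sqnorm (jac (1, 0) k.+1 z) = (sX1 k (approx k z) ^+ 2 + sY1 k (approx k z) ^+ 2)
    * sqnorm (jac (1, 0) k z).
  by rewrite /sqnorm /= e1 e2; ring.
split; first by rewrite /= c e1 e2 /=; congr (_, _); ring.
have n0 : 0 <= sqnorm (jac (1, 0) k z) by rewrite addr_ge0// sqr_ge0.
apply/andP; split.
  apply: ler_pM => //; rewrite ?exprn_ge0 ?invr_ge0//.
  move: b1; rewrite ler_norml => /andP[? ?]; have := sqr_ge0 (sY1 k (approx k z)).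
  have : 1 / 2 <= sX1 k (approx k z) by lra.
  by move: (sX1 _ _) (sY1 _ _) => p q *; nra.
by rewrite mulrC ler_pM// addr_ge0// sqr_ge0.
Qed.

(** An orbit is first conformal, then makes at most one step in the transition region of the cutoff,
    and is fixed from then on. The single bad step deviates from the identity by O(amp), with index
    at least [j]; [v] is the last conformal differential. *)
Lemma near_conformal_jac j l z : (j <= l)%N -> strip j z ->
  exists2 v, 4^-1 ^+ l <= sqnorm v <= 1 &
    near_conformal (2 * (C * amp j)) v (jac (1, 0) l z) (jac (0, 1) l z).
Proof.
move=> jl sj; have p1 k : \prod_(j < k) (1 - amp j ^+ 2 / 4) <= 1.
  apply: prodr_ile1 => i _; apply/andP; split; last first.
    by rewrite lerBlDr lerDl mulr_ge0// sqr_ge0.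
  by have := amp_le1 i; have := A0 i; nra.
have CA i : 0 <= 2 * (C * amp i).
  by apply: mulr_ge0 => //; apply: mulr_ge0; apply: ltW.
elim: l jl => [|l IH] jl.
  move: jl sj; rewrite leqn0 => /eqP-> sj; have [c /andP[n1 n2]] := strip_conformal sj.
  exists (jac (1, 0) 0 z); first by rewrite n1 (le_trans n2).
  by split; rewrite ?c/= ?subrr ?addNr ?addr0 ?normr0 mulr_ge0.
move: jl; rewrite leq_eqVlt => /predU1P[jl|jl].
  rewrite -jl; have [c /andP[n1 n2]] := strip_conformal sj.
  exists (jac (1, 0) j z); first by rewrite n1 (le_trans n2).
  by split; rewrite ?c/= ?subrr ?addNr ?normr0 mulr_ge0.
(* Either step [l] is the identity at the point and the induction hypothesis carries over, or the
   point is still in strip [l], so that step [l] is the first that can fail to be conformal. *)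
have [fl|fl] := leP 2 (freq l * `|(approx l z).2|).
  have [v /andP[v1 v2] nc] := IH jl; exists v.
    rewrite v2 andbT (le_trans _ v1)// exprS ler_piMl ?exprn_ge0//.
    by rewrite invf_le1// ler1n.
  have [_ e1 e2 e3 e4] := step_out fl.
  by rewrite /= e1 e2 e3 e4 !mul1r !mul0r !addr0 !add0r -!surjective_pairing.
have [c /andP[n1 n2]] := strip_conformal (or_intror fl : strip l z).
exists (jac (1, 0) l z).
  rewrite (le_trans n2)// andbT (le_trans _ n1)// exprS ler_piMl ?exprn_ge0//.
  by rewrite invf_le1// ler1n.
have [b1 b2 b3 b4] := step_jacobian_bound l (approx l z).
rewrite /near_conformal /= c /=.
set m := Num.sqrt _; set p := (jac (1, 0) l z).1; set q := (jac (1, 0) l z).2.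
have pm : `|p| <= m by rewrite -sqrtr_sqr ler_wsqrtr// lerDl sqr_ge0.
have qm : `|q| <= m by rewrite -sqrtr_sqr ler_wsqrtr// lerDr sqr_ge0.
have comb (x y s t : R) : `|x| <= C * amp l -> `|y| <= C * amp l ->
    `|s| <= m -> `|t| <= m -> `|x * s + y * t| <= 2 * (C * amp j) * m.
  move=> xb yb sm tm; rewrite (le_trans (ler_normD _ _))// !normrM.
  have aa : C * amp l <= C * amp j by rewrite ler_pM2l// amp_le// ltnW.
  have -> : 2 * (C * amp j) * m = C * amp j * m + C * amp j * m by ring.
  by apply: lerD; apply: ler_pM => //; exact: le_trans aa.
split.
- by rewrite (_ : _ - _ = (sX1 l (approx l z) - 1) * p + sX2 l (approx l z) * q);
    [exact: comb|ring].
- by rewrite (_ : _ - _ = sY1 l (approx l z) * p + (sY2 l (approx l z) - 1) * q);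
    [exact: comb|ring].
- have -> : sX1 l (approx l z) * - q + sX2 l (approx l z) * p + q =
      (sX1 l (approx l z) - 1) * - q + sX2 l (approx l z) * p by ring.
  by apply: comb => //; rewrite normrN.
- have -> : sY1 l (approx l z) * - q + sY2 l (approx l z) * p - p =
      sY1 l (approx l z) * - q + (sY2 l (approx l z) - 1) * p by ring.
  by apply: comb => //; rewrite normrN.
Qed.

Definition gap k : R := C * amp k / freq k.

Lemma gap_gt0 k : 0 < gap k.
Proof. by rewrite /gap divr_gt0// mulr_gt0. Qed.

Lemma gapS k : 4 * gap k.+1 <= gap k.
Proof.
rewrite /gap mulrA ler_pdivrMr// mulrAC ler_pdivlMr//.
have aa : C * amp k.+1 <= C * amp k by rewrite ler_pM2l// amp_le.
have g := freq_growth C1 a10 k; rewrite -[leLHS]mulrA mulrCA.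
by apply: ler_pM => //; apply: ltW; rewrite mulr_gt0.
Qed.

Lemma gap_freq k : gap k * freq k <= (20 * 20)^-1.
Proof. by rewrite /gap divfK ?gt_eqF// C_amp. Qed.

Lemma gap_le k : gap k <= 4^-1 ^+ k.
Proof.
have n0 : 4 <= freq 0 := freq_first C1 a10.
elim: k => [|k IH]; first by have := gap_freq 0; have := gap_gt0 0; rewrite expr0; nra.
by rewrite exprS ler_pdivlMl//; apply: le_trans IH; exact: gapS.
Qed.

Lemma gap_cvg0 : gap k @[k --> \oo] --> 0.
Proof.
apply: (@squeeze_cvgr _ _ _ _ (fun=> 0) (geometric 1 4^-1)).
- by apply: nearW => k; rewrite ltW ?gap_gt0// /geometric/= mul1r gap_le.
- exact: cvg_cst.
- by apply: cvg_geometric; rewrite ger0_norm ?invr_ge0// invf_lt1// ltr1n.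
Qed.

(** As [gap l.+1] is at most a quarter of [gap l], one displacement is below
    [2 * (gap l - gap l.+1)]; the difference of gaps makes the induction telescope. *)
Lemma approx_dist k l z : (k <= l)%N ->
  `|approx l z - approx k z| <= 2 * (gap k - gap l).
Proof.
elim: l => [|l IH]; first by rewrite leqn0 => /eqP->; rewrite !subrr normr0 mulr0.
rewrite leq_eqVlt => /predU1P[->|kl]; first by rewrite !subrr normr0 mulr0.
have := IH kl; have := step_dist l (approx l z); rewrite -/(gap l) => h1 h2.
have g := gapS l; have g0 := gap_gt0 l.+1; have g1 := gap_gt0 l.
rewrite -(subrKA (approx l z)) (le_trans (ler_normD _ _))//.
apply: le_trans (lerD h1 h2) _; lra.
Qed.

Lemma approx_dist_gap k l z : (k <= l)%N ->
  `|approx l z - approx k z| <= 2 * gap k.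
Proof.
move=> kl; apply: le_trans (approx_dist z kl) _.
by have := gap_gt0 l; lra.
Qed.

Definition mapX z : R := lim ((approx k z).1 @[k --> \oo]).
Definition mapY z : R := lim ((approx k z).2 @[k --> \oo]).

Lemma cauchy_limit (u : nat -> R) :
  (forall k l, (k <= l)%N -> `|u l - u k| <= 2 * gap k) ->
  u k @[k --> \oo] --> lim (u k @[k --> \oo]) /\
  forall k, `|lim (u k @[k --> \oo]) - u k| <= 2 * gap k.
Proof.
move=> ug; have cu : cvg (u k @[k --> \oo]).
  apply: cauchy_cvg; apply: cauchy_exP => e e0.
  have /cvgr0_norm_le /(_ _ (divr_gt0 e0 (ltr0n R 4))) [k _ kP] := gap_cvg0.
  exists (u k); exists k => // l /= kl; rewrite -ball_normE /= distrC.
  apply: le_lt_trans (ug _ _ kl) _; have := kP k (leqnn k).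
  rewrite ger0_norm ?(ltW (gap_gt0 k))// => h; lra.
split=> // k; apply/ler_addgt0Pl => e e0.
have /cvgr_dist_le /(_ _ e0) [n _ nP] := cu.
have h1 := nP (maxn n k) (leq_maxl _ _); have h2 := ug k (maxn n k) (leq_maxr _ _).
by apply: le_trans (ler_distD (u (maxn n k)) _ _) _; exact: lerD.
Qed.

Lemma mapXP z : (approx k z).1 @[k --> \oo] --> mapX z /\
  forall k, `|mapX z - (approx k z).1| <= 2 * gap k.
Proof.
apply: cauchy_limit => k l kl; apply: le_trans (approx_dist_gap z kl).
exact: norm_fst (_ - _).
Qed.

Lemma mapYP z : (approx k z).2 @[k --> \oo] --> mapY z /\
  forall k, `|mapY z - (approx k z).2| <= 2 * gap k.
Proof.
apply: cauchy_limit => k l kl; apply: le_trans (approx_dist_gap z kl).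
exact: norm_snd (_ - _).
Qed.

Lemma freq_le j k : (j <= k)%N -> freq j <= freq k.
Proof.
elim: k => [|k IH]; first by rewrite leqn0 => /eqP->.
rewrite leq_eqVlt => /predU1P[->//|jk]; have := freq_growth C1 a10 k.
by have := IH jk; have := N0 k; lra.
Qed.

(** A point outside the reach of step [k] is outside that of all later steps, whose frequencies are
    higher. *)
Lemma approx_stable k l z v : 2 <= freq k * `|(approx k z).2| -> (k <= l)%N ->
  approx l z = approx k z /\ jac v l z = jac v k z.
Proof.
move=> fk; elim: l => [|l IH]; first by rewrite leqn0 => /eqP->.
rewrite leq_eqVlt => /predU1P[->//|kl]; have [e1 e2] := IH kl.
have fl : 2 <= freq l * `|(approx l z).2|.
  by rewrite e1 (le_trans fk)// ler_wpM2r// freq_le.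
have [s1 s2 s3 s4 s5] := step_out fl.
rewrite /= s1 s2 s3 s4 s5 e2 e1 !mul1r !mul0r addr0 add0r.
by case: (jac v k z).
Qed.

Lemma map_stable k z : 2 <= freq k * `|(approx k z).2| ->
  mapX z = (approx k z).1 /\ mapY z = (approx k z).2.
Proof.
move=> fk; split; apply: (cvg_lim (@Rhausdorff R)); apply: cvg_near_cst;
  by exists k => // l /= kl; have [->] := approx_stable 0 fk kl.
Qed.

Lemma map_outside z : 1 / 2 <= `|z.2| -> mapX z = z.1 /\ mapY z = z.2.
Proof.
move=> z2; have n0 : 4 <= freq 0 := freq_first C1 a10.
by apply: (@map_stable 0) => /=; nra.
Qed.

Lemma map_near_id z : `|mapX z - z.1| <= 1 / 4 /\ `|mapY z - z.2| <= 1 / 4.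
Proof.
have n0 : 4 <= freq 0 := freq_first C1 a10; have g := gap_freq 0.
have g0 := gap_gt0 0; have e : gap 0 <= 1 / 8 by nra.
have [_ /(_ 0%N) hX] := mapXP z; have [_ /(_ 0%N) hY] := mapYP z.
by split; [apply: le_trans hX _|apply: le_trans hY _]; lra.
Qed.

(** The heights of the orbit tend to a nonzero limit while the frequencies are unbounded. The
    inequality is strict so that it persists in a neighbourhood. *)
Lemma map_nonzero_stable z : mapY z != 0 ->
  exists k, 2 < freq k * `|(approx k z).2|.
Proof.
move=> y0; have d0 : 0 < `|mapY z| by rewrite normr_gt0.
have /cvgr0_norm_le /(_ _ (divr_gt0 d0 (ltr0n R 4))) [k _ kP] := gap_cvg0.
have [n nP] : exists n, 8 <= freq n * `|mapY z|.
  have [n nP] : exists n, 8 / `|mapY z| <= n%:R.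
    by exists (Num.bound (8 / `|mapY z|)); rewrite ltW// archi_boundP// divr_ge0.
  exists n; rewrite -ler_pdivrMr//; apply: le_trans nP _.
  elim: n => [|n IH]; first exact: ltW.
  have g := freq_growth C1 a10 n; have n0 : 4 <= freq 0 := freq_first C1 a10.
  have : 1 <= freq n.
    elim: n {IH g} => [|n IH]; first lra.
    by have := freq_growth C1 a10 n; lra.
  rewrite -natr1; lra.
have fm := freq_le (leq_maxl n k).
exists (maxn n k); have h := kP (maxn n k) (leq_maxr _ _).
have [_ /(_ (maxn n k)) hY] := mapYP z.
rewrite ger0_norm ?(ltW (gap_gt0 _))// in h.
have : `|mapY z| / 2 <= `|(approx (maxn n k) z).2|.
  have := ler_normD (mapY z - (approx (maxn n k) z).2) (approx (maxn n k) z).2.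
  rewrite subrK; lra.
move: (freq (maxn n k)) fm (N0 n) nP => f fm n0 nP ha.
have : 8 <= f * `|mapY z| by apply: le_trans nP _; rewrite ler_wpM2r.
have : f * (`|mapY z| / 2) <= f * `|(approx (maxn n k) z).2|.
  by rewrite ler_wpM2l// (le_trans _ fm)// ltW.
lra.
Qed.

Lemma map_zero_strip z k : mapY z = 0 -> strip k z.
Proof.
move=> y0; right; have [_ /(_ k)] := mapYP z; rewrite y0 sub0r normrN => h.
have g := gap_freq k; rewrite mulrC.
apply: le_lt_trans (ler_wpM2r (ltW (N0 k)) h) _; rewrite -mulrA; lra.
Qed.

(** With H_k the harmonic sums, (1 - c h)(1 + c (S + h)) <= 1 + c S shows inductively that the
    product times 1 + c H_k stays below 1; H_k diverges. *)
Lemma prod_amp_cvg0 : \prod_(j < k) (1 - amp j ^+ 2 / 4) @[k --> \oo] --> 0.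
Proof.
have b1 j : 0 <= 1 - amp j ^+ 2 / 4 <= 1.
  have := A0 j; have := amp_le1 j; have := sqr_ge0 (amp j) => ? ? ?.
  by apply/andP; split; nra.
pose c := amax ^+ 2 / 4; have c0 : 0 < c.
  by rewrite divr_gt0// exprn_gt0// amax_gt0.
have P0 k : 0 <= \prod_(j < k) (1 - amp j ^+ 2 / 4).
  by apply: prodr_ge0 => j _; have /andP[] := b1 j.
have S0 k : 0 <= series (@harmonic R) k by apply: sumr_ge0 => i _; exact: harmonic_ge0.
have prodle k :
    (\prod_(j < k) (1 - amp j ^+ 2 / 4)) * (1 + c * series (@harmonic R) k) <= 1.
  elim: k => [|k IH]; first by rewrite big_ord0 /series /= big_geq// mulr0 addr0 mulr1.
  have e : amp k ^+ 2 / 4 = c * harmonic k by rewrite amp_sqr /c /harmonic mulrAC.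
  rewrite big_ord_recr seriesSr; apply: le_trans IH.
  rewrite -mulrA; apply: ler_wpM2l => //.
  rewrite -[X in (1 - X) * _ <= _]/(amp k ^+ 2 / 4) e.
  have := harmonic_ge0 k : (0 : R) <= harmonic k.
  move: (harmonic k) (series _ _) (S0 k) => h S S0' h0.
  rewrite -subr_ge0 (_ : _ - _ = (c * h) * (c * (S + h))); last ring.
  have c0' := ltW c0; apply: mulr_ge0; apply: mulr_ge0 => //; exact: addr_ge0.
have dS : series (@harmonic R) k @[k --> \oo] --> +oo.
  apply: nondecreasing_dvgn_lt; last exact: dvg_harmonic.
  apply: nondecreasing_series => n _ _; exact: harmonic_ge0.
apply/cvgrPdist_le => e e0; have /cvgryPge /(_ (e^-1 / c)) := dS.
apply: filterS => k; rewrite ler_pdivrMr// => h.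
rewrite sub0r normrN ger0_norm//; have := prodle k; have := P0 k.
move: (\prod_(j < k) _) => P P0' Ple.
have : P * e^-1 <= 1.
  by apply: le_trans Ple; rewrite ler_wpM2l// [c * _]mulrC; lra.
by rewrite ler_pdivrMr// mul1r.
Qed.

(** The form in which uniform limits of Lipschitz maps present themselves: [L] may depend on [e]. *)
Lemma continuous_modulus (phi : R * R -> R) :
  (forall e : R, 0 < e -> exists L : R, forall z w,
     `|phi w - phi z| <= e + L * `|w - z|) -> continuous phi.
Proof.
move=> h z; apply/cvgrPdist_le => e e0.
have e2 : 0 < e / 2 by rewrite divr_gt0.
have [L LP] := h _ e2; have L0 : 0 < `|L| + 1 by rewrite ltr_wpDl.
apply/(@nbhs_ballP R (R * R)%type); exists (e / 2 / (`|L| + 1)); first by rewrite /= divr_gt0.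
move=> w; rewrite -ball_normE /= => zw; rewrite distrC.
apply: le_trans (LP z w) _; rewrite [leRHS](splitr e) lerD2l distrC.
move: zw; rewrite ltr_pdivlMr// => /ltW; apply: le_trans.
by rewrite mulrC ler_wpM2l// (le_trans (ler_norm L))// lerDl.
Qed.

Lemma box_min (phi : R * R -> R) z : continuous phi ->
  exists2 w, `|w - z| <= 1 & forall w', `|w' - z| <= 1 -> phi w <= phi w'.
Proof.
move=> cphi; pose B : set (R * R) :=
  (`[z.1 - 1, z.1 + 1]%classic `*` `[z.2 - 1, z.2 + 1]%classic).
have BE w : w \in B <-> `|w - z| <= 1.
  rewrite inE prod_normE ge_max /B /=; split.
    move=> [/=]; rewrite !in_itv/= => /andP[? ?] /andP[? ?].
    by rewrite !ler_norml; apply/andP; split; apply/andP; split; lra.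
  rewrite !ler_norml => /andP[/andP[? ?] /andP[? ?]].
  by split; rewrite /= in_itv /=; apply/andP; split; lra.
have [|||w /BE wz wmin] := @compact_EVT_min _ _ phi B.
- by exists z; apply/set_mem/BE; rewrite subrr normr0 ler01.
- by apply: compact_setX; exact: segment_compact.
- exact: continuous_subspaceT.
by exists w => // w' /BE; exact: wmin.
Qed.

(** The displacement of a step is a strict contraction. A minimum of the distance from [step k w] to
    [z] over a box must therefore be 0, since one Picard iteration would decrease a positive
    value. *)
Lemma step_surjective k z : exists w, step k w = z.
Proof.
have CA := C_amp k; have CA0 : 0 < C * amp k by rewrite mulr_gt0.
pose phi w := `|step k w - z|.
have cphi : continuous phi.
  apply: continuous_modulus => e e0; exists (1 + C * amp k) => w w'.
  apply: le_trans (ler_dist_dist _ _) _.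
  have := step_lipschitz k w w'.
  have -> : step k w' - z - (step k w - z) =
      (step k w' - w' - (step k w - w)) + (w' - w).
    by move: (step k w) (step k w') => s s'; apply: injective_projections => /=; ring.
  move=> h; apply: le_trans (ler_normD _ _) _; rewrite mulrDl mul1r; lra.
have [w wz wmin] := box_min z cphi; exists w; apply/eqP; rewrite -subr_eq0 -normr_eq0.
rewrite eq_le normr_ge0 andbT leNgt; apply/negP => w0.
(* The Picard iterate; it stays in the box because displacements are at most 1. *)
pose w' := z - (step k w - w).
have w'z : `|w' - z| <= 1.
  rewrite /w' addrAC subrr add0r normrN; apply: le_trans (step_dist k w) _.
  by rewrite -/(gap k); have := gap_le k; have : 4^-1 ^+ k <= 1 :> R;
    [rewrite exprn_ile1// ?invr_ge0// invf_le1// ler1n|lra].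
have := wmin _ w'z; rewrite leNgt => /negP; apply; rewrite /phi.
have -> : step k w' - z = step k w' - w' - (step k w - w).
  rewrite /w'; move: (step k w) (step k _) => s s'.
  by apply: injective_projections => /=; ring.
apply: le_lt_trans (step_lipschitz k w w') _.
have -> : w' - w = - (step k w - z).
  by rewrite /w'; move: (step k w) => s; apply: injective_projections => /=; ring.
rewrite normrN; rewrite gtr_pMl//; lra.
Qed.

Lemma approx_surjective k z : exists w, approx k w = z.
Proof.
elim: k z => [|k IH] z; first by exists z.
by have [w wz] := step_surjective k z; have [w' w'w] := IH w; exists w'; rewrite /= w'w.
Qed.

Lemma approx_lipschitz k z w : `|approx k w - approx k z| <= 2 ^+ k * `|w - z|.
Proof.
have [/(_ z w)[_ hX _ _] /(_ z w)[_ hY _ _]] := c11_approx k.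
exact: norm_le_pair.
Qed.

Lemma mapX_continuous : continuous mapX.
Proof.
apply: continuous_modulus => e e0.
have /cvgr0_norm_le /(_ _ (divr_gt0 e0 (ltr0n R 4))) [k _ /(_ k (leqnn k)) kP] := gap_cvg0.
rewrite ger0_norm ?(ltW (gap_gt0 k))// in kP.
exists (2 ^+ k) => z w.
have [_ /(_ k) hz] := mapXP z; have [_ /(_ k) hw] := mapXP w.
have hl := le_trans (norm_fst (_ - _)) (approx_lipschitz k z w).
have -> : mapX w - mapX z = (mapX w - (approx k w).1) + - (mapX z - (approx k z).1)
  + (approx k w - approx k z).1 by rewrite /=; ring.
apply: le_trans (ler_normD _ _) _; apply: lerD => //.
apply: le_trans (ler_normD _ _) _; rewrite normrN; lra.
Qed.

Lemma mapY_continuous : continuous mapY.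
Proof.
apply: continuous_modulus => e e0.
have /cvgr0_norm_le /(_ _ (divr_gt0 e0 (ltr0n R 4))) [k _ /(_ k (leqnn k)) kP] := gap_cvg0.
rewrite ger0_norm ?(ltW (gap_gt0 k))// in kP.
exists (2 ^+ k) => z w.
have [_ /(_ k) hz] := mapYP z; have [_ /(_ k) hw] := mapYP w.
have hl := le_trans (norm_snd (_ - _)) (approx_lipschitz k z w).
have -> : mapY w - mapY z = (mapY w - (approx k w).2) + - (mapY z - (approx k z).2)
  + (approx k w - approx k z).2 by rewrite /=; ring.
apply: le_trans (ler_normD _ _) _; apply: lerD => //.
apply: le_trans (ler_normD _ _) _; rewrite normrN; lra.
Qed.

(** A preimage of [z] under [approx k] misses [z] under the limit map by at most [4 * gap k];
    compactness of the box turns these approximate solutions into an exact one. *)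
Lemma map_surjective z : exists w, mapX w = z.1 /\ mapY w = z.2.
Proof.
pose phi w := `|mapX w - z.1| + `|mapY w - z.2|.
have cphi : continuous phi.
  move=> w; apply: cvgD; apply: cvg_norm.
  - by apply: cvgB; [exact: mapX_continuous|exact: cvg_cst].
  - by apply: cvgB; [exact: mapY_continuous|exact: cvg_cst].
have [w wz wmin] := box_min z cphi.
have phi0 : phi w <= 0.
  apply/ler_addgt0Pl => e e0; rewrite addr0.
  have /cvgr0_norm_le /(_ _ (divr_gt0 e0 (ltr0n R 4))) [k _ /(_ k (leqnn k)) kP] := gap_cvg0.
  rewrite ger0_norm ?(ltW (gap_gt0 k))// in kP.
  have [w' w'z] := approx_surjective k z.
  have : phi w <= phi w'.
    apply: wmin; rewrite -w'z distrC; apply: le_trans (approx_dist_gap w' (leq0n k)) _.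
    have n0 : 4 <= freq 0 := freq_first C1 a10; have g := gap_freq 0.
    by have g0 := gap_gt0 0; nra.
  have [_ /(_ k) hX] := mapXP w'; have [_ /(_ k) hY] := mapYP w'.
  rewrite w'z in hX hY; rewrite /phi; lra.
exists w; have := normr_ge0 (mapX w - z.1); have := normr_ge0 (mapY w - z.2).
rewrite /phi in phi0 => y0 x0; split; apply/eqP; rewrite -subr_eq0 -normr_eq0;
  apply/eqP; lra.
Qed.

Lemma radius_cover (r : R) : 0 < r -> r <= 1 ->
  exists k, radius C a1 k.+1 <= r <= radius C a1 k.
Proof.
move=> r0 r1; have rh := radius_half C1 a10; have rp := radius_gt0 C1 a10.
have rk k : radius C a1 k <= 2^-1 ^+ k.
  elim: k => [|k IH]; first by rewrite radius0.
  by rewrite exprS ler_pdivlMl//; apply: le_trans (rh k) IH.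
have ex : exists k, radius C a1 k.+1 <= r.
  have /cvgr0_norm_le /(_ _ r0) [n _ /(_ n (leqnn n))] :
      geometric 1 (2^-1 : R) k @[k --> \oo] --> 0.
    by apply: cvg_geometric; rewrite ger0_norm ?invr_ge0// invf_lt1// ltr1n.
  rewrite /geometric /= mul1r ger0_norm ?exprn_ge0 ?invr_ge0// => h.
  exists n; apply: le_trans h; apply: le_trans (rk n); have := rh n; have := rp n.+1.
  lra.
case: (ex_minnP ex) => k kr kmin; exists k; rewrite kr /=.
case: k kr kmin => [|k] kr kmin; first by rewrite radius0.
by rewrite leNgt; apply/negP => /ltW /kmin; rewrite ltnn.
Qed.

Lemma norm_le_sqrt_sqnorm v : [/\ `|v.1| <= Num.sqrt (sqnorm v), `|v.2| <= Num.sqrt (sqnorm v) &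
  Num.sqrt (sqnorm v) ^+ 2 = sqnorm v].
Proof.
split; last by rewrite sqr_sqrtr// addr_ge0// sqr_ge0.
  by rewrite -sqrtr_sqr ler_wsqrtr// lerDl sqr_ge0.
by rewrite -sqrtr_sqr ler_wsqrtr// lerDr sqr_ge0.
Qed.

Lemma sqrt_sqnorm_ge k v : 4^-1 ^+ k <= sqnorm v -> 2^-1 ^+ k <= Num.sqrt (sqnorm v).
Proof.
move=> h; rewrite -(@ler_pXn2r _ 2)// ?nnegrE ?exprn_ge0 ?invr_ge0 ?sqrtr_ge0//.
have [_ _ ->] := norm_le_sqrt_sqnorm v; apply: le_trans h; rewrite -exprM mulnC exprM.
by rewrite (_ : 2^-1 ^+ 2 = 4^-1 :> R)//; field.
Qed.

(** Error budget in units of [m * r], where [m] is the modulus of [v]: quadratic remainder of the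
    first [k] maps 4/100, their deviation from conformality 2/100, step [k] 5/400, all later steps
    4/400. The total is below 1/8. *)
Lemma approx_affine k p v (r : R) z :
  near_conformal (2 * (C * amp 0)) v (jac (1, 0) k p) (jac (0, 1) k p) ->
  4^-1 ^+ k <= sqnorm v -> 0 < r -> radius C a1 k.+1 <= r <= radius C a1 k ->
  `|z - p| <= 2 * r ->
  `|mapX z - mapX p - (v.1 * (z.1 - p.1) - v.2 * (z.2 - p.2))|
     <= Num.sqrt (sqnorm v) * r / 8 /\
  `|mapY z - mapY p - (v.2 * (z.1 - p.1) + v.1 * (z.2 - p.2))|
     <= Num.sqrt (sqnorm v) * r / 8.
Proof.
move=> [n1 n2 n3 n4] v4 r0 /andP[r1 r2] zp.
have [v1 v2 _] := norm_le_sqrt_sqnorm v; have m2 := sqrt_sqnorm_ge v4.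
set m := Num.sqrt _ in n1 n2 n3 n4 v1 v2 m2 *.
have m0 : 0 < m by apply: lt_le_trans m2; rewrite exprn_gt0// invr_gt0.
have [/(_ p z)[_ _ _ qX] /(_ p z)[_ _ _ qY]] := c11_approx k.
have CA0 := C_amp 0; have CA := C_amp k.
have mr : 0 < m * r by rewrite mulr_gt0.
have prod (x y s t : R) : `|x| <= s -> `|y| <= t -> `|x * y| <= s * t.
  by move=> xs yt; rewrite normrM ler_pM.
have d1 := le_trans (norm_fst (z - p)) zp; have d2 := le_trans (norm_snd (z - p)) zp.
rewrite /= in d1 d2.
set dx := z.1 - p.1 in qX qY d1 *; set dy := z.2 - p.2 in qX qY d2 *.
have Qr : quad k * `|z - p| ^+ 2 <= 4 / (10 * 10) * (m * r).
  have Q0 := quad_gt0 C1 a10 k.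
  apply: (@le_trans _ _ (quad k * (2 * r) ^+ 2)).
    by rewrite ler_wpM2l ?(ltW Q0)// lerXn2r// nnegrE// mulr_ge0// ltW.
  have h : quad k * r <= (10 * 10)^-1 * m.
    apply: (@le_trans _ _ (quad k * radius C a1 k)).
      by rewrite ler_wpM2l// ltW.
    have p2 : 0 < 2 ^+ k :> R by rewrite exprn_gt0.
    rewrite -(@ler_pM2l _ (2 ^+ k))// mulrA radius_quad//.
    rewrite mulrCA ler_peMr// ?invr_ge0//.
    by rewrite -ler_pdivrMl// mulr1 -exprVn.
  have -> : quad k * (2 * r) ^+ 2 = 4 * r * (quad k * r) by ring.
  have -> : 4 / (10 * 10) * (m * r) = 4 * r * ((10 * 10)^-1 * m) by ring.
  by rewrite ler_wpM2l// mulr_ge0// ltW.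
have e0 : 2 * (C * amp 0) * m <= 2 * (20 * 20)^-1 * m.
  by rewrite ler_wpM2r ?(ltW m0)// ler_wpM2l.
have lin (x y c1' c2' : R) : `|c1' - x| <= 2 * (C * amp 0) * m ->
    `|c2' - y| <= 2 * (C * amp 0) * m ->
    `|(c1' - x) * dx + (c2' - y) * dy| <= 8 / (20 * 20) * (m * r).
  move=> /le_trans /(_ e0) h1 /le_trans /(_ e0) h2; apply: le_trans (ler_normD _ _) _.
  apply: le_trans (lerD (prod _ _ _ _ h1 d1) (prod _ _ _ _ h2 d2)) _.
  by clear - contr pert a10 C1; lra.
set a1' := (jac (1, 0) k p).1 in n1 qX; set b1' := (jac (1, 0) k p).2 in n2 qY.
set a2' := (jac (0, 1) k p).1 in n3 qX; set b2' := (jac (0, 1) k p).2 in n4 qY.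
rewrite -[v.2]opprK in n3.
have lX := lin _ _ _ _ n1 n3; have lY := lin _ _ _ _ n2 n4.
rewrite /= in qX qY.
set Ux := (approx k z).1 - (approx k p).1 in qX.
set Uy := (approx k z).2 - (approx k p).2 in qY.
have aX : `|Ux - (v.1 * dx - v.2 * dy)| <= 6 / (10 * 10) * (m * r).
  have -> : Ux - (v.1 * dx - v.2 * dy) = (Ux - (a1' * dx + a2' * dy)) +
     ((a1' - v.1) * dx + (a2' - - v.2) * dy) by ring.
  apply: le_trans (ler_normD _ _) _; apply: le_trans (lerD qX lX) _; move: Qr; clear - contr pert a10 C1; lra.
have aY : `|Uy - (v.2 * dx + v.1 * dy)| <= 6 / (10 * 10) * (m * r).
  have -> : Uy - (v.2 * dx + v.1 * dy) = (Uy - (b1' * dx + b2' * dy)) +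
     ((b1' - v.2) * dx + (b2' - v.1) * dy) by ring.
  apply: le_trans (ler_normD _ _) _; apply: le_trans (lerD qY lY) _; move: Qr; clear - contr pert a10 C1; lra.
have U5 : `|approx k z - approx k p| <= 5 * (m * r).
  have e1 := prod _ _ _ _ v1 d1; have e2 := prod _ _ _ _ v2 d2.
  have e3 := prod _ _ _ _ v2 d1; have e4 := prod _ _ _ _ v1 d2.
  apply: norm_le_pair; rewrite /= -?/Ux -?/Uy.
    rewrite -[Ux](subrK (v.1 * dx - v.2 * dy)) (le_trans (ler_normD _ _))//.
    apply: le_trans (lerD aX (ler_normB _ _)) _.
    by move: e1 e2 mr; clear - contr pert a10 C1; lra.
  rewrite -[Uy](subrK (v.2 * dx + v.1 * dy)) (le_trans (ler_normD _ _))//.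
  apply: le_trans (lerD aY (ler_normD _ _)) _.
  by move: e3 e4 mr; clear - contr pert a10 C1; lra.
(* Step [k] is at its critical scale, neither nearly affine nor of negligible displacement; but its
   displacement has Lipschitz constant at most 1/400. *)
have S := step_lipschitz k (approx k p) (approx k z).
have {}S : `|step k (approx k z) - approx k z - (step k (approx k p) - approx k p)|
    <= 5 / (20 * 20) * (m * r).
  apply: le_trans S _; apply: (@le_trans _ _ ((20 * 20)^-1 * (5 * (m * r)))); last first.
    by clear - contr pert a10 C1; lra.
  by apply: ler_pM => //; rewrite ltW// mulr_gt0.
have G : gap k.+1 <= (20 * 20)^-1 * (m * r).
  have g := gap_freq k.+1; have fr := freq_radius C1 a10 k.
  have f0 := N0 k.+1.
  have fmr : 1 <= freq k.+1 * (m * r).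
    have p2 : 0 < 2 ^+ k :> R by rewrite exprn_gt0.
    have h1 : 2 ^+ k <= freq k.+1 * r by apply: le_trans fr _; rewrite ler_wpM2l// ltW.
    have h2 : 1 <= 2 ^+ k * m by rewrite -ler_pdivrMl// mulr1 -exprVn.
    rewrite mulrCA mulrC; apply: le_trans h2 _; rewrite ler_wpM2r//.
    exact: ltW.
  rewrite -(@ler_pM2r _ (freq k.+1))//; apply: le_trans g _.
  rewrite -mulrA ler_peMr// ?invr_ge0//.
  by rewrite mulrC.
have [_ /(_ k.+1) zX] := mapXP z; have [_ /(_ k.+1) pX] := mapXP p.
have [_ /(_ k.+1) zY] := mapYP z; have [_ /(_ k.+1) pY] := mapYP p.
have S1 := le_trans (norm_fst (_ - _)) S; have S2 := le_trans (norm_snd (_ - _)) S.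
have fin (M1 M2 A1 A2 B1 B2 L : R) : `|M1 - A1| <= 2 * gap k.+1 ->
    `|M2 - A2| <= 2 * gap k.+1 ->
    `|A1 - B1 - (A2 - B2)| <= 5 / (20 * 20) * (m * r) ->
    `|B1 - B2 - L| <= 6 / (10 * 10) * (m * r) -> `|M1 - M2 - L| <= m * r / 8.
  move=> h1 h2 h3 h4.
  have -> : M1 - M2 - L = (M1 - A1) - (M2 - A2) + ((A1 - B1 - (A2 - B2)) +
     (B1 - B2 - L)) by ring.
  apply: le_trans (ler_normD _ _) _.
  apply: le_trans (lerD (ler_normB _ _) (ler_normD _ _)) _.
  move: mr G h1 h2 h3 h4; clear - contr pert a10 C1; move: (gap _) (m * r) => g s; lra.
split; [exact: fin zX pX S1 aX|exact: fin zY pY S2 aY].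
Qed.

End iteration.

(** * Properties of the limit map *)

Section flat_maps.
Variable R : realType.
Implicit Types (z w v p : R * R).

(** The range [2 * r] covers both balls of the doubling inequality; [m] will be the modulus of the
    linear part, so the error is relative. *)
Definition affine_near (f : R * R -> R) p (r a b m : R) :=
  forall z, `|z - p| <= 2 * r ->
    `|f z - f p - (a * (z.1 - p.1) + b * (z.2 - p.2))| <= m * r / 8.

(* The properties of the limit map [X + i Y] of the maps [F k] that remain in use.
   [c1 k] and [c2 k] are the columns of the differential of [F k]; on the open
   neighbourhood [S j] of the nodal set they are conformal up to the relative
   error [e j], and they tend to 0 on the nodal set. *)
Record flat_map (X Y : R * R -> R) (F c1 c2 : nat -> R * R -> R * R)
    (S : nat -> set (R * R)) (e : nat -> R) : Prop := FlatMap {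
  flat_c11 : forall k, exists L Q,
    c11 L Q (fst \o F k) (fst \o c1 k) (fst \o c2 k) /\
    c11 L Q (snd \o F k) (snd \o c1 k) (snd \o c2 k);
  flat_cvg : forall z, (F k z).1 @[k --> \oo] --> X z /\ (F k z).2 @[k --> \oo] --> Y z;
  flat_dist : forall k z, `|F k z - z| <= 1;
  flat_stable : forall z, Y z != 0 -> exists k, \forall w \near z,
    forall l, (k <= l)%N -> c1 l w = c1 k w /\ c2 l w = c2 k w;
  flat_vanish : forall z, Y z = 0 -> forall d : R, 0 < d ->
    \forall k \near \oo, `|c1 k z| <= d /\ `|c2 k z| <= d;
  flat_open : forall j z, Y z = 0 -> \forall w \near z, S j w;
  flat_S0 : forall z, S 0%N z;
  flat_e_cvg0 : e j @[j --> \oo] --> 0;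
  flat_e_small : forall j, 0 <= e j <= (10 * 10)^-1;
  flat_near : forall j l z, (j <= l)%N -> S j z ->
    exists2 v, 0 < sqnorm v <= 1 & near_conformal (e j) v (c1 l z) (c2 l z);
  flat_affine : forall p (r : R), 0 < r -> r <= 1 -> exists2 v, 0 < sqnorm v &
    affine_near Y p r v.2 v.1 (Num.sqrt (sqnorm v));
  flat_thin : forall d : R, 0 < d -> exists2 r0 : R, 0 < r0 & forall p (r : R),
    Y p = 0 -> 0 < r -> r <= r0 -> exists2 v, sqnorm v <= d &
    affine_near X p r v.1 (- v.2) (Num.sqrt (sqnorm v));
  flat_outside : forall z, 1 / 2 <= `|z.2| -> Y z = z.2;
  flat_near_id : forall z, `|X z - z.1| <= 1 / 4 /\ `|Y z - z.2| <= 1 / 4;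
  flat_continuous : continuous X /\ continuous Y;
  flat_surjective : forall z, exists w, X w = z.1 /\ Y w = z.2
}.

Section instance.
Variables (C a1 : R).
Hypothesis C1 : 1 <= C.
Hypothesis a10 : 0 < a1 <= 1.
Hypothesis pert : forall a : R, 0 <= a -> a <= 1 ->
  [/\ forall z, `|PX a z| <= C, c11 C C (PX a) (PX1 a) (PX2 a),
      forall z, `|PY a z| <= C & c11 C C (PY a) (PY1 a) (PY2 a)].
Hypothesis contr : forall (a : R) z, 0 < a -> a <= a1 -> `|z.2| <= 1 ->
  `|z.2 + a * PY a z| <= a ^+ 3 ->
  (1 + a * PX1 a z) ^+ 2 + (a * PY1 a z) ^+ 2 <= 1 - a ^+ 2 / 4.

Local Notation amp := (amp C a1).
Local Notation freq := (freq C a1).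
Local Notation approx := (approx C a1).
Local Notation jac := (jac C a1).
Local Notation strip := (strip C a1).

Lemma open_approx_snd k (P : R -> Prop) z :
  (\forall y \near (approx k z).2, P y) -> \forall w \near z, P (approx k w).2.
Proof.
have cY : continuous (fun w => (approx k w).2).
  apply: continuous_modulus => d d0; exists (2 ^+ k) => w w'.
  apply: le_trans (norm_snd (_ - _)) _.
  by apply: le_trans (approx_lipschitz C1 a10 pert k w w') _; rewrite lerDr ltW.
exact: (cY z).
Qed.

Lemma iteration_flat_map : flat_map (mapX C a1) (mapY C a1) approx
  (jac (1, 0)) (jac (0, 1)) strip (fun j => 2 * (C * amp j)).
Proof.
have ag0 k : 0 < amp k := amp_gt0 C1 a10 k.
have fg0 k : 0 < freq k := freq_gt0 C1 a10 k.
have C0 : 0 < C := lt_le_trans ltr01 C1.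
have pow4 k : 0 < 4^-1 ^+ k :> R by rewrite exprn_gt0// invr_gt0.
split.
- by move=> k; exists (2 ^+ k), (quad C a1 k); exact: c11_approx.
- by move=> z; have [? _] := mapXP C1 a10 pert z; have [? _] := mapYP C1 a10 pert z.
- move=> k z; apply: le_trans (approx_dist_gap C1 a10 pert z (leq0n k)) _.
  have n0 := freq_first C1 a10; have g := gap_freq C1 a10 0.
  by have g0 := gap_gt0 C1 a10 0; nra.
- move=> z /(map_nonzero_stable C1 a10 pert)[k zk]; exists k.
  have : \forall w \near z, 2 < freq k * `|(approx k w).2|.
    apply: open_approx_snd (fun y => 2 < freq k * `|y|) _ _.
    have : (freq k * `|y|) @[y --> (approx k z).2] --> freq k * `|(approx k z).2|.
      by apply: cvgMr; apply: norm_continuous.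
    by move/cvgr_gt; exact.
  apply: filterS => w /ltW wk l kl.
  have [_ ->] := approx_stable C1 a10 (1, 0) wk kl.
  by have [_ ->] := approx_stable C1 a10 (0, 1) wk kl.
- move=> z z0 d d0; have d2 : 0 < d ^+ 2 by rewrite exprn_gt0.
  have /cvgr0_norm_le /(_ _ d2) := prod_amp_cvg0 C1 a10.
  apply: filterS => k /(le_trans (ler_norm _)) kd.
  have [c /andP[_ n]] := strip_conformal C1 a10 pert contr (map_zero_strip C1 a10 pert k z0).
  have [n1 n2 n3] := norm_le_sqrt_sqnorm (jac (1, 0) k z).
  have {}n : Num.sqrt (sqnorm (jac (1, 0) k z)) <= d.
    rewrite -(@ler_pXn2r _ 2)// ?nnegrE ?sqrtr_ge0 ?(ltW d0)// n3.
    exact: le_trans kd.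
  split; first by apply: norm_le_pair; [exact: le_trans n1 _|exact: le_trans n2 _].
  rewrite c; apply: norm_le_pair; rewrite /= ?normrN.
    exact: le_trans n2 _.
  exact: le_trans n1 _.
- move=> j z z0; case: j => [|j]; first by near=> w; left.
  have zs : freq j.+1 * `|(approx j.+1 z).2| < 2.
    by have [//|] := map_zero_strip C1 a10 pert j.+1 z0.
  have : \forall w \near z, freq j.+1 * `|(approx j.+1 w).2| < 2.
    apply: open_approx_snd (fun y => freq j.+1 * `|y| < 2) _ _.
    have : (freq j.+1 * `|y|) @[y --> (approx j.+1 z).2]
        --> freq j.+1 * `|(approx j.+1 z).2|.
      by apply: cvgMr; apply: norm_continuous.
    by move/cvgr_lt; exact.
  by apply: filterS => w; right.
- by move=> z; left.
- rewrite -[X in _ --> X](mulr0 2); apply: cvgMr.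
  by rewrite -[X in _ --> X](mulr0 C); apply: cvgMr; exact: amp_cvg0.
- move=> j; have := C_amp C1 a10 j; have : 0 < C * amp j by rewrite mulr_gt0.
  by move=> ? ?; apply/andP; split; lra.
- move=> j l z jl sz.
  have [v /andP[v1 v2] nc] := near_conformal_jac C1 a10 pert contr jl sz.
  by exists v => //; rewrite v2 andbT (lt_le_trans _ v1).
- move=> p r r0 r1; have [k kr] := radius_cover C1 a10 r0 r1.
  have [v /andP[v1 _] nc] := near_conformal_jac C1 a10 pert contr (leq0n k)
    (or_introl erefl : strip 0 p).
  exists v; first exact: lt_le_trans v1.
  by move=> z zp; have [_] := approx_affine C1 a10 pert nc v1 r0 kr zp.
- move=> d d0; have /cvgr0_norm_le /(_ _ d0) [n _ nP] := prod_amp_cvg0 C1 a10.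
  have rp := radius_gt0 C1 a10; have rh := radius_half C1 a10.
  (* Scales below [radius n] involve at least [n] maps. At a nodal point their differential is
     conformal, with squared modulus at most the product, hence at most [d]. *)
  exists (radius C a1 n) => // p r p0 r0 rn.
  have r1 : r <= 1.
    apply: le_trans rn _; rewrite -(radius0 C a1); elim: n {nP} => // n IH.
    by apply: le_trans IH; have := rh n; have := rp n.+1; lra.
  have rmon i j : (i <= j)%N -> radius C a1 j <= radius C a1 i.
    elim: j => [|j IH]; first by rewrite leqn0 => /eqP->.
    rewrite leq_eqVlt => /predU1P[->//|ij]; have := IH ij.
    by have := rh j; have := rp j.+1; lra.
  have ex : exists k, (n <= k)%N && (radius C a1 k.+1 <= r <= radius C a1 k).
    have [k kr] := radius_cover C1 a10 r0 r1.
    (* An index below [n] can only come from [r] equal to [radius n], and then [n] itself serves. *)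
    have [nk|kn] := leqP n k; first by exists k; rewrite nk.
    exists n; rewrite leqnn rn andbT /=; have /andP[kr1 _] := kr.
    by apply: le_trans kr1; apply: rmon; exact: ltnW.
  have [k /andP[nk kr]] := ex; have sp := map_zero_strip C1 a10 pert k p0.
  have [c /andP[n1 n2]] := strip_conformal C1 a10 pert contr sp.
  have nc : near_conformal (2 * (C * amp 0)) (jac (1, 0) k p) (jac (1, 0) k p) (jac (0, 1) k p).
    have CA : 0 <= 2 * (C * amp 0) by apply: mulr_ge0 => //; apply: mulr_ge0; exact: ltW.
    by split; rewrite ?c/= ?subrr ?addNr normr0 mulr_ge0// sqrtr_ge0.
  exists (jac (1, 0) k p).
    by apply: le_trans n2 _; apply: le_trans (ler_norm _) _; exact: nP.
  move=> z zp; have [+ _] := approx_affine C1 a10 pert nc n1 r0 kr zp.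
  by rewrite mulNr.
- by move=> z /(map_outside C1 a10)[_ ->].
- by move=> z; exact: map_near_id.
- by split; [exact: mapX_continuous|exact: mapY_continuous].
- exact: map_surjective.
Unshelve. all: by end_near. Qed.

End instance.

Theorem flat_map_exists : exists X Y F c1 c2 S e, flat_map X Y F c1 c2 S e.
Proof.
have [C C1 pert] := perturbation_c11 R; have [a1 a10 contr] := contraction_strip R.
by do 7 eexists; exact: iteration_flat_map C1 a10 pert contr.
Qed.

End flat_maps.

(** * The coefficient matrix *)

Section pullback_matrix.
Variable R : realType.
Implicit Types (c d v z : R * R).

Definition jacobian c d : R := c.1 * d.2 - d.1 * c.2.

(* For M with columns [c] and [d], this is adj M (adj M)^T / det M, the coefficient
   matrix of the equation satisfied by a harmonic function composed with a map of
   differential M. *)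
Definition pullback_entry c d (i j : bool) : R :=
  (if i then if j then d.2 ^+ 2 + d.1 ^+ 2 else - (c.2 * d.2 + c.1 * d.1)
   else if j then - (c.2 * d.2 + c.1 * d.1) else c.1 ^+ 2 + c.2 ^+ 2)
  / jacobian c d.

Definition pullback c d : 'M[R]_2 :=
  \matrix_(i, j) pullback_entry c d (i == 0) (j == 0).

Definition pair_col (s t : R) : 'cV[R]_2 := \col_i (if i == 0 then s else t).

(** The vector is M^T e_2, and (adj M)^T M^T = det M; what remains is adj M e_2, the rotated first
    row of M. This is the conjugate relation between Im F and Re F. *)
Lemma pullback_flux c d : jacobian c d != 0 ->
  pullback c d *m pair_col c.2 d.2 = pair_col (- d.1) c.1.
Proof.
move=> j0; apply/matrixP => i j; rewrite !mxE !big_ord_recl big_ord0 !mxE /=.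
rewrite /pullback_entry addr0; move: j0; rewrite /jacobian => j0.
have e0 : (ord0 == 0 :> 'I_2) = true by [].
have e1 : (lift ord0 ord0 == 0 :> 'I_2) = false by [].
by rewrite e0 e1; case: (i == 0); field.
Qed.

Lemma quadratic_form (N : 'M[R]_2) (x : 'cV[R]_2) :
  (x^T *m N *m x) 0 0 = N 0 0 * x 0 0 ^+ 2 + (N 0 1 + N 1 0) * (x 0 0 * x 1 0)
    + N 1 1 * x 1 0 ^+ 2.
Proof.
rewrite !mxE !big_ord_recl big_ord0 !mxE !big_ord_recl !big_ord0 !mxE /=.
have e1 : lift ord0 ord0 = 1 :> 'I_2 by exact: val_inj.
rewrite e1; move: (N _ _) (N _ _) (N _ _) (N _ _) (x _ _) (x _ _) => *; ring.
Qed.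

(** Up to the determinant, the deviation from the identity is linear in the Cauchy-Riemann defects
    [a - g] and [b + f], of size at most [2 * (e * m)], with coefficients at most [11 / 10 * m]; the
    determinant is at least [m ^+ 2 / 2]. The modulus [m] cancels, so the estimate survives the
    degeneration of the differential. *)
Lemma pullback_near (e : R) v c d : 0 <= e -> e <= (10 * 10)^-1 -> 0 < sqnorm v ->
  near_conformal e v c d -> 0 < jacobian c d /\
  forall i j, `|pullback_entry c d i j - (i == j)%:R| <= 10 * e.
Proof.
move=> e0 e1 v0 [n1 n2 n3 n4]; have [v1 v2 m2] := norm_le_sqrt_sqnorm v.
have m0 : 0 < Num.sqrt (sqnorm v) by rewrite sqrtr_gt0.
move: (Num.sqrt _) n1 n2 n3 n4 v1 v2 m2 m0 => m n1 n2 n3 n4 v1 v2 m2 m0.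
have em : e * m <= (10 * 10)^-1 * m by rewrite ler_pM2r.
have em0 : 0 <= e * m by rewrite mulr_ge0// ltW.
set a := c.1 in n1 *; set b := d.1 in n3 *; set f := c.2 in n2 *; set g := d.2 in n4 *.
have J : m ^+ 2 / 2 <= jacobian c d.
  rewrite /jacobian -/a -/b -/f -/g.
  have -> : a * g - b * f = sqnorm v + (v.1 * ((a - v.1) + (g - v.1)) + (a - v.1) * (g - v.1)
     + (v.2 * ((f - v.2) - (b + v.2)) - (b + v.2) * (f - v.2))).
    by rewrite /sqnorm; ring.
  rewrite -m2; move: (a - v.1) (f - v.2) (b + v.2) (g - v.1) n1 n2 n3 n4 => x y s t.
  have prod (u w p q : R) : `|u| <= p -> `|w| <= q -> `|u * w| <= p * q.
    by move=> up wq; rewrite normrM ler_pM.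
  move=> x1 y1 s1 t1.
  have h1 := prod _ _ _ _ v1 (le_trans (ler_normD x t) (lerD x1 t1)).
  have h2 := prod _ _ _ _ x1 t1; have h4 := prod _ _ _ _ s1 y1.
  have h3 := prod _ _ _ _ v2 (le_trans (ler_normB y s) (lerD y1 s1)).
  have k1 : m * (e * m) <= (10 * 10)^-1 * m ^+ 2 by nra.
  have k2 : e * m * (e * m) <= (10 * 10)^-1 * m ^+ 2 by nra.
  move: h1 h2 h3 h4; rewrite !ler_norml => /andP[h1 _] /andP[h2 _] /andP[h3 _] /andP[_ h4].
  have m20 : 0 < m ^+ 2 by rewrite exprn_gt0.
  lra.
have m20 : 0 < m ^+ 2 by rewrite exprn_gt0.
have J0 : 0 < jacobian c d by apply: lt_le_trans J; rewrite divr_gt0.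
split=> // i j; rewrite /pullback_entry -/a -/b -/f -/g.
have big (x y : R) : `|x - y| <= e * m -> `|y| <= m -> `|x| <= 11 / 10 * m.
  move=> xy ym; rewrite -[x](subrK y) (le_trans (ler_normD _ _))//; lra.
have bn (x y : R) : `|x + y| <= e * m -> `|y| <= m -> `|x| <= 11 / 10 * m.
  by move=> xy ym; apply: (big x (- y)); rewrite ?opprK ?normrN.
have a1 := big _ _ n1 v1; have f1 := big _ _ n2 v2.
have b1 := bn _ _ n3 v2; have g1 := big _ _ n4 v1.
have ag : `|a - g| <= 2 * (e * m).
  have -> : a - g = (a - v.1) - (g - v.1) by ring.
  by apply: le_trans (ler_normB _ _) _; lra.
have bf : `|b + f| <= 2 * (e * m).
  have -> : b + f = (b + v.2) + (f - v.2) by ring.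
  by apply: le_trans (ler_normD _ _) _; lra.
have key (x y s t : R) : `|x| <= 11 / 10 * m -> `|y| <= 11 / 10 * m ->
    `|s| <= 2 * (e * m) -> `|t| <= 2 * (e * m) ->
    `|(x * s + y * t) / jacobian c d| <= 10 * e.
  move=> x1 y1 s1 t1; rewrite normrM normfV (gtr0_norm J0) ler_pdivrMr//.
  apply: le_trans (ler_normD _ _) _; rewrite !normrM.
  apply: (@le_trans _ _ (11 / 10 * m * (2 * (e * m)) + 11 / 10 * m * (2 * (e * m)))).
    by apply: lerD; apply: ler_pM.
  apply: (@le_trans _ _ (10 * e * (m ^+ 2 / 2))); last by rewrite ler_wpM2l// mulr_ge0.
  have h : 0 <= e * m ^+ 2 by rewrite mulr_ge0// ltW.
  lra.
have JN : jacobian c d != 0 by rewrite gt_eqF.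
have ga : `|g - a| <= 2 * (e * m) by rewrite distrC.
have nb : `|- b| <= 11 / 10 * m by rewrite normrN.
have ng : `|- g| <= 11 / 10 * m by rewrite normrN.
move: i j => [] [] /=.
- rewrite (_ : _ - _ = (g * (g - a) + b * (b + f)) / jacobian c d); first exact: key.
  by move: JN; rewrite /jacobian -/a -/b -/f -/g => JN; field.
- rewrite subr0 (_ : - _ = (- g) * (b + f) + (- b) * (a - g)); first exact: key.
  ring.
- rewrite subr0 (_ : - _ = (- g) * (b + f) + (- b) * (a - g)); first exact: key.
  ring.
- rewrite (_ : _ - _ = (a * (a - g) + f * (b + f)) / jacobian c d); first exact: key.
  by move: JN; rewrite /jacobian -/a -/b -/f -/g => JN; field.
Qed.

End pullback_matrix.

(** * The doubling property *)

Section coefficient.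
Variable R : realType.
Implicit Types (v z w p : R * R).
Variables (X Y : R * R -> R) (F c1 c2 : nat -> R * R -> R * R).
Variables (S : nat -> set (R * R)) (e : nat -> R).
Hypothesis fm : flat_map X Y F c1 c2 S e.

(** These limits exist everywhere: the sequences are eventually constant off the nodal set and tend
    to 0 on it. *)
Definition col_lim (c : nat -> R * R -> R * R) z : R * R :=
  (lim ((c k z).1 @[k --> \oo]), lim ((c k z).2 @[k --> \oo])).

(** On the nodal set the limiting differential vanishes and the pullback would be 0/0; the identity
    is its continuous extension. *)
Definition coefficient z : 'M[R]_2 :=
  if Y z == 0 then 1%:M else pullback (col_lim c1 z) (col_lim c2 z).

Lemma col_lim_zero z : Y z = 0 ->
  [/\ (c1 k z).1 @[k --> \oo] --> (0 : R), (c1 k z).2 @[k --> \oo] --> (0 : R),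
      (c2 k z).1 @[k --> \oo] --> (0 : R) & (c2 k z).2 @[k --> \oo] --> (0 : R)].
Proof.
move=> z0; split; apply/cvgrPdist_le => d d0; have := flat_vanish fm z0 d0;
  apply: filterS => k [h1 h2]; rewrite sub0r normrN.
- exact: le_trans (norm_fst _) h1.
- exact: le_trans (norm_snd _) h1.
- exact: le_trans (norm_fst _) h2.
- exact: le_trans (norm_snd _) h2.
Qed.

Lemma col_lim_eq0 z : Y z = 0 -> col_lim c1 z = 0 /\ col_lim c2 z = 0.
Proof.
move=> /col_lim_zero[h1 h2 h3 h4].
by split; rewrite /col_lim; apply: injective_projections => /=;
  apply: (cvg_lim (@Rhausdorff R)).
Qed.

Lemma col_lim_stable z k : (forall l, (k <= l)%N -> c1 l z = c1 k z /\ c2 l z = c2 k z) ->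
  col_lim c1 z = c1 k z /\ col_lim c2 z = c2 k z.
Proof.
move=> st; split; rewrite /col_lim; apply: injective_projections => /=;
  apply: (cvg_lim (@Rhausdorff R)); apply: cvg_near_cst; exists k => // l /= /st[e1 e2];
  by rewrite ?e1 ?e2.
Qed.

Lemma stable_at z : Y z != 0 ->
  exists k, forall l, (k <= l)%N -> c1 l z = c1 k z /\ c2 l z = c2 k z.
Proof.
by move=> /(flat_stable fm)[k kz]; exists k; exact: nbhs_singleton kz.
Qed.

Lemma col_lim_cvg z :
  [/\ (c1 k z).1 @[k --> \oo] --> (col_lim c1 z).1,
      (c1 k z).2 @[k --> \oo] --> (col_lim c1 z).2,
      (c2 k z).1 @[k --> \oo] --> (col_lim c2 z).1 &
      (c2 k z).2 @[k --> \oo] --> (col_lim c2 z).2].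
Proof.
have [z0|/stable_at[k st]] := eqVneq (Y z) 0.
  by have [-> ->] := col_lim_eq0 z0; exact: col_lim_zero.
have [-> ->] := col_lim_stable st.
by split; apply: cvg_near_cst; exists k => // l /= /st[E1 E2]; rewrite ?E1 ?E2.
Qed.

Lemma columns_bound k z : [/\ `|(c1 k z).1| <= 2, `|(c1 k z).2| <= 2,
  `|(c2 k z).1| <= 2 & `|(c2 k z).2| <= 2].
Proof.
have [v /andP[v0 v1] [n1 n2 n3 n4]] := flat_near fm (leq0n k) (flat_S0 fm z).
have [m1 m2 _] := norm_le_sqrt_sqnorm v; have /andP[e0 e1] := flat_e_small fm 0.
have m : Num.sqrt (sqnorm v) <= 1 by rewrite -[leRHS]sqrtr1 ler_wsqrtr.
have em : e 0%N * Num.sqrt (sqnorm v) <= 1.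
  by rewrite -[leRHS]mulr1 ler_pM ?sqrtr_ge0// (le_trans e1)// invf_le1; lra.
split.
- by rewrite -[(c1 k z).1](subrK v.1) (le_trans (ler_normD _ _))//; lra.
- by rewrite -[(c1 k z).2](subrK v.2) (le_trans (ler_normD _ _))//; lra.
- by rewrite -[(c2 k z).1](addrK v.2) (le_trans (ler_normB _ _))//; lra.
- by rewrite -[(c2 k z).2](subrK v.1) (le_trans (ler_normD _ _))//; lra.
Qed.

(** Off the nodal set the limiting columns are those of every late composition, in particular of one
    with index at least [j], to which [flat_near] applies. *)
Lemma coefficient_near j z : S j z ->
  forall i i' : 'I_2, `|coefficient z i i' - (i == i')%:R| <= 10 * e j.
Proof.
move=> sj i i'; have /andP[e0 e1] := flat_e_small fm j.
rewrite /coefficient; case: eqVneq => [_|/stable_at[k st]].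
  by rewrite !mxE subrr normr0 mulr_ge0.
have [-> ->] := col_lim_stable st.
have [E1 E2] := st (maxn j k) (leq_maxr _ _); rewrite -E1 -E2.
have [v /andP[v0 _] nc] := flat_near fm (leq_maxl j k) sj.
have [_ /(_ (i == 0) (i' == 0))] := pullback_near e0 e1 v0 nc.
rewrite !mxE; suff -> : ((i == 0) == (i' == 0)) = (i == i') by [].
by case: i => -[|[|//]] ?; case: i' => -[|[|//]] ?.
Qed.

Lemma coefficient_sym z : (coefficient z)^T = coefficient z.
Proof.
rewrite /coefficient; case: ifP => _; first by rewrite tr_scalar_mx.
apply/matrixP => i j; rewrite !mxE /pullback_entry.
by case: (i == 0); case: (j == 0).
Qed.

Lemma perturbed_form (p q r s a b t : R) : `|p - 1| <= t -> `|q| <= t ->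
  `|r| <= t -> `|s - 1| <= t ->
  `|p * a ^+ 2 + (q + r) * (a * b) + s * b ^+ 2 - (a ^+ 2 + b ^+ 2)|
    <= 2 * t * (a ^+ 2 + b ^+ 2).
Proof.
move=> hp hq hr hs; have h1 := sqr_ge0 (a - b); have h2 := sqr_ge0 (a + b).
have hab : `|a * b| <= (a ^+ 2 + b ^+ 2) / 2.
  by rewrite ler_norml; apply/andP; split; nra.
have -> : p * a ^+ 2 + (q + r) * (a * b) + s * b ^+ 2 - (a ^+ 2 + b ^+ 2) =
  (p - 1) * a ^+ 2 + (q + r) * (a * b) + (s - 1) * b ^+ 2 by ring.
have a2 : `|a ^+ 2| <= a ^+ 2 by rewrite ger0_norm ?sqr_ge0.
have b2 : `|b ^+ 2| <= b ^+ 2 by rewrite ger0_norm ?sqr_ge0.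
have prod (u w k l : R) : `|u| <= k -> `|w| <= l -> `|u * w| <= k * l.
  by move=> uk wl; rewrite normrM ler_pM.
apply: le_trans (ler_normD _ _) _.
apply: le_trans (lerD (ler_normD _ _) (lexx _)) _.
apply: le_trans (lerD (lerD (prod _ _ _ _ hp a2) (prod _ _ _ _
  (le_trans (ler_normD q r) (lerD hq hr)) hab)) (prod _ _ _ _ hs b2)) _.
lra.
Qed.

(** The entries are within 1/10 of the identity, so the quadratic form is within 1/5 of |x|^2; the
    ellipticity constant 1 leaves room. *)
Lemma coefficient_elliptic z :
  loewner_le ((1 + 1)^-1)%:M (coefficient z) /\ loewner_le (coefficient z) (1 + 1)%:M.
Proof.
have cn := coefficient_near (flat_S0 fm z); have /andP[e0 e1] := flat_e_small fm 0.
have c00 := cn 0 0; have c01 := cn 0 1; have c10 := cn 1 0; have c11 := cn 1 1.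
rewrite /= ?subr0 in c00 c01 c10 c11.
have key (a b : R) := perturbed_form a b c00 c01 c10 c11.
have pos2 (a b : R) : 2 * (10 * e 0%N) * (a ^+ 2 + b ^+ 2) <= (a ^+ 2 + b ^+ 2) / 2.
  have ab : 0 <= a ^+ 2 + b ^+ 2 by rewrite addr_ge0// sqr_ge0.
  by rewrite [leRHS]mulrC ler_wpM2r//; lra.
split=> x; rewrite quadratic_form !mxE /= !mulr1n !mulr0n; move: (key (x 0 0) (x 1 0));
  move=> /le_trans /(_ (pos2 _ _)); rewrite ler_norml => /andP[];
  have := sqr_ge0 (x 0 0); have := sqr_ge0 (x 1 0).
  move: (x 0 0) (x 1 0) (coefficient z 0 0) (coefficient z 0 1) (coefficient z 1 0)
    (coefficient z 1 1) => a b p q r s.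
  rewrite (_ : 1 + 1 = 2 :> R)//; lra.
move: (x 0 0) (x 1 0) (coefficient z 0 0) (coefficient z 0 1) (coefficient z 1 0)
  (coefficient z 1 1) => a b p q r s; lra.
Qed.

(** On the nodal set both gradients are 0, so the relation also holds where the matrix was set to
    the identity by hand. *)
Lemma coefficient_flux z :
  coefficient z *m pair_col (col_lim c1 z).2 (col_lim c2 z).2 =
  pair_col (- (col_lim c2 z).1) (col_lim c1 z).1.
Proof.
rewrite /coefficient; case: eqVneq => [z0|/stable_at[k st]].
  by have [-> ->] := col_lim_eq0 z0; rewrite mul1mx /= oppr0.
have [-> ->] := col_lim_stable st; apply: pullback_flux.
have /andP[e0 e1] := flat_e_small fm 0.
have [v /andP[v0 _] nc] := flat_near fm (leq0n k) (flat_S0 fm z).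
by have [j0 _] := pullback_near e0 e1 v0 nc; rewrite gt_eqF.
Qed.

(** At a nodal point, [S j] is a neighbourhood on which the matrix is within [10 * e j] of the
    identity. Elsewhere it is locally the pullback by a single composition, with nonzero
    determinant. *)
Lemma coefficient_continuous : continuous coefficient.
Proof.
move=> p; have FI := @filterI _ _ (@nbhs_filter (R * R)%type p).
apply/cvg_ballP => d d0.
have mxball (M N : 'M[R]_2) : (forall i j : 'I_2, `|M i j - N i j| < d) -> ball M d N.
  by move=> h; split=> // i j; rewrite -ball_normE /=.
have [p0|p0] := eqVneq (Y p) 0.
  have d10 : 0 < d / (10 * 2) by rewrite divr_gt0// mulr_gt0.
  have /cvgr0_norm_le /(_ _ d10) [j _ /(_ j (leqnn j)) ej] := flat_e_cvg0 fm.
  have := flat_open fm j p0; apply: filterS => w Sw.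
  apply: mxball => i i'; have h := coefficient_near Sw i i'.
  rewrite [coefficient p]/coefficient p0 eqxx mxE distrC.
  apply: le_lt_trans h _; have := le_trans (ler_norm _) ej; lra.
have [k kst] := flat_stable fm p0.
have Yn : \forall w \near p, Y w != 0.
  have /(_ p) cY := (flat_continuous fm).2.
  have : \forall y \near Y p, y != 0.
    by apply: open_nbhs_nbhs; split; [exact: open_neq|].
  exact: cY.
have [L [Q [cX cY]]] := flat_c11 fm k.
have cont (f : R * R -> R) : (forall z w, `|f w - f z| <= Q * `|w - z|) ->
    {for p, continuous f}.
  by move=> fQ; apply: continuous_modulus => d' d'0; exists Q => z w;
    apply: le_trans (fQ z w) _; rewrite lerDr ltW.
have k1 : {for p, continuous (fst \o c1 k)} by apply: cont => z w; have [_ _ []] := cX z w.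
have k2 : {for p, continuous (fst \o c2 k)} by apply: cont => z w; have [_ _ []] := cX z w.
have k3 : {for p, continuous (snd \o c1 k)} by apply: cont => z w; have [_ _ []] := cY z w.
have k4 : {for p, continuous (snd \o c2 k)} by apply: cont => z w; have [_ _ []] := cY z w.
have j0 : jacobian (c1 k p) (c2 k p) != 0.
  have /andP[e0 e1] := flat_e_small fm 0.
  have [v /andP[v0 _] nc] := flat_near fm (leq0n k) (flat_S0 fm p).
  by have [j0 _] := pullback_near e0 e1 v0 nc; rewrite gt_eqF.
have ent (i j : bool) : {for p, continuous (fun w => pullback_entry (c1 k w) (c2 k w) i j)}.
  apply: cvgM.
    case: i; case: j.
    - by apply: cvgD; apply: cvgM; assumption.
    - by apply: cvgN; apply: cvgD; apply: cvgM; assumption.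
    - by apply: cvgN; apply: cvgD; apply: cvgM; assumption.
    - by apply: cvgD; apply: cvgM; assumption.
  by apply: cvgV => //; apply: cvgB; apply: cvgM; assumption.
have near_ent i j : \forall w \near p,
    `|pullback_entry (c1 k p) (c2 k p) i j - pullback_entry (c1 k w) (c2 k w) i j| < d.
  by have /cvgr_dist_lt /(_ _ d0) := ent i j.
have near_all : \forall w \near p, forall i j,
    `|pullback_entry (c1 k p) (c2 k p) i j - pullback_entry (c1 k w) (c2 k w) i j| < d.
  have h1 := FI _ _ (near_ent true true) (near_ent true false).
  have h2 := FI _ _ (near_ent false true) (near_ent false false).
  by have := FI _ _ h1 h2; apply: filterS => w [[? ?] [? ?]] [] [].
have := FI _ _ kst (FI _ _ Yn near_all); apply: filterS => w [st [wY h]].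
apply: mxball => i j; rewrite /coefficient (negPf p0) (negPf wY).
have [-> ->] := col_lim_stable st.
have [-> ->] := col_lim_stable (nbhs_singleton kst).
by rewrite !mxE; exact: h.
Qed.

End coefficient.

(** * Averages over discs and the doubling inequality *)

Section doubling.
Variable R : realType.
Implicit Types (v z w p q : R * R).
Local Notation mR := (measurableTypeR R).
Local Notation mu := (@plane_measure R).

Lemma edist_lt p z (r : R) : 0 < r ->
  (Defs.edist p z < r) = ((p.1 - z.1) ^+ 2 + (p.2 - z.2) ^+ 2 < r ^+ 2).
Proof.
move=> r0; rewrite /Defs.edist -[in LHS](ger0_norm (ltW r0)) -sqrtr_sqr.
by rewrite ltr_sqrt ?exprn_gt0.
Qed.

Lemma eball_open p (r : R) : open (eball p r).
Proof.
rewrite (_ : eball p r = Defs.edist p @^-1` `]-oo, r[%classic); last first.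
  by apply/seteqP; split => z /=; rewrite in_itv.
have cp : continuous (Defs.edist p).
  move=> z; apply: continuous_comp; last exact: sqrt_continuous.
  have c1 : continuous (fun z : R * R => p.1 - z.1).
    by move=> w; apply: cvgB; [exact: cvg_cst|exact: cvg_fst].
  have c2 : continuous (fun z : R * R => p.2 - z.2).
    by move=> w; apply: cvgB; [exact: cvg_cst|exact: cvg_snd].
  by apply: cvgD; apply: cvgM; [exact: c1|exact: c1|exact: c2|exact: c2].
by move/continuousP : cp; apply; exact: interval_open.
Qed.

Lemma eball_measurable p (r : R) : measurable (eball p r : set (mR * mR)).
Proof. by apply: open_plane_measurable; exact: eball_open. Qed.

(** Closed balls of the sup norm. Their measure is explicit, and comparison with them replaces the
    area of a disc. *)
Definition square q (h : R) : set (mR * mR) :=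
  `[q.1 - h, q.1 + h]%classic `*` `[q.2 - h, q.2 + h]%classic.

Lemma squareE q (h : R) z : square q h z <-> `|z - q| <= h.
Proof.
rewrite prod_normE ge_max /square /=; split.
  by move=> [/=]; rewrite !in_itv/= => /andP[? ?] /andP[? ?];
    rewrite !ler_norml; apply/andP; split; apply/andP; split; lra.
rewrite !ler_norml => /andP[/andP[? ?] /andP[? ?]].
by split; rewrite /= in_itv/=; apply/andP; split; lra.
Qed.

Lemma square_measurable q (h : R) : measurable (square q h).
Proof. by apply: measurableX; exact: measurable_itv. Qed.

Lemma square_measure q (h : R) : 0 <= h -> mu (square q h) = ((2 * h) ^+ 2)%:E.
Proof. by move=> h0; rewrite plane_measure_box; [congr EFin; ring|lra|lra]. Qed.

Lemma eball_norm p (r : R) z : eball p r z -> `|z - p| <= r.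
Proof.
rewrite /eball /= /Defs.edist => zr; apply: norm_le_pair; rewrite /= distrC -sqrtr_sqr;
  apply: le_trans (ltW zr); rewrite ler_wsqrtr//.
  by rewrite lerDl sqr_ge0.
by rewrite lerDr sqr_ge0.
Qed.

Lemma eball_measure p (r : R) : 0 < r ->
  (mu (eball p r) <= ((2 * r) ^+ 2)%:E)%E.
Proof.
move=> r0; rewrite -(square_measure p (ltW r0)); apply: le_measure; rewrite ?inE.
- exact: eball_measurable.
- exact: square_measurable.
- by move=> z /eball_norm /squareE.
Qed.

Lemma eball_measure_fin p (r : R) : (mu (eball p r) < +oo)%E.
Proof.
have [r0|r0] := leP r 0; last by apply: le_lt_trans (eball_measure p r0) _; rewrite ltry.
rewrite (_ : eball p r = set0) ?measure0 ?ltry//.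
apply/seteqP; split => // z /=; rewrite /eball/= => /lt_le_trans /(_ r0).
by rewrite ltNge sqrtr_ge0.
Qed.

Lemma bounded_integrable (D : set (R * R)) (f : R * R -> R) (K : R) :
  measurable (D : set (mR * mR)) -> (mu D < +oo)%E -> 
  measurable_fun (D : set (mR * mR)) f -> (forall z, D z -> `|f z| <= K) ->
  mu.-integrable D (EFin \o f).
Proof.
move=> mD D0 mf fK; apply: measurable_bounded_integrable => //.
exists K; split; first exact: num_real.
by move=> t Kt z Dz; exact: le_trans (fK _ Dz) (ltW Kt).
Qed.

Lemma average_le p (r M : R) (u : R * R -> R) : continuous u -> 0 <= M ->
  (forall z, eball p r z -> `|u z| <= M) -> average (eball p r) (fun z => u z ^+ 2) <= M ^+ 2.
Proof.
move=> cu M0 uM; rewrite /average; have mE := eball_measurable p r.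
have fE := eball_measure_fin p r.
have u2 z : eball p r z -> u z ^+ 2 <= M ^+ 2.
  by move=> zr; rewrite -(@real_normK _ (u z)) ?num_real// lerXn2r ?nnegrE// uM.
have cu2 : continuous (fun z => u z ^+ 2) by move=> z; exact: cvgM (cu z) (cu z).
have iu : mu.-integrable (eball p r) (EFin \o (fun z => u z ^+ 2)).
  apply: (@bounded_integrable _ _ (M ^+ 2)) => //.
    exact: continuous_plane_measurable.
  by move=> z zr; rewrite ger0_norm ?sqr_ge0// u2.
have ic : mu.-integrable (eball p r) (EFin \o (fun=> M ^+ 2)).
  by apply: (@bounded_integrable _ _ `|M ^+ 2|).
have h : \int[mu]_(z in eball p r) (u z ^+ 2) <= M ^+ 2 * fine (mu (eball p r)).
  by rewrite -Rintegral_cst//; exact: le_Rintegral.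
have m0 : 0 <= fine (mu (eball p r)) by rewrite fine_ge0.
(* For a disc of measure 0 the inverse, and with it the average, is 0 by convention. *)
have [e|n] := eqVneq (fine (mu (eball p r))) 0.
  by rewrite e invr0 mul0r sqr_ge0.
by rewrite ler_pdivrMl ?lt0r ?n// mulrC.
Qed.

(** The disc contains a square of half-side [h] and is contained in one of half-side [r];
    [(h / r) ^+ 2] is the ratio of their areas. *)
Lemma average_ge p q (r h m : R) (u : R * R -> R) : 0 < r -> 0 <= h -> continuous u ->
  (forall z, `|z - q| <= h -> eball p r z) ->
  (exists M, forall z, eball p r z -> `|u z| <= M) ->
  0 <= m -> (forall z, `|z - q| <= h -> m <= `|u z|) ->
  (h / r) ^+ 2 * m ^+ 2 <= average (eball p r) (fun z => u z ^+ 2).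
Proof.
move=> r0 h0 cu sub [M uM] m0 um; rewrite /average; have mE := eball_measurable p r.
have fE := eball_measure_fin p r; have mS := square_measurable q h.
have cu2 : continuous (fun z => u z ^+ 2) by move=> z; exact: cvgM (cu z) (cu z).
have iu : mu.-integrable (eball p r) (EFin \o (fun z => u z ^+ 2)).
  apply: (@bounded_integrable _ _ (M ^+ 2)) => //.
    exact: continuous_plane_measurable.
  move=> z zr; rewrite ger0_norm ?sqr_ge0//.
  rewrite -(@real_normK _ (u z)) ?num_real// lerXn2r ?nnegrE ?uM//.
  exact: le_trans (normr_ge0 _) (uM z zr).
have SE : square q h `<=` eball p r by move=> z /squareE /sub.
have iS : mu.-integrable (square q h) (EFin \o (fun z => u z ^+ 2)).
  exact: integrableS iu.
have lo : m ^+ 2 * (2 * h) ^+ 2 <= \int[mu]_(z in square q h) (u z ^+ 2).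
  rewrite -[(2 * h) ^+ 2]/(fine ((2 * h) ^+ 2)%:E) -(square_measure q h0).
  rewrite -Rintegral_cst//; apply: le_Rintegral => //.
    apply: (@bounded_integrable _ _ `|m ^+ 2|) => //.
    by rewrite square_measure// ltry.
  move=> z /squareE /um mz; rewrite -(@real_normK _ (u z)) ?num_real//.
  by rewrite lerXn2r ?nnegrE.
have up : \int[mu]_(z in square q h) (u z ^+ 2) <= \int[mu]_(z in eball p r) (u z ^+ 2).
  rewrite /Rintegral fine_le//; [exact: integrable_fin_num|exact: integrable_fin_num|].
  apply: ge0_subset_integral => //.
    by apply/measurable_EFinP; exact: continuous_plane_measurable.
  by move=> z _; rewrite lee_fin sqr_ge0.
have sM : fine (mu (square q h)) <= fine (mu (eball p r)).
  have leS : (mu (square q h) <= mu (eball p r))%E by apply: le_measure; rewrite ?inE.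
  by apply: fine_le leS; rewrite ge0_fin_numE// square_measure// ltry.
have bM : fine (mu (eball p r)) <= (2 * r) ^+ 2.
  by rewrite -lee_fin fineK ?ge0_fin_numE//; exact: eball_measure.
have [->|hn] := eqVneq h 0.
  rewrite mul0r expr0n mul0r; apply: mulr_ge0; first by rewrite invr_ge0 fine_ge0.
  by apply: Rintegral_ge0 => z _; exact: sqr_ge0.
rewrite square_measure//= in sM.
have h2 : 0 < (2 * h) ^+ 2 by rewrite exprn_gt0// mulr_gt0// lt0r hn.
have mp : 0 < fine (mu (eball p r)) by apply: lt_le_trans sM.
rewrite ler_pdivlMl//; apply: le_trans (le_trans lo up).
apply: (@le_trans _ _ ((2 * r) ^+ 2 * ((h / r) ^+ 2 * m ^+ 2))).
  by rewrite ler_wpM2r// mulr_ge0 ?sqr_ge0.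
rewrite le_eqVlt; apply/orP; left; apply/eqP; field.
by rewrite gt_eqF.
Qed.

(** If r > 1, the points p + (2, 0) and p - (2, 0) would both lie in the disc of radius 2, although
    their squared norms add up to at least 8. *)
Lemma eball_radius p (r : R) : 0 < r -> eball p (2 * r) `<=` eball (0, 0) 2 -> r <= 1.
Proof.
move=> r0 sub; rewrite leNgt; apply/negP => r1.
have s z : eball p (2 * r) z -> z.1 ^+ 2 + z.2 ^+ 2 < 4.
  move=> /sub; rewrite /eball/= edist_lt// !sub0r !sqrrN => h.
  by rewrite (_ : 4 = 2 ^+ 2 :> R)//; ring.
have /s /= h1 : eball p (2 * r) (p.1 + 2, p.2).
  rewrite /eball/= edist_lt ?mulr_gt0//= subrr expr0n addr0.
  by rewrite (_ : p.1 - _ = -2); [nra|ring].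
have /s /= h2 : eball p (2 * r) (p.1 - 2, p.2).
  rewrite /eball/= edist_lt ?mulr_gt0//= subrr expr0n addr0.
  by rewrite (_ : p.1 - _ = 2); [nra|ring].
nra.
Qed.

Variables (X Y : R * R -> R) (F c1 c2 : nat -> R * R -> R * R).
Variables (S : nat -> set (R * R)) (e : nat -> R).
Hypothesis fm : flat_map X Y F c1 c2 S e.

(** With b = Y p, the function is at most |b| + 5 m r on the large disc. On a small square, shifted
    from [p] so that the linear part has the sign of b, it is at least |b| + m r / 10 in absolute
    value. The ratio is bounded independently of b, m and r. *)
Lemma flat_map_doubling p (r : R) : 0 < r -> r <= 1 ->
  average (eball p (2 * r)) (fun z => Y z ^+ 2) <=
  4 `^ 10 * average (eball p r) (fun z => Y z ^+ 2).
Proof.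
move=> r0 r1; have [v v0 aff] := flat_affine fm p r0 r1.
have [_ cY] := flat_continuous fm.
have [v1 v2 m2] := norm_le_sqrt_sqnorm v; have m0 : 0 < Num.sqrt (sqnorm v) by rewrite sqrtr_gt0.
move: (Num.sqrt _) v1 v2 m2 m0 aff => m v1 v2 m2 m0 aff.
have mr : 0 < m * r by rewrite mulr_gt0.
have b0 := normr_ge0 (Y p); set b := Y p in b0 aff.
have prod (x y s t : R) : `|x| <= s -> `|y| <= t -> `|x * y| <= s * t.
  by move=> xs yt; rewrite normrM ler_pM.
pose M := `|b| + 5 * (m * r).
have M0 : 0 <= M by rewrite addr_ge0// mulr_ge0// ltW.
have up z : `|z - p| <= 2 * r -> `|Y z| <= M.
  move=> zp; have d1 := le_trans (norm_fst (z - p)) zp.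
  have d2 := le_trans (norm_snd (z - p)) zp; rewrite /= in d1 d2.
  have h1 := prod _ _ _ _ v2 d1; have h2 := prod _ _ _ _ v1 d2; have h := aff z zp.
  move: h h1 h2; set s := v.2 * _; set t := v.1 * _ => h h1 h2.
  have -> : Y z = (Y z - b - (s + t)) + (b + (s + t)) by ring.
  apply: le_trans (ler_normD _ _) _; have := ler_normD b (s + t).
  have := ler_normD s t; rewrite /M; lra.
(* 1/10 = 7/20 - 1/16 - 1/16 - 1/8: gain from a shift by r/2, loss over the square of half-side r/16
   in each coordinate, affine error. *)
pose ml := `|b| + m * r / 10.
have ml0 : 0 <= ml by rewrite addr_ge0// divr_ge0// ltW.
have [q [qp qlow]] : exists q, (forall z, `|z - q| <= r / 16 -> eball p r z /\ `|z - p| <= 2 * r)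
    /\ forall z, `|z - q| <= r / 16 -> ml <= `|Y z|.
  (* A sign that is 1 rather than 0 at b = 0, since |sb| = 1 is used throughout. *)
  pose sb : R := if 0 <= b then 1 else -1.
  have sbb : sb * b = `|b|.
    rewrite /sb; case: ifPn => h; first by rewrite mul1r ger0_norm.
    by rewrite mulN1r ltr0_norm// ltNge.
  have sb1 : `|sb| = 1 by rewrite /sb; case: ifP => _; rewrite ?normrN normr1.
  have low (z : R * R) (c x y o : R) : `|z - p| <= 2 * r -> 7 / 10 * m <= `|c| ->
      `|x| <= r / 16 -> `|y| <= r / 16 -> `|o| <= m -> `|c| <= m ->
      v.2 * (z.1 - p.1) + v.1 * (z.2 - p.2) = sb * `|c| * (r / 2) + c * x + o * y ->
      ml <= `|Y z|.
    move=> zp cm xr yr om cm' eq; have := aff z zp; rewrite eq.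
    have h1 := prod _ _ _ _ cm' xr; have h2 := prod _ _ _ _ om yr.
    move=> h; have sE : sb * sb = 1.
      by rewrite -expr2 -(@real_normK _ sb) ?num_real// sb1 expr1n.
    have yE : sb * Y z = `|b| + `|c| * (r / 2) + (sb * (c * x) + sb * (o * y) +
        sb * (Y z - b - (sb * `|c| * (r / 2) + c * x + o * y))).
      by rewrite -sbb -[in LHS](subrK b (Y z)); ring: sE.
    have n1 (w : R) : `|sb * w| = `|w| by rewrite normrM sb1 mul1r.
    rewrite -(n1 (Y z)); apply: le_trans (ler_norm _); rewrite yE.
    move: h1 h2 h; rewrite -/b -(n1 (c * x)) -(n1 (o * y)) -(n1 (Y z - _ - _)) !ler_norml.
    move=> /andP[? _] /andP[? _] /andP[? _].
    have : 7 / 10 * m * (r / 2) <= `|c| * (r / 2) by rewrite ler_wpM2r// divr_ge0// ltW.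
    rewrite /ml; lra.
  have r16 : 0 < r / 16 by rewrite divr_gt0.
  have sub (q z : R * R) : (`|q.1 - p.1| <= r / 2 /\ q.2 = p.2 \/
       `|q.2 - p.2| <= r / 2 /\ q.1 = p.1) ->
      `|z - q| <= r / 16 -> eball p r z /\ `|z - p| <= 2 * r.
    move=> hq hz; have zq1 := le_trans (norm_fst (_ - _)) hz.
    have zq2 := le_trans (norm_snd (_ - _)) hz.
    have key (x y : R) : `|x| <= r * 9 / 16 -> `|y| <= r * 9 / 16 -> x ^+ 2 + y ^+ 2 < r ^+ 2.
      move=> hx hy; rewrite -(@real_normK _ x) ?num_real// -(@real_normK _ y) ?num_real//.
      have := normr_ge0 x; have := normr_ge0 y; move: hx hy.
      by move: `|x| `|y| r0; clear - fm => s t; nra.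
    have [x9 y9] : `|p.1 - z.1| <= r * 9 / 16 /\ `|p.2 - z.2| <= r * 9 / 16.
      have near (s t w : R) : `|t - s| <= r / 2 -> `|w - t| <= r / 16 ->
          `|s - w| <= r * 9 / 16.
        clear - r0 fm; rewrite distrC [`|w - t|]distrC => h1 h2.
        rewrite -(subrKA t); apply: le_trans (ler_normD _ _) _; lra.
      have r2 : 0 <= r / 2 by rewrite divr_ge0// ltW.
      by case: hq => -[h E]; split; apply: near zq1 || apply: near zq2;
        rewrite ?E ?subrr ?normr0//.
    split; first by rewrite /eball/= edist_lt//; exact: key.
    have le2 (x : R) : x <= r * 9 / 16 -> x <= 2 * r by clear - r0 fm; lra.
    by apply: norm_le_pair; rewrite /= distrC; exact: le2.
  (* One component of [v] has absolute value at least m / sqrt 2 > 7/10 m; the shift follows the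
     corresponding axis. *)
  have [c7|c7] := leP (7 / 10 * m) `|v.2|.
    pose s := sb * Num.sg v.2 * (r / 2).
    have s2 : `|s| <= r / 2.
      rewrite /s !normrM sb1 mul1r normr_sg (ger0_norm (ltW r0)) ger0_norm//.
      by case: (v.2 != 0); rewrite ?mul1r ?mul0r// divr_ge0// ltW.
    exists (p.1 + s, p.2); split => z zq.
      by apply: sub zq; left; split => //=; rewrite addrC addKr.
    have [_ zp] : eball p r z /\ `|z - p| <= 2 * r.
      by apply: sub zq; left; split => //=; rewrite addrC addKr.
    apply: (@low z v.2 (z.1 - (p.1 + s)) (z.2 - p.2) v.1) => //.
    - exact: le_trans (norm_fst (_ - _)) zq.
    - exact: le_trans (norm_snd (_ - _)) zq.
    - by rewrite /s [`|v.2|]normrEsg; ring.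
  have c7' : 7 / 10 * m <= `|v.1|.
    rewrite leNgt; apply/negP => h; have := normr_ge0 v.1; have := normr_ge0 v.2.
    move: m2; rewrite /sqnorm -(@real_normK _ v.1) ?num_real// -(@real_normK _ v.2) ?num_real//.
    move: c7 h; move: `|v.1| `|v.2| => s t; nra.
  pose s := sb * Num.sg v.1 * (r / 2).
  have s2 : `|s| <= r / 2.
    rewrite /s !normrM sb1 mul1r normr_sg (ger0_norm (ltW r0)) ger0_norm//.
    by case: (v.1 != 0); rewrite ?mul1r ?mul0r// divr_ge0// ltW.
  exists (p.1, p.2 + s); split => z zq.
    by apply: sub zq; right; split => //=; rewrite addrC addKr.
  have [_ zp] : eball p r z /\ `|z - p| <= 2 * r.
    by apply: sub zq; right; split => //=; rewrite addrC addKr.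
  apply: (@low z v.1 (z.2 - (p.2 + s)) (z.1 - p.1) v.2) => //.
  - exact: le_trans (norm_snd (_ - _)) zq.
  - exact: le_trans (norm_fst (_ - _)) zq.
  - by rewrite /s [`|v.1|]normrEsg; ring.
have A2 : average (eball p (2 * r)) (fun z => Y z ^+ 2) <= M ^+ 2.
  by apply: average_le => // z /eball_norm; exact: up.
have A1 : (r / 16 / r) ^+ 2 * ml ^+ 2 <= average (eball p r) (fun z => Y z ^+ 2).
  apply: (@average_ge p q) => //.
  - by rewrite divr_ge0// ltW.
  - by move=> z /qp[].
  - exists M => z /eball_norm zr; apply: up; lra.
apply: le_trans A2 _; rewrite powR_mulrn//.
apply: (@le_trans _ _ (4 ^+ 10 * ((r / 16 / r) ^+ 2 * ml ^+ 2))); last first.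
  by rewrite ler_pM2l// exprn_gt0.
(* The area fraction is 2^-8, and 4^10 / 2^8 = 64^2; [64 * ml] dominates [M], which fixes the
   exponent 10. *)
have -> : 4 ^+ 10 * ((r / 16 / r) ^+ 2 * ml ^+ 2) = (64 * ml) ^+ 2.
  by field; rewrite gt_eqF.
rewrite lerXn2r ?nnegrE ?mulr_ge0// /M /ml; lra.
Qed.

End doubling.

(** * The length of the nodal set *)

Section nodal_length.
Variable R : realType.
Implicit Types (v z w p q : R * R).

Lemma diameter_ge0 (U : set (R * R)) : (0 <= diameter U)%E.
Proof. by apply: ereal_sup_ubound; left. Qed.

Lemma edist_le_diameter (U : set (R * R)) z w : U z -> U w ->
  ((Defs.edist z w)%:E <= diameter U)%E.
Proof. by move=> Uz Uw; apply: ereal_sup_ubound; right; exists z, w. Qed.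

Lemma norm_le_edist z w : `|z - w| <= Defs.edist z w.
Proof.
rewrite /Defs.edist; apply: norm_le_pair; rewrite /= -sqrtr_sqr ler_wsqrtr//.
  by rewrite lerDl sqr_ge0.
by rewrite lerDr sqr_ge0.
Qed.

(** A covering of [A] by sets of diameter at most [delta] induces one of [a, b] by intervals of
    half-length K times the diameters. The factor 2 arises because each interval is centred at the
    image of an arbitrary point. *)
Lemma hausdorff1_pre_ge (f : R * R -> R) (A : set (R * R)) (K delta a b : R) :
  0 < K -> a <= b ->
  (forall z w, A z -> A w -> Defs.edist z w <= delta ->
     `|f z - f w| <= K * Defs.edist z w) ->
  `[a, b]%classic `<=` f @` A ->
  (((b - a) / (2 * K))%:E <= hausdorff1_pre delta A)%E.
Proof.
move=> K0 ab fK fA; apply: le_ereal_inf_tmp => s [U [Ud UA ->]].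
have dfin k : diameter (U k) \is a fin_num.
  by rewrite ge0_fin_numE ?diameter_ge0// (le_lt_trans (Ud k)) ?ltry.
pose d k := fine (diameter (U k)).
have d0 k : 0 <= d k by rewrite fine_ge0// diameter_ge0.
have dE k : diameter (U k) = (d k)%:E by rewrite fineK.
have /choice[c cP] : forall k, exists c, forall z, A z -> U k z ->
    `|f z - c| <= K * d k.
  move=> k; have [[w [Aw Uw]]|no] := pselect (exists w, A w /\ U k w); last first.
    by exists 0 => z Az Uz; exfalso; apply: no; exists z.
  exists (f w) => z Az Uz; have := edist_le_diameter Uz Uw; rewrite dE lee_fin => zd.
  apply: (@le_trans _ _ (K * Defs.edist z w)); last by rewrite ler_pM2l.
  apply: fK => //; have := le_trans (edist_le_diameter Uz Uw) (Ud k).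
  by rewrite lee_fin.
pose I k : set (measurableTypeR R) := `[c k - K * d k, c k + K * d k]%classic.
have IE k : lebesgue_measure (I k) = ((2 * K) * d k)%:E.
  have Kd : 0 <= K * d k by rewrite mulr_ge0// ltW.
  rewrite lebesgue_measure_itv/= lte_fin; case: ltP => h.
    by rewrite -EFinD; congr EFin; ring.
  by congr EFin; lra.
have cover : (`[a, b]%classic : set (measurableTypeR R)) `<=` \bigcup_k I k.
  move=> t /fA [z Az <-]; have [k _ Uz] := UA _ Az; exists k => //.
  by have := cP k _ Az Uz; rewrite /I /= in_itv/= ler_norml => /andP[? ?]; apply/andP; split; lra.
have lab : lebesgue_measure (`[a, b]%classic : set (measurableTypeR R)) = (b - a)%:E.
  rewrite lebesgue_measure_itv/= lte_fin.
  by move: ab; case: ltgtP => // -> _; rewrite subrr.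
have h : ((b - a)%:E <= \sum_(0 <= k <oo) ((2 * K)%:E * (d k)%:E))%E.
  rewrite -lab; apply: le_trans (measure_sigma_subadditive (@lebesgue_measure R)
    (fun k => measurable_itv _ : measurable (I k)) (measurable_itv _) cover) _.
  by apply: lee_nneseries => [k _ _|k _]; [exact: measure_ge0|rewrite -EFinM -IE].
rewrite nneseriesZl in h; last by move=> k _; rewrite lee_fin.
under eq_eseriesr do rewrite dE.
have K2 : 0 < 2 * K by rewrite mulr_gt0.
rewrite -(@lee_pmul2l _ (2 * K)%:E) ?lte_fin// -EFinM mulrC divfK ?gt_eqF//.
Qed.

Variables (X Y : R * R -> R) (F c1 c2 : nat -> R * R -> R * R).
Variables (S : nat -> set (R * R)) (e : nat -> R).
Hypothesis fm : flat_map X Y F c1 c2 S e.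

(** At short distances [X] contracts the nodal set by any prescribed factor [K], yet the part in the
    unit disc is mapped over a fixed interval of length 1/2. The choice of [K] makes the resulting
    lower bound exactly [M]. *)
Lemma flat_map_nodal_length :
  hausdorff1 (nodal_set (eball (0, 0) 2) Y `&` eball (0, 0) 1) = +oo%E.
Proof.
apply/eqyP => M M0; set A := _ `&` _.
pose K := (4 * M)^-1; have K0 : 0 < K by rewrite invr_gt0 mulr_gt0.
(* Modulus at most K/3: the linear part costs at most twice the modulus, and the affine error fits
   into the remaining third. *)
have [r0 r00 thin] := flat_thin fm (exprn_gt0 2 (divr_gt0 K0 (ltr0n R 3))).
have near z w : A z -> A w -> Defs.edist z w <= r0 ->
    `|X z - X w| <= K * Defs.edist z w.
  move=> [[_ z0] _] [[_ w0] _] zw.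
  apply: (@le_trans _ _ (K * `|z - w|)); last by rewrite ler_pM2l// norm_le_edist.
  have [->|zwn] := eqVneq z w; first by rewrite !subrr !normr0 mulr0.
  have t0 : 0 < `|z - w| by rewrite normr_gt0 subr_eq0.
  have t2 : `|z - w| / 2 <= r0.
    by have := norm_le_edist z w; have := lt_le_trans t0 (norm_le_edist z w); lra.
  have [v vd aff] := thin w _ w0 (divr_gt0 t0 (ltr0n R 2)) t2.
  have := aff z; rewrite mulrC divfK ?pnatr_eq0// => /(_ (lexx _)).
  have [v1 v2 m2] := norm_le_sqrt_sqnorm v; have m0 : 0 <= Num.sqrt (sqnorm v) by rewrite sqrtr_ge0.
  have mK : Num.sqrt (sqnorm v) <= K / 3.
    rewrite -(@ler_pXn2r _ 2)// ?nnegrE ?divr_ge0 ?(ltW K0)//.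
    by rewrite m2.
  move: (Num.sqrt _) v1 v2 m0 mK => m v1 v2 m0 mK.
  have d1 := norm_fst (z - w); have d2 := norm_snd (z - w); rewrite /= in d1 d2.
  have prod (x y s t : R) : `|x| <= s -> `|y| <= t -> `|x * y| <= s * t.
    by move=> xs yt; rewrite normrM ler_pM.
  have h1 := prod _ _ _ _ v1 d1.
  have h2 : `|- v.2 * (z.2 - w.2)| <= m * `|z - w| by apply: prod => //; rewrite normrN.
  move=> h; move: h h1 h2; set s := v.1 * _; set t := - v.2 * _ => h h1 h2.
  have -> : X z - X w = (X z - X w - (s + t)) + (s + t) by ring.
  apply: le_trans (ler_normD _ _) _; apply: le_trans (lerD h (ler_normD _ _)) _.
  have : m * `|z - w| <= K / 3 * `|z - w| by rewrite ler_wpM2r.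
  have : 0 <= m * `|z - w| by rewrite mulr_ge0.
  lra.
(* The limit map moves each coordinate by at most 1/4, so preimages of these points on the real axis
   stay in the unit disc. *)
have img : `[- 4^-1, 4^-1]%classic `<=` X @` A.
  move=> t; rewrite /= in_itv/= => /andP[t1 t2].
  have [w [/= wX wY]] := flat_surjective fm (t, 0).
  have [] := flat_near_id fm w; rewrite wX wY !ler_norml => /andP[? ?] /andP[? ?].
  exists w => //; split; first (split=> //); rewrite /eball/= edist_lt//= !sub0r !sqrrN; nra.
have := hausdorff1_pre_ge K0 _ near img.
have -> : (4^-1 - - 4^-1) / (2 * K) = M by rewrite /K; field; rewrite gt_eqF.
move=> /(_ _) h; apply: le_trans (h _) _; first lra.
by apply: ereal_sup_ubound; exists r0.
Qed.

End nodal_length.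

(** * The equation *)

Section solution.
Variable R : realType.
Implicit Types (v z w p q : R * R).
Local Notation mR := (measurableTypeR R).
Local Notation mu := (@plane_measure R).

Lemma c11_continuous L Q (f f1 f2 : R * R -> R) : c11 L Q f f1 f2 ->
  [/\ continuous f, continuous f1 & continuous f2].
Proof.
move=> cf; split; apply: continuous_modulus => d d0;
  [exists L|exists Q|exists Q] => z w; have [_ h1 [h2 h3] _] := cf z w;
  [apply: le_trans h1 _|apply: le_trans h2 _|apply: le_trans h3 _];
  by rewrite lerDr ltW.
Qed.

Lemma c11_is_derive L Q (f f1 f2 : R * R -> R) i z : c11 L Q f f1 f2 ->
  is_derive z (basis_vector R i) f (if i == 0 then f1 z else f2 z).
Proof.
move=> cf; apply: (@is_derive_quadratic _ _ _ _ _ _ Q) => h.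
have [_ _ _] := cf z (z + h *: basis_vector R i).
have -> : z + h *: basis_vector R i - z = h *: basis_vector R i by rewrite addrC addKr.
rewrite normrZ /basis_vector; case: (i == 0).
  have -> : `|((1 : R), (0 : R))| = 1 by rewrite prod_normE/= normr1 normr0 max_l.
  rewrite mulr1 real_normK ?num_real//; congr (`|_| <= _); rewrite /= /GRing.scale/=.
  by rewrite [X in f X - _]addrC; ring.
have -> : `|((0 : R), (1 : R))| = 1 by rewrite prod_normE/= normr1 normr0 max_r.
rewrite mulr1 real_normK ?num_real//; congr (`|_| <= _); rewrite /= /GRing.scale/=.
by rewrite [X in f X - _]addrC; ring.
Qed.

Lemma c11_partial L Q (f f1 f2 : R * R -> R) i : c11 L Q f f1 f2 ->
  partial i f = if i == 0 then f1 else f2.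
Proof.
move=> cf; apply/funext => z; rewrite /partial.
by have := @derive_val _ _ _ _ _ _ _ (c11_is_derive i z cf) => ->; case: (i == 0).
Qed.

Lemma square_integrable_bounded (D : set (R * R)) (f : R * R -> R) (K : R) :
  measurable (D : set (mR * mR)) -> (mu D < +oo)%E ->
  measurable_fun (D : set (mR * mR)) f -> (forall z, D z -> `|f z| <= K) ->
  square_integrable D f.
Proof.
move=> mD D0 mf fK; split=> //.
have /integrableP[_] : mu.-integrable D (EFin \o (fun z => f z ^+ 2)).
  apply: (@bounded_integrable _ _ _ (K ^+ 2)) => //.
    exact: measurable_funX.
  move=> z /fK zK; rewrite ger0_norm ?sqr_ge0// -(@real_normK _ (f z)) ?num_real//.
  by rewrite lerXn2r ?nnegrE// (le_trans _ zK).
by under eq_integral do rewrite /= ger0_norm ?sqr_ge0//.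
Qed.

Lemma partial_comm (D : set (R * R)) (phi : R * R -> R) (i j : 'I_2) x :
  test_function D phi -> partial i (partial j phi) x = partial j (partial i phi) x.
Proof.
move=> tphi; have d (k l : 'I_2) := test_function_partial l (test_function_partial k tphi).
apply: (@derive_comm _ _ phi x (basis_vector R j) (basis_vector R i)).
- by move=> y; exact: (test_function_derivable tphi).
- by move=> y; exact: (test_function_derivable tphi).
- by move=> y; exact: (test_function_derivable (test_function_partial j tphi)).
- by move=> y; exact: (test_function_derivable (test_function_partial i tphi)).
- exact: (test_function_continuous (d j i)).
- exact: (test_function_continuous (d i j)).
Qed.

Variables (X Y : R * R -> R) (F c1 c2 : nat -> R * R -> R * R).
Variables (S : nat -> set (R * R)) (e : nat -> R).
Hypothesis fm : flat_map X Y F c1 c2 S e.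

Let D : set (R * R) := eball (0, 0) 2.

Lemma disc_norm z : D z -> `|z.1| <= 2 /\ `|z.2| <= 2.
Proof.
move=> /eball_norm zD; have := le_trans (norm_fst _) zD.
by have := le_trans (norm_snd _) zD; rewrite /= !subr0.
Qed.

Lemma flat_map_bound k z : D z -> `|(F k z).1| <= 3 /\ `|(F k z).2| <= 3.
Proof.
move=> /disc_norm[z1 z2]; have h := flat_dist fm k z.
have h1 := le_trans (norm_fst _) h; have h2 := le_trans (norm_snd _) h.
rewrite /= in h1 h2; split.
  by rewrite -[(F k z).1](subrK z.1) (le_trans (ler_normD _ _))//; lra.
by rewrite -[(F k z).2](subrK z.2) (le_trans (ler_normD _ _))//; lra.
Qed.

Definition gradX z := pair_col (col_lim c1 z).1 (col_lim c2 z).1.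
Definition gradY z := pair_col (col_lim c1 z).2 (col_lim c2 z).2.

Lemma col_lim_bound z : [/\ `|(col_lim c1 z).1| <= 2, `|(col_lim c1 z).2| <= 2,
  `|(col_lim c2 z).1| <= 2 & `|(col_lim c2 z).2| <= 2].
Proof.
have [h1 h2 h3 h4] := col_lim_cvg fm z.
have lim_le (u : nat -> R) l : u k @[k --> \oo] --> l -> (forall k, `|u k| <= 2) -> `|l| <= 2.
  move=> ul u2; apply/ler_addgt0Pl => d d0.
  have /cvgr_dist_le /(_ _ d0) [n _ /(_ n (leqnn n))] := ul => h.
  rewrite -[l](subrK (u n)) (le_trans (ler_normD _ _))// lerD//.
split; [apply: lim_le h1 _|apply: lim_le h2 _|apply: lim_le h3 _|apply: lim_le h4 _];
  by move=> k; have [] := columns_bound fm k z.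
Qed.

Lemma columns_continuous k : [/\ continuous (fun z => (F k z).1),
  continuous (fun z => (F k z).2) &
  [/\ continuous (fun z => (c1 k z).1), continuous (fun z => (c1 k z).2),
      continuous (fun z => (c2 k z).1) & continuous (fun z => (c2 k z).2)]].
Proof.
have [L [Q [cX cY]]] := flat_c11 fm k.
by have [? ? ?] := c11_continuous cX; have [? ? ?] := c11_continuous cY.
Qed.

Lemma mD : measurable (D : set (mR * mR)).
Proof. exact: eball_measurable. Qed.

Lemma col_lim_measurable :
  [/\ measurable_fun (D : set (mR * mR)) (fun z => (col_lim c1 z).1 : R),
      measurable_fun (D : set (mR * mR)) (fun z => (col_lim c1 z).2 : R),
      measurable_fun (D : set (mR * mR)) (fun z => (col_lim c2 z).1 : R) &
      measurable_fun (D : set (mR * mR)) (fun z => (col_lim c2 z).2 : R)].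
Proof.
have mc (u : nat -> R * R -> R) (l : R * R -> R) : (forall k, continuous (u k)) ->
    (forall z, u k z @[k --> \oo] --> l z) -> measurable_fun (D : set (mR * mR)) l.
  move=> cu ul; apply: (@measurable_fun_cvg _ _ _ _ u) => // k.
  by apply: continuous_plane_measurable => //; exact: mD.
split.
- apply: (mc (fun k z => (c1 k z).1)) => [k|z]; first by have [_ _ []] := columns_continuous k.
  by have [] := col_lim_cvg fm z.
- apply: (mc (fun k z => (c1 k z).2)) => [k|z]; first by have [_ _ []] := columns_continuous k.
  by have [] := col_lim_cvg fm z.
- apply: (mc (fun k z => (c2 k z).1)) => [k|z]; first by have [_ _ []] := columns_continuous k.
  by have [] := col_lim_cvg fm z.
- apply: (mc (fun k z => (c2 k z).2)) => [k|z]; first by have [_ _ []] := columns_continuous k.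
  by have [] := col_lim_cvg fm z.
Qed.

(** The conjugate function needs a weak gradient too, since the flux of the equation is that
    gradient rotated. The bound 3 is 2 for the disc plus 1 for the displacement. *)
Lemma weak_gradientX : weak_gradient D X gradX.
Proof.
apply: (@weak_gradient_limit _ D (fun k z => (F k z).1) _ _ 3).
- exact: mD.
- by move=> k; have [] := columns_continuous k.
- move=> k i x; have [L [Q [cX _]]] := flat_c11 fm k.
  exact: (@ex_derive _ _ _ _ _ _ _ (c11_is_derive i x cX)).
- move=> k i; have [L [Q [cX _]]] := flat_c11 fm k.
  have -> := c11_partial i cX : partial i (fun z => (F k z).1) = _.
  by have [_ _ [h1 _ h2 _]] := columns_continuous k; case: (i == 0).
- by move=> x _; have [] := flat_cvg fm x.
- move=> i x _; have [h1 h2 h3 h4] := col_lim_cvg fm x.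
  rewrite mxE (_ : (fun k => _) = fun k => if i == 0 then (c1 k x).1 else (c2 k x).1).
    by case: (i == 0).
  apply/funext => k; have [L [Q [cX _]]] := flat_c11 fm k.
  by have -> := c11_partial i cX : partial i (fun z => (F k z).1) = _; case: (i == 0).
- by move=> k x /(flat_map_bound k)[].
- move=> k i x _; have [L [Q [cX _]]] := flat_c11 fm k.
  have -> := c11_partial i cX : partial i (fun z => (F k z).1) = _.
  by have [? ? ? ?] := columns_bound fm k x; case: (i == 0) => /=; lra.
Qed.

Lemma weak_gradientY : weak_gradient D Y gradY.
Proof.
apply: (@weak_gradient_limit _ D (fun k z => (F k z).2) _ _ 3).
- exact: mD.
- by move=> k; have [] := columns_continuous k.
- move=> k i x; have [L [Q [_ cY]]] := flat_c11 fm k.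
  exact: (@ex_derive _ _ _ _ _ _ _ (c11_is_derive i x cY)).
- move=> k i; have [L [Q [_ cY]]] := flat_c11 fm k.
  have -> := c11_partial i cY : partial i (fun z => (F k z).2) = _.
  by have [_ _ [_ h1 _ h2]] := columns_continuous k; case: (i == 0).
- by move=> x _; have [] := flat_cvg fm x.
- move=> i x _; have [h1 h2 h3 h4] := col_lim_cvg fm x.
  rewrite mxE (_ : (fun k => _) = fun k => if i == 0 then (c1 k x).2 else (c2 k x).2).
    by case: (i == 0).
  apply/funext => k; have [L [Q [_ cY]]] := flat_c11 fm k.
  by have -> := c11_partial i cY : partial i (fun z => (F k z).2) = _; case: (i == 0).
- by move=> k x /(flat_map_bound k)[].
- move=> k i x _; have [L [Q [_ cY]]] := flat_c11 fm k.
  have -> := c11_partial i cY : partial i (fun z => (F k z).2) = _.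
  by have [? ? ? ?] := columns_bound fm k x; case: (i == 0) => /=; lra.
Qed.

Lemma L2_gradY : L2_weak_gradient D Y gradY.
Proof.
split; last exact: weak_gradientY.
have [m1 m2 m3 m4] := col_lim_measurable; move=> i.
rewrite (_ : (fun x => _) = fun x => if i == 0 then (col_lim c1 x).2 else (col_lim c2 x).2);
  last by apply/funext => x; rewrite mxE.
apply: (@square_integrable_bounded _ _ 2); [exact: mD|exact: eball_measure_fin| |].
  by case: (i == 0).
by move=> z _; have [] := col_lim_bound z; case: (i == 0).
Qed.

Lemma square_integrableY : square_integrable D Y.
Proof.
apply: (@square_integrable_bounded _ _ 3); [exact: mD|exact: eball_measure_fin| |].
  by apply: continuous_plane_measurable; [exact: mD|have [] := flat_continuous fm].
move=> z /disc_norm[_ z2]; have [_ h] := flat_near_id fm z.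
by rewrite -[Y z](subrK z.2) (le_trans (ler_normD _ _))//; lra.
Qed.

Lemma integrable_bounded_test (h psi : R * R -> R) (K : R) :
  measurable_fun (D : set (mR * mR)) h -> (forall z, `|h z| <= K) ->
  test_function D psi -> mu.-integrable D (EFin \o (fun z => h z * psi z)).
Proof.
move=> mh hK tpsi; have cpsi := test_function_continuous tpsi.
have [K' K'P] := bounded_on_box 2 cpsi.
apply: (@bounded_integrable _ _ _ (K * K')); [exact: mD|exact: eball_measure_fin| |].
  apply: measurable_funM => //.
  by apply: continuous_plane_measurable => //; exact: mD.
move=> z /disc_norm[z1 z2]; rewrite normrM ler_pM//; exact: K'P.
Qed.

(** Since the flux is the rotated gradient of [X], moving the derivatives onto the test function
    leaves [X] times the difference of two mixed derivatives of [phi]. *)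
Lemma flat_map_weak_solution : weak_solution D (coefficient Y c1 c2) Y.
Proof.
exists gradY; first exact: L2_gradY.
move=> phi tphi; have t0 := test_function_partial 0 tphi.
have t1 := test_function_partial 1 tphi.
have [m1 m2 m3 m4] := col_lim_measurable.
have E x : ((coefficient Y c1 c2 x *m gradY x)^T *m gradient phi x) 0 0 =
    (col_lim c1 x).1 * partial 1 phi x - (col_lim c2 x).1 * partial 0 phi x.
  rewrite (coefficient_flux fm) !mxE !big_ord_recl big_ord0 !mxE /=.
  have -> : lift ord0 ord0 = 1 :> 'I_2 by exact: val_inj.
  by rewrite addr0 mulNr addrC.
under eq_Rintegral do rewrite E.
have i1 : mu.-integrable D (EFin \o (fun x => (col_lim c1 x).1 * partial 1 phi x)).
  by apply: (@integrable_bounded_test _ _ 2) => // z; have [] := col_lim_bound z.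
have i2 : mu.-integrable D (EFin \o (fun x => (col_lim c2 x).1 * partial 0 phi x)).
  by apply: (@integrable_bounded_test _ _ 2) => // z; have [] := col_lim_bound z.
have w0 := weak_gradientX t1 0; have w1 := weak_gradientX t0 1.
have comm : \int[mu]_(x in D) (X x * partial 1 (partial 0 phi) x) =
    \int[mu]_(x in D) (X x * partial 0 (partial 1 phi) x).
  apply: eq_Rintegral => x _.
  exact: (congr1 (fun t => X x * t) (partial_comm 1 0 x tphi)).
have g0 : \int[mu]_(x in D) (gradX x 0 0 * partial 1 phi x) =
    \int[mu]_(x in D) ((col_lim c1 x).1 * partial 1 phi x).
  by apply: eq_Rintegral => x _; rewrite mxE.
have g1 : \int[mu]_(x in D) (gradX x 1 0 * partial 0 phi x) =
    \int[mu]_(x in D) ((col_lim c2 x).1 * partial 0 phi x).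
  by apply: eq_Rintegral => x _; rewrite mxE.
have eq_sub (a b : R) : a = b -> a - b = 0 by move=> ->; exact: subrr.
apply: (etrans (RintegralB mD i1 i2)); apply: eq_sub.
apply: (etrans (esym g0) (etrans _ g1)); apply: oppr_inj.
exact: (etrans (esym w0) (etrans (esym comm) w1)).
Qed.

(** Away from the real axis the map is the identity, so the solution is the second coordinate on a
    square of positive measure around (0, 3/4). *)
Lemma flat_map_nonzero : ~ {ae mu, forall x, D x -> Y x = 0}.
Proof.
move=> [N [mN N0 sN]]; pose q : R * R := (0, 3 / 4).
have h0 : 0 <= 1 / 8 :> R by lra.
have sub : square q (1 / 8) `<=` N.
  move=> z /squareE zq; apply: sN => /= h; move: zq.
  rewrite prod_normE ge_max /= !ler_norml => /andP[/andP[? ?] /andP[? ?]].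
  have z2 : 1 / 2 <= `|z.2| by rewrite ger0_norm; lra.
  have : Y z = 0.
    by apply: h; rewrite /D /eball/= edist_lt//= !sub0r !sqrrN; nra.
  by rewrite (flat_outside fm z2); lra.
have h1 : (mu (square q (1 / 8)) <= 0%:E)%E.
  rewrite -[leRHS](N0 : mu N = 0%:E); apply: le_measure; rewrite ?inE//.
  exact: square_measurable.
by move: h1; rewrite square_measure// lee_fin leNgt exprn_gt0// mulr_gt0//; lra.
Qed.

End solution.

Theorem propositionA1 (R : realType) :
  exists (A : R * R -> 'M[R]_2) (u : R * R -> R) (lambda Lambda : R),
    let B2 : set (R * R) := eball (0, 0) 2 in
    let B1 : set (R * R) := eball (0, 0) 1 in
    [/\ {within B2, continuous A},
        (forall x, B2 x -> (A x)^T = A x),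
        sobolev_W12 B2 u,
        ~ {ae (@plane_measure R), forall x, B2 x -> u x = 0} &
        0 < lambda /\ 0 < Lambda] /\
    [/\ (forall x, B2 x ->
           loewner_le ((1 + lambda)^-1)%:M (A x) /\
           loewner_le (A x) (1 + lambda)%:M),
        weak_solution B2 A u,
        (forall (x : R * R) (r : R), 0 < r -> eball x (2 * r) `<=` B2 ->
           average (eball x (2 * r)) (fun y => u y ^+ 2) <=
           4 `^ Lambda * average (eball x r) (fun y => u y ^+ 2)) &
        exists2 v : R * R -> R, continuous_representative B2 u v &
          hausdorff1 (nodal_set B2 v `&` B1) = +oo%E].
Proof.
have [X [Y [F [c1 [c2 [S [e fm]]]]]]] := flat_map_exists R.
(* The ellipticity constant 1 is that of [coefficient_elliptic], the exponent 10 that of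
   [flat_map_doubling]. *)
exists (coefficient Y c1 c2), Y, 1, 10 => B2 B1; split; split.
- exact: continuous_subspaceT (coefficient_continuous fm).
- by move=> x _; exact: coefficient_sym.
- split; first exact: square_integrableY fm.
  by exists (gradY c1 c2); exact: L2_gradY fm.
- exact: flat_map_nonzero fm.
- by [].
- by move=> x _; exact: coefficient_elliptic fm x.
- exact: flat_map_weak_solution fm.
- move=> x r r0 sub; apply: (flat_map_doubling fm) => //; exact: eball_radius sub.
- exists Y; last exact: flat_map_nodal_length fm.
  by split; [exact: continuous_subspaceT (flat_continuous fm).2|exact: aeW].
Qed.
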